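(* Consider the controlled stochastic transport equation with both controls $u,\ell$ outside the diffusion term: $$ \left\{\begin{array}{ll} dy+U\cdot\nabla y\,dt=\Big[a_1y+\int_{S^{d-1}}a_2(t,x,U,V)y(t,x,V)\,dS^{d-1}(V)+f+\ell\Big]dt+a_3y\,dB(t) & \text{in }(0,T)\times G\times S^{d-1},\\ y=u & \text{on }(0,T)\times\Gamma_S^-,\\ y(0)=y_0 & \text{in }G\times S^{d-1}. \end{array}\right. $$ This system is not exactly controllable for any $T>0$. That is, for every $T>0$ it is not true that for every $y_0\in L^2(G\times S^{d-1})$ and $y_1\in L^2(\Omega,\mathcal F_T,P;L^2(G\times S^{d-1}))$ there is a pair of controls $(u,\ell)\in L^2_{\mathcal F}(0,T;L^2_w(\Gamma_S^-))\times L^2_{\mathcal F}(0,T;L^2(G\times S^{d-1}))$ for which the solution with $y(0)=y_0$ satisfies $y(T)=y_1$.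
   Context: **Geometry.** $d\in\mathbb N$, $G\subset\mathbb R^d$ is a strictly convex bounded domain with $C^1$ boundary $\Gamma$, $\nu(x)$ is the unit outward normal at $x\in\Gamma$, and $S^{d-1}=\{x\in\mathbb R^d:|x|=1\}$ with surface measure $dS^{d-1}$. Set $\Gamma_S^-=\{(x,U)\in\Gamma\times S^{d-1}:U\cdot\nu(x)\le 0\}$ and $\Gamma_S^+=(\Gamma\times S^{d-1})\setminus\Gamma_S^-$. $L^2_w(\Gamma_S^-)$ is the Hilbert space obtained as the completion of the smooth compactly supported functions on $\Gamma_S^-$ under the norm $|h|_{L^2_w(\Gamma_S^-)}=\big(-\int_{\Gamma_S^-}U\cdot\nu\,|h|^2\,d\Gamma_S^-\big)^{1/2}$ (the $L^2$ space on $\Gamma_S^-$ with weight $-U\cdot\nu$). $\nabla$ is the gradient in $x$. **Probability.** $(\Omega,\mathcal F,\{\mathcal F_t\}_{t\ge0},P)$ is a complete filtered probability space carrying a one-dimensional standard Brownian motion $B$, where $\{\mathcal F_t\}$ is the natural filtration of $B$ augmented by all $P$-null sets. For a Banach space $H$: $L^2_{\mathcal F}(0,T;H)$ is the space of $H$-valued adapted processes $X$ with $\mathbb E|X|^2_{L^2(0,T;H)}<\infty$; $L^\infty_{\mathcal F}(0,T;H)$ is the space of $H$-valued adapted bounded processes; $L^2_{\mathcal F}(\Omega;C([0,T];H))$ is the space of $H$-valued adapted continuous processes with $\mathbb E|X|^2_{C([0,T];H)}<\infty$; $L^\infty_{\mathcal F}(\Omega;C([0,T];H))$ is the space of $H$-valued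 adapted continuous processes whose $C([0,T];H)$-norm is essentially bounded on $\Omega$. **Data.** $a_1,a_3\in L^\infty_{\mathcal F}(0,T;L^\infty(G\times S^{d-1}))$, $a_2\in L^\infty_{\mathcal F}(\Omega;C([0,T];C(\overline G\times S^{d-1}\times S^{d-1})))$, $f\in L^2_{\mathcal F}(0,T;L^2(G\times S^{d-1}))$ are given. **Solution.** For $y_0\in L^2(G\times S^{d-1})$, $u\in L^2_{\mathcal F}(0,T;L^2_w(\Gamma_S^-))$ and $\ell\in L^2_{\mathcal F}(0,T;L^2(G\times S^{d-1}))$, a solution is a process $y\in L^2_{\mathcal F}(\Omega;C([0,T];L^2(G\times S^{d-1})))$ such that for every $t\in[0,T]$ and every $\phi\in C^1(\overline G\times S^{d-1})$ with $\phi=0$ on $\Gamma_S^+$, $P$-a.s., $$ \begin{aligned} &\int_G\int_{S^{d-1}}y(t)\phi\,dS^{d-1}dx-\int_G\int_{S^{d-1}}y_0\phi\,dS^{d-1}dx-\int_0^t\int_G\int_{S^{d-1}}y\,U\cdot\nabla\phi\,dS^{d-1}dxds+\int_0^t\int_{\Gamma_S^-}u\,\phi\,U\cdot\nu\,d\Gamma_S^-ds\\ &=\int_0^t\int_G\int_{S^{d-1}}(a_1y+f+\ell)\phi\,dS^{d-1}dxds+\int_0^t\int_G\int_{S^{d-1}}\Big[\int_{S^{d-1}}a_2(s,x,U,V)y(s,x,V)\,dS^{d-1}(V)\Big]\phi(x,U)\,dS^{d-1}(U)dxds\\ &\quad+\int_0^t\int_G\int_{S^{d-1}}a_3y\,\phi\,dS^{d-1}dx\,dB(s).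 \end{aligned} $$ The system has a unique solution for all such data. *)

(* Defs.v *)
From HB Require Import structures.
From mathcomp Require Import all_boot all_order all_algebra.
From mathcomp Require Import all_classical all_reals all_analysis.
From mathcomp Require Import measurable_realfun.

Set Implicit Arguments.
Unset Strict Implicit.
Unset Printing Implicit Defensive.
Import Order.TTheory GRing.Theory Num.Theory.
Import numFieldNormedType.Exports.

Local Open Scope classical_set_scope.
Local Open Scope ring_scope.

(* The sigma-algebra of R^n is generated by the coordinates, as for tuples; it
   is the Borel sigma-algebra. *)
Section measurable_rV.
Context (R : realType) (n : nat).

Let coors : 'I_n -> 'rV[R]_n -> R := fun i x => x ord0 i.

Let rV_set0 : g_sigma_preimage coors set0.
Proof. exact: sigma_algebra0. Qed.

Let rV_setC A : g_sigma_preimage coors A -> g_sigma_preimage coors (~` A).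
Proof. exact: sigma_algebraC. Qed.

Let rV_bigcup (F : _^nat) : (forall i, g_sigma_preimage coors (F i)) ->
  g_sigma_preimage coors (\bigcup_i (F i)).
Proof. exact: sigma_algebra_bigcup. Qed.

HB.instance Definition _ := @isMeasurable.Build default_measure_display
  'rV[R]_n (g_sigma_preimage coors) rV_set0 rV_setC rV_bigcup.

Lemma measurable_coord_rV (i : 'I_n) :
  measurable_fun [set: 'rV[R]_n] (fun x => x ord0 i).
Proof.
move=> _ Y mY; rewrite setTI; apply: sub_sigma_algebra => /=.
rewrite -bigcup_seq/=; exists i => /=; first by rewrite mem_index_enum.
by exists Y => //; rewrite setTI.
Qed.

Lemma measurable_fun_rVP d (T : measurableType d) (f : T -> 'rV[R]_n) :
  (forall i, measurable_fun setT (fun x => f x ord0 i)) ->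
  measurable_fun setT f.
Proof.
move=> mf _ Y; rewrite setTI; move: Y; apply: smallest_sub.
  split => [|A|F] /=.
  - by rewrite preimage_set0.
  - by rewrite setTD preimage_setC; exact: measurableC.
  - by move=> mF; rewrite preimage_bigcup; exact: bigcupT_measurable.
move=> A; rewrite -bigcup_seq/= => -[i _ [B mB <-]].
rewrite setTI; have := mf i measurableT B mB.
by rewrite setTI.
Qed.

End measurable_rV.

Section lebesgue_rV.
Context (R : realType).

Definition cons_rV n (p : R * 'rV[R]_n) : 'rV[R]_n.+1 :=
  \row_i (if unlift ord0 i is Some j then p.2 ord0 j else p.1).

Fixpoint lebesgue_rV n : set 'rV[R]_n -> \bar R :=
  match n return set 'rV[R]_n -> \bar R with
  | 0%N => dirac (0 : 'rV[R]_0)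
  | m.+1 => pushforward
      (product_measure1 (@lebesgue_measure R) (lebesgue_rV (n := m)))
      (@cons_rV m)
  end.

Lemma measurable_cons_rV n : measurable_fun setT (@cons_rV n).
Proof.
apply: measurable_fun_rVP => i; rewrite /cons_rV.
case: (unliftP ord0 i) => [j|] ->.
- rewrite (_ : (fun x => _) = (fun x : 'rV[R]_n => x ord0 j) \o snd); last first.
    by apply/funext => x /=; rewrite mxE liftK.
  by apply: measurableT_comp => //; exact: measurable_coord_rV.
- rewrite (_ : (fun x => _) = fst)//.
  by apply/funext => x /=; rewrite mxE unlift_none.
Qed.

Lemma cons_rV_surj n (x : 'rV[R]_n.+1) :
  x = cons_rV (x ord0 ord0, \row_j x ord0 (lift ord0 j)).
Proof.
apply/rowP => i; rewrite !mxE.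
by case: (unliftP ord0 i) => [j|] ->; rewrite ?liftK ?unlift_none ?mxE.
Qed.

Lemma lebesgue_rV_subproof n :
  [/\ @lebesgue_rV n set0 = 0%E,
      forall A, (0 <= @lebesgue_rV n A)%E,
      semi_sigma_additive (@lebesgue_rV n) &
      sigma_finite setT (@lebesgue_rV n)].
Proof.
elim: n => [|n [m0 m_ge0 m_add m_fin]].
  split => //=; first exact: measure_semi_sigma_additive.
  exact: (sigma_finiteT (dirac (0 : 'rV[R]_0) : {finite_measure set _ -> \bar R})).
pose m_inst := isMeasure.Build _ _ _ _ m0 m_ge0 m_add.
pose m : {measure set 'rV[R]_n -> \bar R} :=
  HB.pack (@lebesgue_rV n) m_inst.
pose ms_inst := @Measure_isSigmaFinite.Build _ _ _ (m : set _ -> \bar R) m_fin.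
pose ms : {sigma_finite_measure set 'rV[R]_n -> \bar R} :=
  HB.pack (@lebesgue_rV n) m_inst ms_inst.
pose L : {measure set _ -> \bar R} := ((@lebesgue_measure R) \x ms)%E.
have E : @lebesgue_rV n.+1 = pushforward L (@cons_rV n) by [].
have mc := @measurable_cons_rV n.
have [F FT Ff] : sigma_finite setT L.
  have /sigma_finiteP[F [TF ndF Foo]] := sigma_finiteT (@lebesgue_measure R).
  have /sigma_finiteP[G [TG ndG Goo]] := sigma_finiteT ms.
  exists (fun n => F n `*` G n).
    rewrite -setXTT TF TG predeqE => -[x y]; split.
      move=> [/= [i _ Fx] [k _ Gy]]; exists (maxn i k) => //; split.
      - by move: x Fx; exact/subsetPset/ndF/leq_maxl.
      - by move: y Gy; exact/subsetPset/ndG/leq_maxr.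
    by move=> [i _ []/= ? ?]; split; exists i.
  move=> k; have [? ?] := Foo k; have [? ?] := Goo k.
  split; first exact: measurableX.
  rewrite [ltLHS](product_measure1E (@lebesgue_measure R) ms)//.
  by rewrite lte_mul_pinfty// ge0_fin_numE.
rewrite E; split => //.
- by rewrite /pushforward preimage_set0; exact: measure0.
- by move=> A; exact: measure_ge0.
- move=> F' mF tF mUF; rewrite /pushforward preimage_bigcup.
  apply: measure_semi_sigma_additive.
  + by move=> k; rewrite -[X in measurable X]setTI; exact: mc.
  + apply/trivIsetP => /= i j _ _ ij; rewrite -preimage_setI.
    by move/trivIsetP : tF => /(_ _ _ _ _ ij) ->//; rewrite preimage_set0.
  + by rewrite -preimage_bigcup -[X in measurable X]setTI; exact: mc.
- pose uncons (x : 'rV[R]_n.+1) := (x ord0 ord0, \row_j x ord0 (lift ord0 j)).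
  have consK : cancel (@cons_rV n) uncons.
    move=> [a x]; congr pair => /=; first by rewrite mxE unlift_none.
    by apply/rowP => j; rewrite !mxE liftK.
  have mu : measurable_fun setT uncons.
    apply/measurable_fun_pairP; split; first exact: measurable_coord_rV.
    apply: measurable_fun_rVP => j.
    rewrite (_ : (fun x => _) = (fun x : 'rV[R]_n.+1 => x ord0 (lift ord0 j))).
      exact: measurable_coord_rV.
    by apply/funext => x /=; rewrite mxE.
  exists (fun k => uncons @^-1` F k).
    by rewrite -preimage_bigcup -FT preimage_setT.
  move=> k; have [mFk Fkoo] := Ff k; split.
    by rewrite -[X in measurable X]setTI; exact: mu.
  rewrite /pushforward -comp_preimage (_ : uncons \o _ = id)//.
  by apply/funext => x /=; rewrite consK.
Qed.

HB.instance Definition _ n := isMeasure.Build _ _ _ (@lebesgue_rV n)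
  (let: And4 h _ _ _ := lebesgue_rV_subproof n in h)
  (let: And4 _ h _ _ := lebesgue_rV_subproof n in h)
  (let: And4 _ _ h _ := lebesgue_rV_subproof n in h).

HB.instance Definition _ n := @Measure_isSigmaFinite.Build _ _ _
  (@lebesgue_rV n) (let: And4 _ _ _ h := lebesgue_rV_subproof n in h).

End lebesgue_rV.

Section euclidean.
Context (R : realType).

Definition dotrv n (x y : 'rV[R]_n) : R := \sum_i x ord0 i * y ord0 i.

(* The norm of 'rV[R]_n in the library is the sup norm. *)
Definition enorm n (x : 'rV[R]_n) : R := Num.sqrt (dotrv x x).

Definition sphere n : set 'rV[R]_n := [set x | enorm x = 1].

Definition unit_ball n : set 'rV[R]_n := [set x | enorm x <= 1].

(* Surface measure of the unit sphere of R^n: sigma(A) = n |{r u : u in A,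
   0 < r <= 1}|, i.e., the measure sigma such that |.| = r^(n-1) dr dsigma in
   polar coordinates; for n = 1 it is the counting measure of {-1, 1}. *)
Definition sphere_measure n (A : set 'rV[R]_n) : \bar R :=
  (n%:R%:E * lebesgue_rV
    [set x | (0 < enorm x <= 1)%R /\ A ((enorm x)^-1 *: x)%R])%E.

Lemma measurable_enorm n : measurable_fun setT (@enorm n).
Proof.
have mdot : measurable_fun setT (fun x : 'rV[R]_n => dotrv x x).
  apply: measurable_sum => i.
  by apply: measurable_funM; exact: measurable_coord_rV.
apply: (measurableT_comp _ mdot).
exact: (continuous_measurable_fun (@sqrt_continuous R)).
Qed.

Lemma measurable_unit_ball n : measurable (@unit_ball n).
Proof.
rewrite (_ : @unit_ball n = @enorm n @^-1` `]-oo, 1]%classic).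
  rewrite -[X in measurable X]setTI.
  exact: (@measurable_enorm n).
by apply/seteqP; split => x; rewrite /unit_ball/= in_itv.
Qed.

Lemma lebesgue_unit_ball_lty n : (lebesgue_rV (@unit_ball n) < +oo)%E.
Proof.
pose box k := [set x : 'rV[R]_k | forall i, x ord0 i \in `[-1, 1]].
have mbox k : measurable (box k).
  rewrite (_ : box k = \bigcap_(i in [set: 'I_k])
      ((fun x : 'rV[R]_k => x ord0 i) @^-1` `[-1, 1]%classic)).
    apply: fin_bigcap_measurable => // i _.
    rewrite -[X in measurable X]setTI.
    exact: (@measurable_coord_rV R k i).
  by apply/seteqP; split => x /= + i => /(_ i)//; exact.
have box_lty k : (lebesgue_rV (box k) < +oo)%E.
  elim: k => [|k IH].
    rewrite /= diracE; exact: ltry.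
  rewrite /= /pushforward.
  rewrite (_ : _ @^-1` _ = `[-1, 1]%classic `*` box k); last first.
    apply/seteqP; split => [[a x] /= H|[a x] /= [Ha Hx] i].
      split => [|i].
        by have := H ord0; rewrite mxE unlift_none.
      by have := H (lift ord0 i); rewrite mxE liftK.
    rewrite mxE; case: (unliftP ord0 i) => [j _|_] //=.
  rewrite [ltLHS](product_measure1E (@lebesgue_measure R) (@lebesgue_rV R k))//=;
    last exact: mbox.
  have I_lty : (lebesgue_measure (`[(-1)%R, 1%R]%classic : set R) < +oo)%E.
    by rewrite lebesgue_measure_itv/=; case: ifP => _; rewrite -?EFinB ltry.
  by rewrite lte_mul_pinfty// ge0_fin_numE.
apply: le_lt_trans (box_lty n).
apply: le_measure; rewrite ?inE//; first exact: measurable_unit_ball.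
move=> x; rewrite /unit_ball/= => x1 i.
rewrite in_itv/= -ler_norml -sqrtr_sqr (le_trans _ x1)//.
rewrite ler_sqrt; last by apply: sumr_ge0 => j _; rewrite -expr2 sqr_ge0.
rewrite expr2 /dotrv (bigD1 i)//= lerDl.
by apply: sumr_ge0 => j _; rewrite -expr2 sqr_ge0.
Qed.

Lemma sphere_measure_subproof n :
  [/\ @sphere_measure n set0 = 0%E,
      forall A, (0 <= @sphere_measure n A)%E,
      semi_sigma_additive (@sphere_measure n) &
      fin_num_fun (@sphere_measure n)].
Proof.
pose D := [set x : 'rV[R]_n | 0 < enorm x <= 1].
have mD : measurable D.
  rewrite (_ : D = @enorm n @^-1` `]0, 1]%classic).
    rewrite -[X in measurable X]setTI.
    exact: (@measurable_enorm n).
  by apply/seteqP; split => x; rewrite /D/= in_itv.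
pose f (x : 'rV[R]_n) := (enorm x)^-1 *: x.
have mf : measurable_fun setT f.
  apply: measurable_fun_rVP => i.
  rewrite (_ : (fun x => _) = fun x : 'rV[R]_n => (enorm x) `^ (-1) * x ord0 i).
    apply: measurable_funM; last exact: measurable_coord_rV.
    exact: (measurableT_comp (@measurable_powR R (-1)) (@measurable_enorm n)).
  by apply/funext => x; rewrite /f mxE powR_inv1// sqrtr_ge0.
pose m : {measure set _ -> \bar R} :=
  mscale (NngNum (ler0n R n)) (mrestr (@lebesgue_rV R n) mD).
have E : @sphere_measure n = pushforward m f.
  apply/funext => A; rewrite /m /mscale /pushforward /mrestr /sphere_measure /=.
  congr (_ * lebesgue_rV _)%E.
  by apply/seteqP; split => x /= -[].
rewrite E; split.
- by rewrite /pushforward preimage_set0; exact: measure0.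
- by move=> A; exact: measure_ge0.
- move=> F mF tF mUF; rewrite /pushforward preimage_bigcup.
  apply: measure_semi_sigma_additive.
  + by move=> k; rewrite -[X in measurable X]setTI; exact: mf.
  + apply/trivIsetP => /= i j _ _ ij; rewrite -preimage_setI.
    by move/trivIsetP : tF => /(_ _ _ _ _ ij) ->//; rewrite preimage_set0.
  + by rewrite -preimage_bigcup -[X in measurable X]setTI; exact: mf.
- move=> A mA; rewrite ge0_fin_numE; last exact: measure_ge0.
  rewrite /pushforward /m/= /mscale/= /mrestr lte_mul_pinfty ?lee_fin//.
  apply: le_lt_trans (lebesgue_unit_ball_lty n).
  apply: le_measure; rewrite ?inE//.
  + apply: measurableI => //.
    by rewrite -[X in measurable X]setTI; exact: mf.
  + exact: measurable_unit_ball.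
  + by move=> x [_ /andP[]].
Qed.

HB.instance Definition _ n := isMeasure.Build _ _ _ (@sphere_measure n)
  (let: And4 h _ _ _ := sphere_measure_subproof n in h)
  (let: And4 _ h _ _ := sphere_measure_subproof n in h)
  (let: And4 _ _ h _ := sphere_measure_subproof n in h).

HB.instance Definition _ n := Measure_isFinite.Build _ _ _ (@sphere_measure n)
  (let: And4 _ _ _ h := sphere_measure_subproof n in h).

Definition diam n (A : set 'rV[R]_n) : \bar R :=
  ereal_sup [set (enorm (p.1 - p.2))%:E | p in A `*` A].

(* The test on set0 matters for k = 0, where (diam / 2)^0 = 1. *)
Definition hausdorff_gauge n k (A : set 'rV[R]_n) : \bar R :=
  (if A == set0 then 0
   else lebesgue_rV (@unit_ball k) * (2^-1%:E * diam A) ^+ k)%E.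

(* The k-dimensional Hausdorff outer measure on R^n, normalized by the volume
   of the unit ball of R^k; for k = n - 1 its restriction to the Borel subsets
   of a C^1 hypersurface is the surface measure. *)
Definition hausdorff n k (A : set 'rV[R]_n) : \bar R :=
  ereal_sup [set ereal_inf
      [set (\sum_(i <oo) hausdorff_gauge k (C i))%E | C in
        [set C : (set 'rV[R]_n)^nat | A `<=` \bigcup_i C i /\
          forall i, (diam (C i) <= delta%:E)%E]]
    | delta in [set delta : R | 0 < delta]].

End euclidean.

Section domain.
Context (R : realType).

(* f is of class C^1 on the open set N; v ranges over all directions, so in
   finite dimension this amounts to continuous partial derivatives. *)
Definition C1_on (V : normedModType R) (N : set V) (f : V -> R) : Prop :=
  forall x, N x -> forall v,
    derivable f x v /\ {for x, continuous (fun z => 'D_v f z)}.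

Definition grad n (f : 'rV[R]_n -> R) (x : 'rV[R]_n) : 'rV[R]_n :=
  \row_i 'D_(delta_mx ord0 i) f x.

Definition boundary n (G : set 'rV[R]_n) : set 'rV[R]_n :=
  closure G `\` interior G.

Definition strictly_convex n (G : set 'rV[R]_n) : Prop :=
  forall x y, closure G x -> closure G y -> x != y ->
  forall t : R, 0 < t < 1 -> interior G (t *: x + (1 - t) *: y).

Definition local_defining_function n (G : set 'rV[R]_n) (x : 'rV[R]_n)
    (N : set 'rV[R]_n) (rho : 'rV[R]_n -> R) : Prop :=
  [/\ open N, N x, C1_on N rho, grad rho x != 0 &
      G `&` N = [set z | rho z < 0] `&` N].

Definition C1_boundary n (G : set 'rV[R]_n) : Prop :=
  forall x, boundary G x -> exists N rho, local_defining_function G x N rho.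

Record strictly_convex_C1_domain n (G : set 'rV[R]_n) : Prop := {
  domain_nonempty : G !=set0 ;
  domain_open : open G ;
  domain_connected : connected G ;
  domain_bounded : bounded_set G ;
  domain_strictly_convex : strictly_convex G ;
  domain_C1_boundary : C1_boundary G }.

(* The unit outward normal is grad rho / |grad rho| for any local defining
   function rho of G at x in the boundary. *)
Definition outward_normal n (G : set 'rV[R]_n) (x : 'rV[R]_n) : 'rV[R]_n :=
  xget 0 [set v | exists N rho, local_defining_function G x N rho /\
                    v = (enorm (grad rho x))^-1 *: grad rho x].

End domain.

Section phase_space.
Context (R : realType) (d : nat) (G : set 'rV[R]_d).

Local Notation X := ('rV[R]_d * 'rV[R]_d)%type.

(* U . nu(x) at z = (x, U) *)
Definition normal_speed (z : X) : R := dotrv z.2 (outward_normal G z.1).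

Definition GammaS_minus : set X :=
  [set z | [/\ boundary G z.1, sphere z.2 & normal_speed z <= 0]].

Definition GammaS_plus : set X :=
  (boundary G `*` @sphere R d) `\` GammaS_minus.

Definition GS : set X := G `*` @sphere R d.

Definition mu_GS : set X -> \bar R :=
  (@lebesgue_rV R d \x @sphere_measure R d)%E.

HB.instance Definition _ := Measure.on mu_GS.

(* The product surface measure of Gamma x S^(d-1). It is the set function
   A |-> \int sigma(A_x) dH^(d-1)(x), which is a measure on the Borel subsets of
   Gamma x S^(d-1); integrals only evaluate it on measurable sets. *)
Definition mu_GammaS : set X -> \bar R :=
  (@hausdorff R d d.-1 \x @sphere_measure R d)%E.

(* Functions on G x S^(d-1) and on GammaS^- are represented by functions on
   R^d x R^d, of which only the restrictions to these sets matter; L^2 classes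
   are represented by square integrable functions. *)
Definition sqnorm_GS (h : X -> R) : \bar R :=
  (\int[mu_GS]_(z in GS) (h z ^+ 2)%:E)%E.

Definition sqnorm_w (h : X -> R) : \bar R :=
  (\int[mu_GammaS]_(z in GammaS_minus) (- normal_speed z * h z ^+ 2)%:E)%E.

Definition L2_GS (h : X -> R) : Prop :=
  measurable_fun GS h /\ (sqnorm_GS h < +oo)%E.

(* phi in C^1(closure G x S^(d-1)), i.e., the restriction of a C^1 function on
   R^d x R^d, with phi = 0 on GammaS^+. *)
Definition test_function (phi : X -> R) : Prop :=
  C1_on setT phi /\ forall z, GammaS_plus z -> phi z = 0.

(* U . grad_x phi(x, U) *)
Definition transport (phi : X -> R) (z : X) : R :=
  dotrv z.2 (grad (fun x => phi (x, z.2)) z.1).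

End phase_space.

Section stochastic.
Context (R : realType) (dO : measure_display) (Omega : measurableType dO).
Context (P : probability Omega R) (B : R -> Omega -> R).

(* Generators of the natural filtration of B augmented by the P-null sets. *)
Definition filtration_gen (t : R) : set (set Omega) :=
  [set A | (exists s C, [/\ 0 <= s <= t, measurable C & A = B s @^-1` C])
           \/ P.-negligible A].

Definition filtration (t : R) : measurableType _ :=
  g_sigma_algebraType (filtration_gen t).

Definition brownian_motion : Prop :=
  [/\ forall t, 0 <= t -> measurable_fun setT (B t),
      {ae P, forall w, B 0 w = 0},
      {ae P, forall w, {within `[0, +oo[, continuous (fun t => B t w)}},
      forall s t, 0 <= s < t -> forall C, measurable C ->
        P [set w | C (B t w - B s w)] = normal_prob 0 (Num.sqrt (t - s)) C &
      forall s t, 0 <= s < t -> forall A C,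
        (measurable : set (set (filtration s))) A -> measurable C ->
        P (A `&` [set w | C (B t w - B s w)]) =
        (P A * P [set w | C (B t w - B s w)%R])%E].

(* Ito integral over [0, t], defined as the L^2(Omega)-limit of the integrals
   of simple adapted processes. *)
Record simple_process (t : R) := SimpleProcess {
  sp_size : nat ;
  sp_time : nat -> R ;
  sp_coef : nat -> Omega -> R ;
  sp_time_start : sp_time 0 = 0 ;
  sp_time_end : sp_time sp_size = t ;
  sp_time_le : forall i, (i < sp_size)%N -> sp_time i <= sp_time i.+1 ;
  sp_coef_adapted : forall i, (i < sp_size)%N ->
    measurable_fun [set: filtration (sp_time i)] (sp_coef i) ;
  sp_coef_bounded : forall i, (i < sp_size)%N ->
    exists M, forall w, `|sp_coef i w| <= M }.

Definition sp_eval t (H : simple_process t) (s : R) (w : Omega) : R :=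
  \sum_(i < sp_size H)
    sp_coef H i w * \1_(`]sp_time H i, sp_time H i.+1]) s.

Definition sp_integral t (H : simple_process t) (w : Omega) : R :=
  \sum_(i < sp_size H)
    sp_coef H i w * (B (sp_time H i.+1) w - B (sp_time H i) w).

Definition is_ito_integral (t : R) (h : R -> Omega -> R) (Z : Omega -> R)
    : Prop :=
  [/\ measurable_fun (`[0, t] `*` setT)
        (fun p : measurableTypeR R * Omega => h p.1 p.2),
      measurable_fun setT Z &
      exists H : nat -> simple_process t,
        (\int[P]_w \int[lebesgue_measure]_(s in `[0%R, t])
           ((sp_eval (H k) s w - h s w) ^+ 2)%:E)%E @[k --> \oo] --> 0%E /\
        (\int[P]_w ((sp_integral (H k) w - Z w) ^+ 2)%:E)%E
          @[k --> \oo] --> 0%E].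

Section processes.
Context (T : R) (dE : measure_display) (E : measurableType dE) (D : set E).

(* X : Omega -> E -> R is F_t-measurable, as a random function on D. *)
Definition F_measurable (t : R) (X : Omega -> E -> R) : Prop :=
  measurable_fun ([set: filtration t] `*` D)
    (fun p : filtration t * E => X p.1 p.2).

(* A process with values in a space of functions on D is represented by a
   jointly measurable function of (t, w, z). Adaptedness is measurability of
   (w, z) |-> X t w z for the product of F_t and the sigma-algebra of D, which
   for L^2 spaces is (strong) F_t-measurability of w |-> X t w up to the choice
   of representatives. *)
Definition adapted_process (X : R -> Omega -> E -> R) : Prop :=
  measurable_fun (`[0, T] `*` (setT `*` D))
    (fun p : measurableTypeR R * (Omega * E) => X p.1 p.2.1 p.2.2) /\
  forall t, 0 <= t <= T -> F_measurable t (X t).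

(* L^2_F(0, T; H), for the space H of functions on D of finite norm, where
   sqnorm is the square of the norm of H. *)
Definition L2F (sqnorm : (E -> R) -> \bar R) (X : R -> Omega -> E -> R)
    : Prop :=
  adapted_process X /\
  (\int[P]_w \int[lebesgue_measure]_(t in `[0%R, T]) sqnorm (X t w) < +oo)%E.

(* L^oo_F(0, T; L^oo(D, mu)) *)
Definition LinftyF (mu : {measure set E -> \bar R}) (X : R -> Omega -> E -> R)
    : Prop :=
  adapted_process X /\
  exists M, {ae lebesgue_measure, forall t, 0 <= t <= T ->
    {ae P, forall w, {ae mu, forall z, D z -> `|X t w z| <= M}}}.

(* L^2_F(Omega; C([0, T]; H)) *)
Definition L2FC (sqnorm : (E -> R) -> \bar R) (X : R -> Omega -> E -> R)
    : Prop :=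
  [/\ adapted_process X,
      {ae P, forall w, forall t, 0 <= t <= T ->
        (sqnorm (X t w) < +oo)%E /\
        sqnorm (fun z => X s w z - X t w z)
          @[s --> within `[0, T] (nbhs t)] --> 0%E} &
      (\int[P]_w ereal_sup [set sqnorm (X t w) | t in `[0%R, T]] < +oo)%E].

End processes.

(* L^oo_F(Omega; C([0, T]; C(K))), for K compact in R^n x R^n x R^n. *)
Definition LinftyFC (T : R) n (K : set ('rV[R]_n * 'rV[R]_n * 'rV[R]_n))
    (X : R -> Omega -> 'rV[R]_n * 'rV[R]_n * 'rV[R]_n -> R) : Prop :=
  [/\ adapted_process T K X,
      {ae P, forall w, forall t, 0 <= t <= T ->
        {within K, continuous (X t w)} /\
        forall e : R, 0 < e -> \forall s \near within `[0, T] (nbhs t),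
          forall z, K z -> `|X s w z - X t w z| <= e} &
      exists M, {ae P, forall w, forall t, 0 <= t <= T ->
        forall z, K z -> `|X t w z| <= M}].

Definition L2Omega (T : R) (dE : measure_display) (E : measurableType dE)
    (D : set E) (sqnorm : (E -> R) -> \bar R) (X : Omega -> E -> R) : Prop :=
  F_measurable D T X /\ (\int[P]_w sqnorm (X w) < +oo)%E.

End stochastic.

Section transport_equation.
Context (R : realType) (d : nat) (G : set 'rV[R]_d).
Context (dO : measure_display) (Omega : measurableType dO).
Context (P : probability Omega R) (B : R -> Omega -> R) (T : R).

Local Notation X := ('rV[R]_d * 'rV[R]_d)%type.
Local Notation mu := (@mu_GS R d).
Local Notation sigma := (@sphere_measure R d).
Local Notation leb := (@lebesgue_measure R).

Context (a1 : R -> Omega -> X -> R) (a2 : R -> Omega -> X * 'rV[R]_d -> R).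
Context (a3 f : R -> Omega -> X -> R).

Definition is_solution (y0 : X -> R) (u l y : R -> Omega -> X -> R) : Prop :=
  L2FC P B T (GS G) (sqnorm_GS G) y /\
  forall t, 0 <= t <= T -> forall phi, test_function G phi ->
  exists Z, is_ito_integral P B t
      (fun s w => \int[mu]_(z in GS G) (a3 s w z * y s w z * phi z)) Z /\
    {ae P, forall w,
      \int[mu]_(z in GS G) (y t w z * phi z)
      - \int[mu]_(z in GS G) (y0 z * phi z)
      - \int[leb]_(s in `[0, t]) \int[mu]_(z in GS G)
          (y s w z * transport phi z)
      + \int[leb]_(s in `[0, t]) fine (\int[@mu_GammaS R d]_(z in GammaS_minus G)
          (u s w z * phi z * normal_speed G z)%:E)
      = \int[leb]_(s in `[0, t]) \int[mu]_(z in GS G)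
          ((a1 s w z * y s w z + f s w z + l s w z) * phi z)
      + \int[leb]_(s in `[0, t]) \int[mu]_(z in GS G)
          ((\int[sigma]_(V in @sphere R d) (a2 s w (z, V) * y s w (z.1, V)))
           * phi z)
      + Z w}.

Definition exactly_controllable : Prop :=
  forall y0, L2_GS G y0 ->
  forall y1, L2Omega P B T (GS G) (sqnorm_GS G) y1 ->
  exists u l y,
    [/\ L2F P B T (GammaS_minus G) (sqnorm_w G) u,
        L2F P B T (GS G) (sqnorm_GS G) l,
        is_solution y0 u l y &
        {ae P, forall w, {ae mu, forall z, GS G z -> y T w z = y1 w z}}].

End transport_equation.

(* Main.v *)
From HB Require Import structures.
Require Import Defs.
From mathcomp Require Import all_boot all_order all_algebra.
From mathcomp Require Import all_classical all_reals all_analysis.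
From mathcomp Require Import measurable_realfun.
From mathcomp Require Import ring lra.

Set Implicit Arguments.
Unset Strict Implicit.
Unset Printing Implicit Defensive.
Import Order.TTheory GRing.Theory Num.Theory.
Import numFieldNormedType.Exports.
Local Open Scope classical_set_scope.
Local Open Scope ring_scope.

(** Test the equation at time [T], with initial state 0, against a function [phi]
of [x] alone that is supported inside [G]. The boundary control then drops out,
and the real random variable obtained by integrating [y(T) phi] over the phase
space is a sum of drift terms, i.e., time integrals over [[0, T]] of adapted
square integrable processes (the control [l] enters here), and of one Ito
integral, whose integrand [h] contains no control and satisfies
[E h(s)^2 <= kappa] for almost every [s], because [a3] is bounded and the state
is bounded in mean square uniformly in time.

Such a variable cannot depend strongly on the last increments of [B]. Let [eps]
be the sign of an increment of [B] over an interval starting at [t < T]. It is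
bounded, centred and independent of [F_t]. In the expectation of [eps] times a
drift term, the times [s <= t] contribute nothing and the others contribute
[O(sqrt (T - t))] by the Cauchy-Schwarz inequality
([integral_incr_sg_drift_le], [integral_incr_sg_scattering_le]); in the
expectation of [eps] times the Ito integral, the integral over [[0, t]]
contributes nothing and the integral over [[t, T]] has an [L^2] norm
[O(sqrt (T - t))] ([integral_incr_sg_ito_le],
[integral_incr_sg_diffusion_le]). So the variable obtained from any reachable
state satisfies [correlation_decay].

The state [y1 = xi phi] violates this bound, where [xi] is the sum of the
[3^-k eps_k] and [eps_k] is the sign of the increment over [[t_k, t_(k+1)]] for
[t_k = T (1 - 16^-k)]. Indeed [xi] is bounded and [F_T]-measurable, and
[E (eps_n xi) >= 3^-n / 2] ([sign_series_correlation]), whereas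
[sqrt (T - t_n) = 4^-n sqrt T]. *)

(** * Square integrable functions and iterated integrals *)

(** Integrate [|f| <= e + f^2 / e]. Used with an [e] adapted to the situation, this
    replaces the Cauchy-Schwarz inequality. *)
Lemma integral_abs_le_sq d (T : measurableType d) (R : realType)
    (m : {measure set T -> \bar R}) (D : set T) (f : T -> R) (e : R) :
  measurable D -> measurable_fun D f -> 0 < e ->
  (\int[m]_(x in D) `|f x|%:E <=
   e%:E * m D + e^-1%:E * \int[m]_(x in D) (f x ^+ 2)%:E)%E.
Proof.
move=> mD mf e0; rewrite -integral_cst// -ge0_integralZl//; last 3 first.
- by apply/measurable_EFinP; exact: measurable_funX.
- by move=> x _; rewrite lee_fin sqr_ge0.
- by rewrite lee_fin invr_ge0 ltW.
rewrite -ge0_integralD//; last 3 first.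
- by move=> x _ /=; rewrite lee_fin ltW.
- by move=> x _; rewrite -EFinM lee_fin mulr_ge0 ?sqr_ge0// invr_ge0 ltW.
- apply/measurable_EFinP; apply: measurable_funM => //.
  exact: measurable_funX.
apply: ge0_le_integral => //.
- by apply/measurable_EFinP; exact: measurableT_comp.
- apply/measurable_EFinP; apply: measurable_funD => //.
  apply: measurable_funM => //; exact: measurable_funX.
move=> x _ /=; rewrite -EFinM -EFinD lee_fin.
rewrite -(ler_pM2l e0) mulrDr mulrA mulfV ?gt_eqF// mul1r -expr2.
have := sqr_ge0 (e - `|f x|); rewrite sqrrB real_normK ?num_real//.
have := sqr_ge0 (e + `|f x|); rewrite sqrrD real_normK ?num_real//.
lra.
Qed.

Lemma integral_sqD_le d (T : measurableType d) (R : realType)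
    (m : {measure set T -> \bar R}) (D : set T) (f g : T -> R) :
  measurable D -> measurable_fun D f -> measurable_fun D g ->
  (\int[m]_(x in D) ((f x + g x) ^+ 2)%:E <=
   2%:E * \int[m]_(x in D) (f x ^+ 2)%:E + 2%:E * \int[m]_(x in D) (g x ^+ 2)%:E)%E.
Proof.
move=> mD mf mg.
have mf2 : measurable_fun D (fun x => (f x ^+ 2)%:E).
  by apply/measurable_EFinP; exact: measurable_funX.
have mg2 : measurable_fun D (fun x => (g x ^+ 2)%:E).
  by apply/measurable_EFinP; exact: measurable_funX.
rewrite -!ge0_integralZl//; try by move=> x _; rewrite lee_fin sqr_ge0.
rewrite -ge0_integralD//; try by [apply: measurable_funeM|move=> x _; rewrite -EFinM lee_fin mulr_ge0// sqr_ge0].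
apply: ge0_le_integral => //.
- by move=> x _; rewrite lee_fin sqr_ge0.
- apply/measurable_EFinP; apply: measurable_funX; exact: measurable_funD.
- by apply: emeasurable_funD; exact: measurable_funeM.
move=> x _; rewrite -!EFinM -EFinD lee_fin.
have := sqr_ge0 (f x - g x); nra.
Qed.

Lemma integrable_sq d (T : measurableType d) (R : realType)
    (m : {measure set T -> \bar R}) (D : set T) (f : T -> R) :
  measurable D -> measurable_fun D f -> (m D < +oo)%E ->
  (\int[m]_(x in D) (f x ^+ 2)%:E < +oo)%E ->
  m.-integrable D (EFin \o f).
Proof.
move=> mD mf mDoo f2; apply/integrableP; split; first exact/measurable_EFinP.
apply: le_lt_trans (integral_abs_le_sq m mD mf ltr01) _.
by rewrite invr1 !mul1e lte_add_pinfty.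
Qed.

Lemma integral_le_2D d (T : measurableType d) (R : realType)
    (m : {measure set T -> \bar R}) (D : set T) (h f g : T -> \bar R) :
  measurable D -> measurable_fun D h -> measurable_fun D f -> measurable_fun D g ->
  (forall x, 0 <= h x)%E -> (forall x, 0 <= f x)%E -> (forall x, 0 <= g x)%E ->
  (forall x, D x -> h x <= 2%:E * f x + 2%:E * g x)%E ->
  (\int[m]_(x in D) h x <=
   2%:E * \int[m]_(x in D) f x + 2%:E * \int[m]_(x in D) g x)%E.
Proof.
move=> mD mh mf mg h0 f0 g0 hfg.
have two0 : (0 <= 2%:E :> \bar R)%E by rewrite lee_fin.
have m2f : measurable_fun D (fun x => 2%:E * f x)%E by exact: measurable_funeM.
have m2g : measurable_fun D (fun x => 2%:E * g x)%E by exact: measurable_funeM.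
rewrite -!ge0_integralZl// -ge0_integralD//; try by move=> x _; exact: mule_ge0.
by apply: ge0_le_integral => //; exact: emeasurable_funD.
Qed.

Lemma bounded_integrable d (T : measurableType d) (R : realType)
    (m : {measure set T -> \bar R}) (D : set T) (f : T -> R) (M : R) :
  measurable D -> (m D < +oo)%E -> measurable_fun D f ->
  (forall x, D x -> `|f x| <= M) -> m.-integrable D (EFin \o f).
Proof.
move=> mD mDoo mf fM; apply: measurable_bounded_integrable => //.
exists M; split; first exact: num_real.
by move=> x Mx z Dz; exact: le_trans (fM z Dz) (ltW Mx).
Qed.

Lemma integrable_bounded_mul d (E : measurableType d) (R : realType)
    (mu : {measure set E -> \bar R}) (A : set E) (M : R) (a y : E -> R) :
  measurable A -> measurable_fun A a -> (forall z, A z -> `|a z| <= M) ->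
  mu.-integrable A (EFin \o y) -> mu.-integrable A (fun z => (a z * y z)%:E).
Proof.
move=> mA ma aM yi.
have my : measurable_fun A y by apply/measurable_EFinP; exact: measurable_int yi.
have Myi : mu.-integrable A (fun z => `|M|%:E * (EFin \o y) z)%E.
  exact: integrableZl.
apply: (le_integrable mA _ _ Myi).
  by apply/measurable_EFinP; exact: measurable_funM.
move=> z Az; rewrite abseM /= -EFinM lee_fin normrM normr_id.
by rewrite ler_wpM2r// (le_trans (aM z Az))// ler_norm.
Qed.

Lemma Rintegral_eq0 d (T : measurableType d) (R : realType)
    (mu : {measure set T -> \bar R}) (D : set T) (f : T -> R) :
  (forall x, D x -> f x = 0) -> \int[mu]_(x in D) f x = 0.
Proof.
by move=> f0; rewrite /Rintegral integral0_eq// => x Dx; rewrite f0.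
Qed.

(** The set function [mu] is arbitrary, so its value on the empty set may be nonzero.
    The integral of 0 still is a difference of two equal terms, and its real part
    is 0 even if they are infinite. *)
Lemma fine_integral_eq0 d (T : measurableType d) (R : realType)
    (mu : set T -> \bar R) (D : set T) (f : T -> \bar R) :
  (forall x, D x -> f x = 0%E) -> fine (\int[mu]_(x in D) f x)%E = 0.
Proof.
move=> f0; rewrite /integral (_ : f \_ D = cst 0%E); last first.
  by apply/funext => x; rewrite patchE; case: ifPn => // /[1!inE] /f0.
have -> : @funeneg T R (cst 0%E) = @funepos T R (cst 0%E).
  by apply/funext => x; rewrite funenegE funeposE/= oppr0.
by case: (ereal_sup _) => //= x; rewrite subrr.
Qed.

Section tonelli_on.
Local Open Scope ereal_scope.
Context d1 d2 (T1 : measurableType d1) (T2 : measurableType d2) (R : realType).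
Variables (m1 : {sigma_finite_measure set T1 -> \bar R})
  (m2 : {sigma_finite_measure set T2 -> \bar R}).
Variables (A : set T1) (C : set T2) (f : T1 * T2 -> \bar R).
Hypotheses (mA : measurable A) (mC : measurable C).

(** Extension by 0 off the rectangle [A `*` C] reduces iterated integrals over [A]
    and [C] to iterated integrals over the whole spaces. *)
Lemma integral_section1E :
  (fun x => \int[m2]_y (f \_ (A `*` C)) (x, y)) =
  (fun x => \int[m2]_(y in C) f (x, y)) \_ A.
Proof.
apply/funext => x; rewrite !patchE; case: ifPn => [|] xA.
  rewrite [RHS]integral_mkcond; apply: eq_integral => y _.
  by rewrite !patchE in_setX/= xA.
by apply: integral0_eq => y _; rewrite patchE in_setX/= (negbTE xA).
Qed.

Lemma integral_section2E :
  (fun y => \int[m1]_x (f \_ (A `*` C)) (x, y)) =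
  (fun y => \int[m1]_(x in A) f (x, y)) \_ C.
Proof.
apply/funext => y; rewrite !patchE; case: ifPn => [|] yC.
  rewrite [RHS]integral_mkcond; apply: eq_integral => x _.
  by rewrite !patchE in_setX/= yC andbT.
by apply: integral0_eq => x _; rewrite patchE in_setX/= (negbTE yC) andbF.
Qed.

Hypotheses (mf : measurable_fun (A `*` C) f) (f0 : forall p, (A `*` C) p -> 0 <= f p).

Let mg : measurable_fun setT (f \_ (A `*` C)).
Proof. by apply: (measurable_restrictT f (measurableX mA mC)).1. Qed.

Let g0 p : 0 <= (f \_ (A `*` C)) p.
Proof. by rewrite patchE; case: ifPn => // /set_mem /f0. Qed.

Lemma measurable_integral_section1 :
  measurable_fun A (fun x => \int[m2]_(y in C) f (x, y)).
Proof.
apply/(measurable_restrictT _ _) => //.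
by rewrite -integral_section1E; exact: measurable_fun_fubini_tonelli_F.
Qed.

Lemma measurable_integral_section2 :
  measurable_fun C (fun y => \int[m1]_(x in A) f (x, y)).
Proof.
apply/(measurable_restrictT _ _) => //.
by rewrite -integral_section2E; exact: measurable_fun_fubini_tonelli_G.
Qed.

Lemma tonelli_prod_on :
  \int[m1 \x m2]_(p in A `*` C) f p = \int[m1]_(x in A) \int[m2]_(y in C) f (x, y).
Proof.
rewrite [LHS]integral_mkcond [RHS]integral_mkcond -integral_section1E.
by rewrite fubini_tonelli1.
Qed.

Lemma tonelli_on :
  \int[m1]_(x in A) \int[m2]_(y in C) f (x, y) =
  \int[m2]_(y in C) \int[m1]_(x in A) f (x, y).
Proof.
rewrite [LHS]integral_mkcond [RHS]integral_mkcond.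
by rewrite -integral_section1E -integral_section2E; exact: fubini_tonelli.
Qed.

End tonelli_on.

(** The integral of a nonnegative function is a supremum over the simple functions
    below it, so it is monotone without any measurability. This allows for an
    upper function [g] that is an uncountable supremum. *)
Lemma le_integral_ge0 d (T : measurableType d) (R : realType)
    (m : {measure set T -> \bar R}) (f g : T -> \bar R) :
  (forall x, 0 <= f x)%E -> (forall x, f x <= g x)%E ->
  (\int[m]_x f x <= \int[m]_x g x)%E.
Proof.
move=> f0 fg; have g0 x : (0 <= g x)%E by exact: le_trans (fg x).
rewrite !ge0_integralTE//; apply: le_ereal_sup => _ [h hf <-].
by exists h => // x; exact: le_trans (fg x).
Qed.

(** The Cauchy-Schwarz inequality against the constant 1, up to the constant: it is
    [integral_abs_le_sq] for an [e] proportional to the absolute value of the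
    integral of [f]. *)
Lemma sq_Rintegral_le d (T : measurableType d) (R : realType)
    (m : {measure set T -> \bar R}) (D : set T) (f : T -> R) :
  measurable D -> (m D < +oo)%E -> measurable_fun D f ->
  (((\int[m]_(x in D) f x) ^+ 2)%:E <=
   (4 * (fine (m D) + 1))%:E * \int[m]_(x in D) (f x ^+ 2)%:E)%E.
Proof.
move=> mD mDoo mf.
have p0 : 0 < fine (m D) + 1 by rewrite ltr_wpDl// fine_ge0.
have C0 : 0 < 4 * (fine (m D) + 1) by rewrite mulr_gt0.
have [q0|] := boolP ((\int[m]_(x in D) (f x ^+ 2)%:E)%E == +oo%E).
  by rewrite (eqP q0) gt0_muley ?leey// lte_fin.
have If0 : (0 <= \int[m]_(x in D) (f x ^+ 2)%:E)%E.
  by apply: integral_ge0 => x _; rewrite lee_fin sqr_ge0.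
rewrite -ltey => foo.
have fi := integrable_sq mD mf mDoo foo.
have qfin : (\int[m]_(x in D) (f x ^+ 2)%:E)%E \is a fin_num by rewrite ge0_fin_numE.
set a := \int[m]_(x in D) f x.
have [->|a0] := eqVneq a 0.
  by rewrite expr0n mule_ge0// lee_fin ltW.
have na0 : 0 < `|a| by rewrite normr_gt0.
(* The added 1 keeps e finite when D is a null set. *)
pose e := `|a| / (2 * (fine (m D) + 1)).
have e0 : 0 < e by rewrite divr_gt0// mulr_gt0.
have : (`|a|%:E <= e%:E * m D + e^-1%:E * \int[m]_(x in D) (f x ^+ 2)%:E)%E.
  apply: le_trans (integral_abs_le_sq m mD mf e0).
  by rewrite EFin_normr_Rintegral//; exact: le_abse_integral (measurable_int _ fi).
have mDfin : m D \is a fin_num by rewrite ge0_fin_numE.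
rewrite -(fineK qfin) -{1}(fineK mDfin) -!EFinM -EFinD !lee_fin.
have q0 : 0 <= fine (\int[m]_(x in D) (f x ^+ 2)%:E)%E by rewrite fine_ge0.
have d0 : 0 <= fine (m D) by rewrite fine_ge0.
rewrite /e invf_div -[a ^+ 2]real_normK ?num_real//.
move: (fine _) q0 => q q0; move: (fine (m D)) p0 d0 {C0 e e0 mDfin} => p p0 p0'.
move: `|a| na0 => x x0 h.
have : x * x <= (x / (2 * (p + 1)) * p + 2 * (p + 1) / x * q) * x by rewrite ler_pM2r.
have -> : (x / (2 * (p + 1)) * p + 2 * (p + 1) / x * q) * x =
   x ^+ 2 * (p / (2 * (p + 1))) + 2 * (p + 1) * q.
  by field; rewrite !gt_eqF.
have : x ^+ 2 * (p / (2 * (p + 1))) <= x ^+ 2 / 2.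
  apply: ler_wpM2l; first exact: sqr_ge0.
  by rewrite ler_pdivrMr ?mulr_gt0//; lra.
rewrite -expr2; move: (x ^+ 2) (_ / _) => x2 z; lra.
Qed.

Section fubini_onM.
Context d1 d2 (T1 : measurableType d1) (T2 : measurableType d2) (R : realType).
Variables (m1 : {sigma_finite_measure set T1 -> \bar R})
  (m2 : {sigma_finite_measure set T2 -> \bar R}).
Variables (A : set T1) (C : set T2) (f : T1 * T2 -> R) (g : T1 -> R).
Hypotheses (mA : measurable A) (mC : measurable C).

(** On the right-hand side the inner integral of [f (x, -)] is turned into a real
    number before it multiplies [g x]. That number means nothing where [f (x, -)]
    is not integrable, which happens only for [x] in a null set; elsewhere the
    factor [g x] can be moved under the inner integral. *)
Lemma Rintegral_fubini_onM : measurable_fun A g ->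
  (m1 \x m2)%E.-integrable (A `*` C) (EFin \o f) ->
  (m1 \x m2)%E.-integrable (A `*` C) (fun p => (f p * g p.1)%:E) ->
  \int[(m1 \x m2)%E]_(p in A `*` C) (f p * g p.1) =
  \int[m1]_(x in A) (\int[m2]_(y in C) f (x, y) * g x).
Proof.
move=> mg fi fgi; have mAC : measurable (A `*` C) by exact: measurableX.
pose h := (EFin \o f) \_ (A `*` C).
pose k := (fun p => (f p * g p.1)%:E) \_ (A `*` C).
have hi : (m1 \x m2)%E.-integrable setT h by apply/(integrable_mkcond _ mAC).
have ki : (m1 \x m2)%E.-integrable setT k by apply/(integrable_mkcond _ mAC).
have HE : fubini_F m2 h = (fun x => \int[m2]_(y in C) (f (x, y))%:E)%E \_ A.
  exact: integral_section1E.
have KE : fubini_F m2 k = (fun x => \int[m2]_(y in C) (f (x, y) * g x)%:E)%E \_ A.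
  exact: integral_section1E.
have mH := measurable_int _ (integrable_fubini_F hi).
have mK := measurable_int _ (integrable_fubini_F ki).
rewrite /Rintegral; congr fine; rewrite integral_mkcond -(integral12_prod_meas1 ki).
rewrite [RHS]integral_mkcond.
have gE : (fun x => (fine (\int[m2]_(y in C) (f (x, y))%:E)%E * g x)%:E) \_ A =
    (fun x => (fine (fubini_F m2 h x) * (g \_ A) x)%:E).
  by apply/funext => x; rewrite HE !patchE; case: ifP => //; rewrite mulr0.
rewrite gE; apply/esym/ae_eq_integral => //.
  apply/measurable_EFinP; apply: measurable_funM.
    exact: measurableT_comp (fine_measurable measurableT) mH.
  exact: (measurable_restrictT g mA).1.
have := ae_integrable1 hi.
apply: filterS => x hx _; rewrite KE HE !patchE; case: ifPn => xA; last by rewrite mulr0.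
have fx : m2.-integrable C (fun y => (f (x, y))%:E).
  apply/(integrable_mkcond _ mC); move: hx; congr integrable; apply/funext => y.
  by rewrite /h !patchE in_setX/= xA.
rewrite EFinM fineK; last exact: integrable_fin_num fx.
by rewrite -integralZr//; apply: eq_integral => y _; rewrite EFinM.
Qed.

End fubini_onM.

Lemma Rintegral_fubini_on d1 d2 (T1 : measurableType d1) (T2 : measurableType d2)
    (R : realType) (m1 : {sigma_finite_measure set T1 -> \bar R})
    (m2 : {sigma_finite_measure set T2 -> \bar R}) (A : set T1) (C : set T2)
    (f : T1 * T2 -> R) :
  measurable A -> measurable C -> (m1 \x m2)%E.-integrable (A `*` C) (EFin \o f) ->
  \int[(m1 \x m2)%E]_(p in A `*` C) f p =
  \int[m1]_(x in A) \int[m2]_(y in C) f (x, y).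
Proof.
move=> mA mC fi.
have f1 (p : T1 * T2) : f p * 1 = f p by rewrite mulr1.
have fi1 : (m1 \x m2)%E.-integrable (A `*` C) (fun p => (f p * cst 1 p.1)%:E).
  by move: fi; congr integrable; apply/funext => p; rewrite /= f1.
have mc : measurable_fun A (cst (1 : R)) by exact: measurable_cst.
have := Rintegral_fubini_onM mA mC mc fi fi1.
under eq_Rintegral do rewrite f1.
move=> ->; apply: eq_Rintegral => x _.
by rewrite (_ : cst 1 x = 1)// mulr1.
Qed.

Section product_sigma_finite.
Context d1 d2 (T1 : measurableType d1) (T2 : measurableType d2) (R : realType).
Variables (m1 : {sigma_finite_measure set T1 -> \bar R})
  (m2 : {sigma_finite_measure set T2 -> \bar R}).

Let mu12 : {measure set (T1 * T2)%type -> \bar R} := (m1 \x m2)%E.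

Let sigma_finite_product : sigma_finite setT mu12.
Proof.
have /sigma_finiteP[F [TF ndF Foo]] := sigma_finiteT m1.
have /sigma_finiteP[G [TG ndG Goo]] := sigma_finiteT m2.
exists (fun n => F n `*` G n).
  rewrite -setXTT TF TG predeqE => -[x y]; split.
    move=> [/= [i _ Fx] [k _ Gy]]; exists (maxn i k) => //; split.
    - by move: x Fx; exact/subsetPset/ndF/leq_maxl.
    - by move: y Gy; exact/subsetPset/ndG/leq_maxr.
  by move=> [i _ []/= ? ?]; split; exists i.
move=> k; have [? ?] := Foo k; have [? ?] := Goo k.
split; first exact: measurableX.
rewrite [ltLHS](product_measure1E m1 m2)//.
by rewrite lte_mul_pinfty// ge0_fin_numE.
Qed.

(** The product measure bundled with its sigma-finiteness, so that it can be a
    factor of a further product. *)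
Definition product_sigma_finite : {sigma_finite_measure set (T1 * T2)%type -> \bar R} :=
  HB.pack (Measure.sort mu12) (Measure.class mu12)
    (@Measure_isSigmaFinite.Build _ _ _ (Measure.sort mu12) sigma_finite_product).

End product_sigma_finite.

(** * Centred normal laws and independence *)

Lemma measurable_sg (R : realType) : measurable_fun [set: R] (@Num.sg R).
Proof.
pose f (x : R) : R := \1_`]0, +oo[%classic x - \1_`]-oo, 0[%classic x.
rewrite (_ : @Num.sg R = f).
  by apply: measurable_funB; exact: measurable_indic.
apply/funext => x; rewrite /f !indicE !mem_setE !in_itv/= andbT.
by case: sgrP => _; rewrite ?subr0 ?sub0r ?subrr.
Qed.

Section normal.
Context (R : realType).
Local Notation leb := (@lebesgue_measure R).

(** The density [normal_pdf] is a version of the Radon-Nikodym derivative. *)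
Lemma ge0_integral_normal_prob (m s : R) (f : R -> \bar R) :
  measurable_fun setT f -> (forall x, 0 <= f x)%E ->
  (\int[normal_prob m s]_x f x = \int[leb]_x (f x * (normal_pdf m s x)%:E))%E.
Proof.
move=> mf f0.
have dom := @normal_prob_dominates R m s.
rewrite -(Radon_Nikodym_SigmaFinite.change_of_variables dom)//.
have fi := Radon_Nikodym_SigmaFinite.f_integrable dom.
have mpdf : measurable_fun setT (EFin \o normal_pdf m s).
  by apply/measurable_EFinP; exact: measurable_normal_pdf.
apply: ae_eq_integral => //.
- by apply: emeasurable_funM => //; exact: measurable_int fi.
- exact: emeasurable_funM.
- apply: ae_eqe_mul2l => /=.
  apply: integral_ae_eq => //= E _ mE.
  by rewrite -Radon_Nikodym_SigmaFinite.f_integral.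
Qed.

Lemma normal_prob_opp (s : R) (A : set R) : s != 0 -> measurable A ->
  normal_prob 0 s (-%R @^-1` A) = normal_prob 0 s A.
Proof.
move=> s0 mA; rewrite /normal_prob.
have mo : measurable_fun setT (-%R : measurableTypeR R -> measurableTypeR R).
  exact: oppr_measurable.
have mp (D : set R) : measurable_fun D (fun x => (normal_pdf 0 s x)%:E).
  by apply/measurable_funTS/measurable_EFinP; exact: measurable_normal_pdf.
transitivity (\int[pushforward leb (-%R : _ -> measurableTypeR R)]_(x in A)
   (normal_pdf 0 s x)%:E)%E.
  rewrite ge0_integral_pushforward//.
  - by apply: eq_integral => x _ /=; rewrite !normal_pdfE// /normal_fun !subr0 sqrrN.
  - exact: (mp A).
  - by move=> x _; rewrite lee_fin normal_pdf_ge0.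
by apply: eq_measure_integral => B mB _; exact: lebesgue_measureN.
Qed.

Lemma integral_normal_odd (s : R) (g : R -> R) : s != 0 ->
  (forall x, g (- x) = - g x) ->
  (normal_prob 0 s).-integrable setT (EFin \o g) ->
  (\int[normal_prob 0 s]_x (g x)%:E = 0)%E.
Proof.
move=> s0 godd ig.
have mo : measurable_fun setT (-%R : measurableTypeR R -> measurableTypeR R).
  exact: oppr_measurable.
have gneg : ((EFin \o g)^\- = (EFin \o g)^\+ \o -%R)%E.
  by apply/funext => x; rewrite funenegE/= funeposE/= godd EFinN.
have mg := measurable_int _ ig.
have mgp : measurable_fun setT ((EFin \o g)^\+)%E by exact: measurable_funepos.
have E : (\int[normal_prob 0 s]_x (EFin \o g)^\- x =
          \int[normal_prob 0 s]_x (EFin \o g)^\+ x)%E.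
  rewrite gneg.
  transitivity (\int[pushforward (normal_prob 0 s)
     (-%R : measurableTypeR R -> measurableTypeR R)]_x (EFin \o g)^\+ x)%E.
    by rewrite ge0_integral_pushforward.
  apply: eq_measure_integral => B mB _; exact: normal_prob_opp.
by rewrite integralE E subee// integrable_pos_fin_num.
Qed.

(** Only the order [s^2] matters. With [y = 3 x^2 / (8 s^2)], the normal density of
    standard deviation [s] is [2 exp(-y)] times that of standard deviation [2 s],
    and [y exp(-y) <= 1]; so [x^2] times the former is at most [8 s^2] times the
    latter, whose total mass is 1. *)
Lemma integral_normal_sq_le (s : R) : 0 < s ->
  (\int[normal_prob 0 s]_x (x ^+ 2)%:E <= (8 * s ^+ 2)%:E)%E.
Proof.
move=> s0.
have s20 : 2 * s != 0 by rewrite mulf_neq0// gt_eqF.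
rewrite ge0_integral_normal_prob; last 2 first.
- by apply/measurable_EFinP; exact: exprn_measurable.
- by move=> x; rewrite lee_fin sqr_ge0.
rewrite -[leRHS]mule1 -(integral_normal_pdf 0 (2 * s)).
rewrite -ge0_integralZl//=; last 3 first.
- by apply/measurable_EFinP; exact: measurable_normal_pdf.
- by move=> x _; rewrite lee_fin normal_pdf_ge0.
- by rewrite lee_fin mulr_ge0// sqr_ge0.
apply: ge0_le_integral => //.
- by move=> x _; rewrite -EFinM lee_fin mulr_ge0 ?sqr_ge0 ?normal_pdf_ge0.
- apply/measurable_EFinP; apply: measurable_funM; first exact: exprn_measurable.
  exact: measurable_normal_pdf.
- apply/measurable_EFinP; apply: measurable_funM => //.
  exact: measurable_normal_pdf.
move=> x _; rewrite -!EFinM lee_fin !normal_pdfE ?(gt_eqF s0)//.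
have -> : normal_peak s = 2 * normal_peak (2 * s).
  rewrite /normal_peak.
  rewrite (_ : (2 * s) ^+ 2 * pi *+ 2 = 2 ^+ 2 * (s ^+ 2 * pi *+ 2)); last by ring.
  by rewrite sqrtrM ?sqr_ge0// sqrtr_sqr ger0_norm// invfM mulrA divff// mul1r.
pose y := 3 * x ^+ 2 / (8 * s ^+ 2).
have sn0 : s != 0 by rewrite gt_eqF.
have -> : normal_fun 0 s x = normal_fun 0 (2 * s) x * expR (- y).
  by rewrite /normal_fun -expRD; congr expR; rewrite /y subr0; field.
have ye : y * expR (- y) <= 1.
  rewrite expRN ler_pdivrMr ?expR_gt0// mul1r.
  by apply: le_trans (expR_ge1Dx y); rewrite lerDr.
have -> : x ^+ 2 = 8 * s ^+ 2 / 3 * y by rewrite /y; field.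
set p := normal_peak _; set q := normal_fun _ _ _.
have p0 : 0 <= p * q by rewrite mulr_ge0 ?normal_peak_ge0 ?normal_fun_ge0.
rewrite (_ : _ / 3 * y * _ = (8 * s ^+ 2 * (p * q)) * (2 / 3 * (y * expR (- y)))); last first.
  by field.
rewrite ler_piMr//; first by rewrite mulr_ge0// mulr_ge0// sqr_ge0.
lra.
Qed.

Lemma integral_normal_sg_sq (s : R) : s != 0 ->
  (\int[normal_prob 0 s]_x (Num.sg x ^+ 2)%:E = 1)%E.
Proof.
move=> s0.
transitivity (\int[normal_prob 0 s]_x (cst 1 x)%E)%E; last first.
  by rewrite integral_cst// mul1e; exact: probability_setT.
apply: ae_eq_integral => //.
- apply/measurable_EFinP; apply: measurable_funX; exact: measurable_sg.
- exists [set 0]; split => //.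
    move/null_content_dominatesP : (@normal_prob_dominates R 0 s); apply => //.
    exact: lebesgue_measure_set1.
  move=> x /= /not_implyP[_]; apply: contra_notP => /eqP x0.
  by rewrite sqr_sg x0.
Qed.

End normal.

Section independence.
Context d d1 d2 (Omega : measurableType d) (T1 : measurableType d1)
  (T2 : measurableType d2) (R : realType) (P : probability Omega R).
Variables (h1 : Omega -> T1) (h2 : Omega -> T2).
Hypotheses (mh1 : measurable_fun setT h1) (mh2 : measurable_fun setT h2).
Hypothesis indep : forall A C, measurable A -> measurable C ->
  P (h1 @^-1` A `&` h2 @^-1` C) = (P (h1 @^-1` A) * P (h2 @^-1` C))%E.

Let X1 : {mfun Omega >-> T1} := HB.pack h1 (isMeasurableFun.Build _ _ _ _ _ mh1).
Let X2 : {mfun Omega >-> T2} := HB.pack h2 (isMeasurableFun.Build _ _ _ _ _ mh2).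
Let h12 w := (h1 w, h2 w).
Let mh12 : measurable_fun setT h12.
Proof. by apply/measurable_fun_pairP; split. Qed.
Let X12 : {mfun Omega >-> (T1 * T2)%type} :=
  HB.pack h12 (isMeasurableFun.Build _ _ _ _ _ mh12).

(** Both measures agree on rectangles. *)
Lemma joint_distribution A : measurable A ->
  (distribution P X1 \x distribution P X2)%E A = distribution P X12 A.
Proof.
by move=> mA; apply: product_measure_unique.
Qed.

Lemma ge0_integral_indep (f : T1 -> \bar R) (g : T2 -> \bar R) :
  measurable_fun setT f -> (forall x, 0 <= f x)%E ->
  measurable_fun setT g -> (forall x, 0 <= g x)%E ->
  (\int[P]_w (f (h1 w) * g (h2 w)) =
   \int[P]_w f (h1 w) * \int[P]_w g (h2 w))%E.
Proof.
move=> mf f0 mg g0.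
pose k (p : T1 * T2) := (f p.1 * g p.2)%E.
have mk : measurable_fun setT k.
  by apply: emeasurable_funM; exact: measurableT_comp.
have k0 p : (0 <= k p)%E by exact: mule_ge0.
rewrite -[LHS]/(\int[P]_w (k \o X12) w)%E -ge0_integral_distribution//.
rewrite -(eq_measure_integral _ (fun A mA _ => joint_distribution mA)).
rewrite fubini_tonelli1// /fubini_F /k/=.
under eq_integral do rewrite ge0_integralZl//.
rewrite ge0_integralZr//; last exact: integral_ge0.
by rewrite !ge0_integral_distribution.
Qed.

Variables (f : T1 -> R) (g : T2 -> R).
Hypotheses (mf : measurable_fun setT f) (mg : measurable_fun setT g).

Lemma integrable_indep : P.-integrable setT (EFin \o f \o h1) ->
  P.-integrable setT (EFin \o g \o h2) ->
  P.-integrable setT (fun w => (f (h1 w) * g (h2 w))%:E).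
Proof.
move=> /integrableP[_ fi] /integrableP[_ gi]; apply/integrableP; split.
  by apply/measurable_EFinP; apply: measurable_funM; exact: measurableT_comp.
under eq_integral do rewrite abse_EFin normrM EFinM.
rewrite (ge0_integral_indep (f := fun x => `|f x|%:E) (g := fun x => `|g x|%:E))//.
- by apply: lte_mul_pinfty => //; [exact: integral_ge0|rewrite ge0_fin_numE//; exact: integral_ge0].
- by apply/measurable_EFinP; exact: measurableT_comp.
- by apply/measurable_EFinP; exact: measurableT_comp.
Qed.

Lemma integral_indep : P.-integrable setT (EFin \o f \o h1) ->
  P.-integrable setT (EFin \o g \o h2) ->
  (\int[P]_w (f (h1 w) * g (h2 w))%:E =
   \int[P]_w (f (h1 w))%:E * \int[P]_w (g (h2 w))%:E)%E.
Proof.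
move=> fi gi.
pose k (p : T1 * T2) := (f p.1 * g p.2)%:E.
have mk : measurable_fun setT k.
  by apply/measurable_EFinP; apply: measurable_funM; exact: measurableT_comp.
have ki := integrable_indep fi gi.
rewrite -[LHS]/(\int[P]_w (k \o X12) w)%E -integral_distribution//.
rewrite -(eq_measure_integral _ (fun A mA _ => joint_distribution mA)).
have gi' : (distribution P X2).-integrable setT (EFin \o g).
  by apply: integrable_pushforward => //; exact/measurable_EFinP.
have fi' : (distribution P X1).-integrable setT (EFin \o f).
  by apply: integrable_pushforward => //; exact/measurable_EFinP.
have ki' : (distribution P X1 \x distribution P X2)%E.-integrable setT k.
  apply/integrableP; split => //.
  rewrite (eq_measure_integral _ (fun A mA _ => joint_distribution mA)).
  suff : (distribution P X12).-integrable setT k by case/integrableP.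
  exact: integrable_pushforward.
have mEf : measurable_fun setT (EFin \o f) by exact/measurable_EFinP.
have mEg : measurable_fun setT (EFin \o g) by exact/measurable_EFinP.
rewrite -integral12_prod_meas1// /fubini_F.
transitivity (\int[distribution P X1]_x
    ((f x)%:E * \int[P]_w (g (h2 w))%:E))%E.
  apply: eq_integral => x _; rewrite /k/=.
  under eq_integral do rewrite EFinM.
  by rewrite integralZl// (integral_distribution (X := X2) mEg gi).
rewrite -(fineK (integrable_fin_num _ gi))// integralZr//.
by rewrite (integral_distribution (X := X1) mEf fi).
Qed.

End independence.

(** * Increments of Brownian motion and martingale transforms *)

Section brownian.
Context (R : realType) (dO : measure_display) (Omega : measurableType dO).
Context (P : probability Omega R) (B : R -> Omega -> R).
Hypotheses (P_complete : measure_is_complete P) (B_bm : brownian_motion P B).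
Local Notation F := (filtration P B).

Lemma brownian_measurable t : 0 <= t -> measurable_fun setT (B t).
Proof. by case: B_bm => + _ _ _ _; exact. Qed.

(** The generators of [F s] include all negligible sets, which are measurable because
    [P] is complete. *)
Lemma filtration_measurable s (A : set (F s)) :
  measurable A -> measurable (A : set Omega).
Proof.
move: A; apply: smallest_sub => [|A [[r [C [/andP[r0 _] mC ->]]]|]].
- split => //; [by move=> A mA; rewrite setTD; exact: measurableC|].
  by move=> G mG; exact: bigcupT_measurable.
- by rewrite -[X in measurable X]setTI; exact: brownian_measurable.
- exact: P_complete.
Qed.

Lemma filtration_le s t (A : set Omega) : s <= t ->
  measurable (A : set (F s)) -> measurable (A : set (F t)).
Proof.
move=> st; move: A; apply: smallest_sub => [|A].
  exact: smallest_sigma_algebra.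
move=> [[r [C [/andP[r0 rs] mC ->]]]|nA]; apply: sub_sigma_algebra; last by right.
by left; exists r, C; split => //; rewrite r0 (le_trans rs).
Qed.

Lemma measurable_fun_filtration d' (T' : measurableType d') s (f : Omega -> T') :
  measurable_fun [set: F s] f -> measurable_fun [set: Omega] f.
Proof.
by move=> mf _ Y mY; apply: filtration_measurable; exact: mf.
Qed.

Lemma measurable_fun_filtration_le d' (T' : measurableType d') s t
    (f : Omega -> T') : s <= t ->
  measurable_fun [set: F s] f -> measurable_fun [set: F t] f.
Proof.
by move=> st mf _ Y mY; apply: (filtration_le st); exact: mf.
Qed.

Lemma measurable_brownian_filtration s t : 0 <= s <= t ->
  measurable_fun [set: F t] (B s).
Proof.
move=> st _ Y mY; rewrite setTI; apply: sub_sigma_algebra; left.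
by exists s, Y.
Qed.

Section increment.
Variables (s t : R).
Hypotheses (s0 : 0 <= s) (st : s < t).
Let D w := B t w - B s w.

Lemma measurable_increment : measurable_fun setT D.
Proof.
by apply: measurable_funB; apply: brownian_measurable => //; exact: le_trans (ltW st).
Qed.

Let sigma0 : 0 < Num.sqrt (t - s). Proof. by rewrite sqrtr_gt0 subr_gt0. Qed.

Let X : {mfun Omega >-> measurableTypeR R} :=
  HB.pack D (@isMeasurableFun.Build _ _ _ (measurableTypeR R) _ measurable_increment).

Let law (C : set (measurableTypeR R)) : measurable C ->
  distribution P X C = normal_prob 0 (Num.sqrt (t - s)) C.
Proof. by case: B_bm => _ _ _ + _; apply => //; rewrite s0. Qed.

Lemma ge0_integral_increment (g : R -> \bar R) : measurable_fun setT g ->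
  (forall x, 0 <= g x)%E ->
  (\int[P]_w g (D w) = \int[normal_prob 0 (Num.sqrt (t - s))]_x g x)%E.
Proof.
move=> mg g0.
rewrite -[LHS]/(\int[P]_w (g \o X) w)%E -ge0_integral_distribution//.
by apply: (eq_measure_integral (normal_prob 0 (Num.sqrt (t - s)))) => A mA _; exact: law.
Qed.

Lemma integral_increment_odd (g : R -> R) : measurable_fun setT g ->
  (forall x, g (- x) = - g x) ->
  P.-integrable setT (fun w => (g (D w))%:E) ->
  (\int[P]_w (g (D w))%:E = 0)%E.
Proof.
move=> mg godd gi.
rewrite -(@integral_normal_odd R _ g (lt0r_neq0 sigma0) godd).
  transitivity (\int[distribution P X]_x (g x)%:E)%E.
    by rewrite integral_distribution//; exact/measurable_EFinP.
  by apply: (eq_measure_integral (normal_prob 0 (Num.sqrt (t - s)))) => A mA _; exact: law.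
apply/integrableP; split; first exact/measurable_EFinP.
rewrite -ge0_integral_increment//; last first.
  by apply/measurable_EFinP; exact: measurableT_comp.
by case/integrableP: gi.
Qed.

Lemma integral_increment_sq_le :
  (\int[P]_w (D w ^+ 2)%:E <= (8 * (t - s))%:E)%E.
Proof.
rewrite (ge0_integral_increment (g := fun x => (x ^+ 2)%:E)).
- by rewrite -[leRHS](_ : (8 * Num.sqrt (t - s) ^+ 2)%:E = _) ?integral_normal_sq_le// sqr_sqrtr// subr_ge0 ltW.
- by apply/measurable_EFinP; exact: exprn_measurable.
- by move=> x; rewrite lee_fin sqr_ge0.
Qed.

Lemma integral_increment_sg_sq : (\int[P]_w (Num.sg (D w) ^+ 2)%:E = 1)%E.
Proof.
rewrite (ge0_integral_increment (g := fun x => (Num.sg x ^+ 2)%:E)).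
- by rewrite integral_normal_sg_sq// lt0r_neq0.
- by apply/measurable_EFinP; apply: measurable_funX; exact: measurable_sg.
- by move=> x; rewrite lee_fin sqr_ge0.
Qed.

Lemma integrable_increment : P.-integrable setT (EFin \o D).
Proof.
have mD := measurable_increment.
apply/integrableP; split; first exact/measurable_EFinP.
apply: (@le_lt_trans _ _ (\int[P]_w (1%:E + (D w ^+ 2)%:E)))%E.
  apply: ge0_le_integral => //.
  - by apply/measurable_EFinP; exact: measurableT_comp.
  - apply/measurable_EFinP; apply: measurable_funD => //.
    exact: measurable_funX.
  - move=> w _; rewrite -EFinD lee_fin.
    have := sqr_ge0 (`|D w| - 2^-1); rewrite -[X in _ <= 1 + X]real_normK ?num_real//.
    by set y := `|D w|; nra.
rewrite ge0_integralD//=; last 2 first.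
- by move=> w _; rewrite lee_fin sqr_ge0.
- by apply/measurable_EFinP; exact: measurable_funX.
rewrite integral_cst// mul1e; apply: lte_add_pinfty.
  by apply: (le_lt_trans (probability_le1 P measurableT)); rewrite ltry.
by apply: le_lt_trans integral_increment_sq_le _; rewrite ltry.
Qed.

Lemma indep_increment (A : set (F s)) (C : set R) : measurable A -> measurable C ->
  P (A `&` D @^-1` C) = (P A * P (D @^-1` C))%E.
Proof. by case: B_bm => _ _ _ _; apply => //; rewrite s0. Qed.

(* Taken as a random variable with values in (Omega, F s), the identity turns the
   independence of F s and the increment into that of two random variables. *)
Let idF (w : Omega) : F s := w.
Let midF : measurable_fun setT idF.
Proof. by move=> _ A mA; rewrite setTI; exact: (filtration_measurable mA). Qed.

(** The increment is independent of [F s] and its law is symmetric. *)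
Lemma integral_past_increment_odd (Y : Omega -> R) (g : R -> R) :
  measurable_fun [set: F s] Y -> P.-integrable setT (EFin \o Y) ->
  measurable_fun setT g -> (forall x, g (- x) = - g x) ->
  P.-integrable setT (fun w => (g (D w))%:E) ->
  P.-integrable setT (fun w => (Y w * g (D w))%:E) /\
  (\int[P]_w (Y w * g (D w))%:E = 0)%E.
Proof.
move=> mY Yi mg godd gi; split.
  exact: (integrable_indep (h1 := idF) midF measurable_increment indep_increment).
rewrite (integral_indep (h1 := idF) midF measurable_increment indep_increment)//.
by rewrite (integral_increment_odd mg)// mule0.
Qed.

Lemma integral_past_increment_sq_le (Y : Omega -> R) :
  measurable_fun [set: F s] Y ->
  (\int[P]_w ((Y w * D w) ^+ 2)%:E <=
   \int[P]_w (Y w ^+ 2)%:E * (8 * (t - s))%:E)%E.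
Proof.
move=> mY; under eq_integral do rewrite exprMn EFinM.
rewrite (ge0_integral_indep (h1 := idF) midF measurable_increment indep_increment
  (f := fun w => (Y w ^+ 2)%:E) (g := fun x => (x ^+ 2)%:E)).
- by apply: lee_wpmul2l; [apply: integral_ge0 => w _; rewrite lee_fin sqr_ge0|exact: integral_increment_sq_le].
- by apply/measurable_EFinP; exact: measurable_funX.
- by move=> x; rewrite lee_fin sqr_ge0.
- by apply/measurable_EFinP; exact: exprn_measurable.
- by move=> x; rewrite lee_fin sqr_ge0.
Qed.

End increment.
End brownian.

Section martingale_transform.
Context (R : realType) (dO : measure_display) (Omega : measurableType dO).
Context (P : probability Omega R) (B : R -> Omega -> R).
Hypotheses (P_complete : measure_is_complete P) (B_bm : brownian_motion P B).
Local Notation F := (filtration P B).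

Variables (n : nat) (tau : nat -> R) (c : nat -> Omega -> R).
Hypothesis tau0 : 0 <= tau 0.
Hypothesis tau_le : forall i, (i < n)%N -> tau i <= tau i.+1.
Hypothesis c_adapted : forall i, (i < n)%N -> measurable_fun [set: F (tau i)] (c i).
Hypothesis c_bounded : forall i, (i < n)%N -> exists M, forall w, `|c i w| <= M.

Let S m w := \sum_(i < m) c i w * (B (tau i.+1) w - B (tau i) w).

Let tau_ge0 i : (i <= n)%N -> 0 <= tau i.
Proof. by elim: i => // i IH ni; rewrite (le_trans (IH (ltnW ni)))// tau_le. Qed.

Let S_adapted m : (m <= n)%N -> measurable_fun [set: F (tau m)] (S m).
Proof.
elim: m => [_|m IH mn].
  by rewrite (_ : S 0 = cst 0); [exact: measurable_cst|apply/funext => w; rewrite /S big_ord0].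
rewrite (_ : S m.+1 = fun w => S m w + c m w * (B (tau m.+1) w - B (tau m) w)); last first.
  by apply/funext => w; rewrite /S big_ord_recr.
have tm := tau_le mn.
apply: measurable_funD.
  apply: (measurable_fun_filtration_le tm); exact: (IH (ltnW mn)).
apply: measurable_funM; first exact: (measurable_fun_filtration_le tm (c_adapted mn)).
apply: measurable_funB; apply: measurable_brownian_filtration.
  by rewrite lexx tau_ge0.
by rewrite tm tau_ge0// ltnW.
Qed.

(** The Ito isometry for simple integrands, as an inequality. In each step of the
    induction the cross term has mean 0, being a past variable times a later
    increment. *)
Lemma martingale_transform_sq_le m : (m <= n)%N ->
  (\int[P]_w (S m w ^+ 2)%:E <=
   \sum_(i < m) (8 * (tau i.+1 - tau i))%:E * \int[P]_w (c i w ^+ 2)%:E)%E /\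
  (\int[P]_w (S m w ^+ 2)%:E < +oo)%E.
Proof.
elim: m => [_|m IH mn].
  rewrite big_ord0.
  have -> : (\int[P]_w (S 0 w ^+ 2)%:E = 0)%E.
    by apply: integral0_eq => w _; rewrite /S big_ord0 expr0n.
  by rewrite lexx ltry.
have [IH1 IH2] := IH (ltnW mn).
have mS := measurable_fun_filtration P_complete B_bm (S_adapted (ltnW mn)).
have mc := measurable_fun_filtration P_complete B_bm (c_adapted mn).
have [M cM] := c_bounded mn.
have c2 : (\int[P]_w (c m w ^+ 2)%:E < +oo)%E.
  apply: (@le_lt_trans _ _ (\int[P]_w (cst (M ^+ 2)%:E w)))%E.
    apply: ge0_le_integral => //.
    - by move=> w _; rewrite lee_fin sqr_ge0.
    - by apply/measurable_EFinP; exact: measurable_funX.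
    - move=> w _; rewrite lee_fin -[leLHS]real_normK ?num_real//.
      by rewrite lerXn2r// nnegrE (le_trans _ (cM w)).
  rewrite integral_cst//; apply: lte_mul_pinfty => //; rewrite ?lee_fin ?sqr_ge0//.
  by apply: (le_lt_trans (probability_le1 P measurableT)); rewrite ltry.
have := tau_le mn; rewrite le_eqVlt => /orP[/eqP tt|tt].
  have E : S m.+1 = S m.
    by apply/funext => w; rewrite /S big_ord_recr/= tt subrr mulr0 addr0.
  by rewrite E big_ord_recr/= tt subrr mulr0 mul0e adde0.
pose D w := B (tau m.+1) w - B (tau m) w.
have tm0 := tau_ge0 (ltnW mn).
have mD : measurable_fun setT D by exact: (measurable_increment B_bm tm0 tt).
have mScF : measurable_fun [set: F (tau m)] (fun w => S m w * c m w).
  by apply: measurable_funM; [exact: S_adapted (ltnW mn)|exact: c_adapted].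
have Sci : P.-integrable setT (fun w => (S m w * c m w)%:E).
  have -> : (fun w => (S m w * c m w)%:E) = ((EFin \o S m) \* (EFin \o c m))%E.
    by apply/funext => w /=; rewrite EFinM.
  apply: integrableMl => //.
    by apply: integrable_sq => //; apply: (le_lt_trans (probability_le1 P measurableT)); rewrite ltry.
  exists M; split; first exact: num_real.
  by move=> x Mx w _; exact: le_trans (cM w) (ltW Mx).
have [ScDi ScD0] := integral_past_increment_odd P_complete B_bm tm0 tt mScF Sci
  (@measurable_id _ R setT) (fun x => erefl) (integrable_increment B_bm tm0 tt).
have cD := integral_past_increment_sq_le P_complete B_bm tm0 tt (c_adapted mn).
have cDoo : (\int[P]_w ((c m w * D w) ^+ 2)%:E < +oo)%E.
  apply: le_lt_trans cD _; rewrite muleC; apply: lte_mul_pinfty => //.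
  by rewrite lee_fin mulr_ge0// subr_ge0 ltW.
have S2i : P.-integrable setT (fun w => (S m w ^+ 2)%:E).
  apply/integrableP; split; first by apply/measurable_EFinP; exact: measurable_funX.
  by under eq_integral do rewrite abse_EFin ger0_norm ?sqr_ge0//.
have cD2i : P.-integrable setT (fun w => ((c m w * D w) ^+ 2)%:E).
  apply/integrableP; split.
    by apply/measurable_EFinP; apply: measurable_funX; exact: measurable_funM.
  by under eq_integral do rewrite abse_EFin ger0_norm ?sqr_ge0//.
have E : (\int[P]_w (S m.+1 w ^+ 2)%:E =
    \int[P]_w (S m w ^+ 2)%:E + \int[P]_w ((c m w * D w) ^+ 2)%:E)%E.
  transitivity (\int[P]_w (((S m w ^+ 2)%:E + (2%:E * (S m w * c m w * D w)%:E))
    + ((c m w * D w) ^+ 2)%:E))%E.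
    apply: eq_integral => w _; rewrite -EFinM -!EFinD; congr EFin.
    by rewrite /S big_ord_recr/= -/(S m w) -/(D w); ring.
  rewrite integralD//; last first.
    by apply: integrableD => //; exact: integrableZl.
  rewrite integralD//; last exact: integrableZl.
  by rewrite integralZl// ScD0 mule0 adde0.
rewrite E; split; last exact: lte_add_pinfty.
by rewrite big_ord_recr/=; apply: leeD => //; rewrite [leRHS]muleC.
Qed.

End martingale_transform.

(** * Ito integrals against the sign of an increment *)

Section simple.
Context (R : realType) (dO : measure_display) (Omega : measurableType dO).
Context (P : probability Omega R) (B : R -> Omega -> R).
Hypotheses (P_complete : measure_is_complete P) (B_bm : brownian_motion P B).
Local Notation F := (filtration P B).
Local Notation leb := (@lebesgue_measure R).
Variables (T t : R) (H : simple_process P B T).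
Hypothesis tT : 0 <= t <= T.

Local Notation n := (sp_size H).
Local Notation s_ := (sp_time H).
Local Notation c := (sp_coef H).

Lemma sp_time_mono i j : (i <= j)%N -> (j <= n)%N -> s_ i <= s_ j.
Proof.
move=> + jn; elim: j jn => [|j IH jn]; first by rewrite leqn0 => _ /eqP ->.
rewrite leq_eqVlt => /orP[/eqP ->//|ij].
by rewrite (le_trans (IH (ltnW jn) ij))// sp_time_le.
Qed.

Let s_ge0 i : (i <= n)%N -> 0 <= s_ i.
Proof. by move=> ni; rewrite -(sp_time_start H) sp_time_mono. Qed.

Let sig i := Num.min (s_ i) t.
Let tau i := Num.max (s_ i) t.
Let t0 : 0 <= t. Proof. by case/andP: tT. Qed.

Let sig_ge0 i : (i <= n)%N -> 0 <= sig i.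
Proof. by move=> ni; rewrite le_min s_ge0. Qed.

Let tau_le i : (i < n)%N -> tau i <= tau i.+1.
Proof. by move=> ni; rewrite /tau ge_max !le_max sp_time_le// lexx orbT. Qed.

(** [sp_past] and [sp_future] are the parts of the integral of [H] that come from
    the times before and after [t].
    Cutting the time grid with [min] and [max] makes this work for a [t] that is
    not one of its points. *)
Definition sp_past w := \sum_(i < n) c i w * (B (sig i.+1) w - B (sig i) w).
Definition sp_future w := \sum_(i < n) c i w * (B (tau i.+1) w - B (tau i) w).

Lemma sp_integral_split w : sp_integral H w = sp_past w + sp_future w.
Proof.
rewrite /sp_integral /sp_past /sp_future -big_split/=; apply: eq_bigr => i _.
rewrite -mulrDr; congr (_ * _); rewrite /sig /tau.
have E r : B (Num.max r t) w + B (Num.min r t) w = B r w + B t w.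
  by case: (leP r t) => _ //; rewrite addrC.
have := E (s_ i.+1); have := E (s_ i); lra.
Qed.

Let mc i : (i < n)%N -> measurable_fun setT (c i).
Proof.
by move=> ni; exact: measurable_fun_filtration (sp_coef_adapted ni).
Qed.

Lemma sp_past_adapted : measurable_fun [set: F t] sp_past.
Proof.
apply: measurable_sum => i.
have [si|si] := leP (s_ i) t; last first.
  rewrite (_ : (fun w => _) = cst 0); first exact: measurable_cst.
  apply/funext => w; rewrite /sig !min_r ?subrr ?mulr0//; first exact: ltW.
  by rewrite (le_trans (ltW si))// sp_time_le.
apply: measurable_funM.
  exact: (measurable_fun_filtration_le si (sp_coef_adapted _)).
by apply: measurable_funB; apply: measurable_brownian_filtration;
  rewrite sig_ge0 ?(ltnW (ltn_ord i))// ge_min lexx orbT.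
Qed.

Lemma sp_past_integrable : P.-integrable setT (EFin \o sp_past).
Proof.
rewrite (_ : EFin \o sp_past = fun w => (\sum_(i < n)
    (c i w * (B (sig i.+1) w - B (sig i) w))%:E)%E); last first.
  by apply/funext => w /=; rewrite sumEFin.
apply: integrable_sum => // i _.
have : sig i <= sig i.+1.
  by rewrite /sig le_min !ge_min sp_time_le// lexx orbT.
rewrite le_eqVlt => /orP[/eqP <-|lt].
  by under eq_fun do rewrite subrr mulr0; exact: integrable0.
have := integrable_increment B_bm (sig_ge0 (ltnW (ltn_ord i))) lt.
have [M cM] := sp_coef_bounded (ltn_ord i) => Di.
have := @integrableMr _ _ _ P setT measurableT (c i) _ (mc (ltn_ord i)) _ Di.
apply; exists M; split; first exact: num_real.
by move=> x Mx w _; exact: le_trans (cM w) (ltW Mx).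
Qed.

Lemma sp_eval_on j s w : (j < n)%N -> s_ j < s <= s_ j.+1 -> sp_eval H s w = c j w.
Proof.
move=> jn sj; rewrite /sp_eval (bigD1 (Ordinal jn))//= big1 ?addr0.
  by rewrite indicE mem_set ?mulr1//= in_itv.
move=> i /negP ij; rewrite indicE memNset ?mulr0//= in_itv/= => /andP[si1 si2].
case/andP: sj => sj1 sj2; apply: ij; apply/eqP/val_inj => /=.
apply/eqP; rewrite eqn_leq; apply/andP; split; rewrite leqNgt; apply/negP => ij.
  have := sp_time_mono ij (ltnW (ltn_ord i)).
  by rewrite leNgt (lt_le_trans si1 sj2).
have := sp_time_mono ij (ltnW jn).
by rewrite leNgt (lt_le_trans sj1 si2).
Qed.

Lemma measurable_sp_eval :
  measurable_fun setT (fun p : measurableTypeR R * Omega => sp_eval H p.1 p.2).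
Proof.
apply: measurable_sum => i; apply: measurable_funM.
  exact: measurableT_comp (mc (ltn_ord i)) measurable_snd.
by apply: measurableT_comp measurable_fst; exact: measurable_indic.
Qed.

Lemma measurable_sp_eval_section w :
  measurable_fun setT (fun s : measurableTypeR R => sp_eval H s w).
Proof.
exact: (measurableT_comp measurable_sp_eval (pair2_measurable w)).
Qed.

(** The cut grid starts at [t] and ends at [T], and [sp_eval H] is constant on each
    of its intervals. *)
Lemma sp_energy w :
  (\int[leb]_(s in `]t, T]) (sp_eval H s w ^+ 2)%:E =
   \sum_(i < n) ((tau i.+1 - tau i) * c i w ^+ 2)%:E)%E.
Proof.
have tauE : tau n = T by rewrite /tau sp_time_end max_l//; case/andP: tT.
suff E m : (m <= n)%N -> (\int[leb]_(s in `]t, tau m]) (sp_eval H s w ^+ 2)%:E =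
   \sum_(i < m) ((tau i.+1 - tau i) * c i w ^+ 2)%:E)%E by rewrite -E// tauE.
elim: m => [_|m IH mn].
  by rewrite big_ord0 /tau sp_time_start max_r// set_itvoc0 integral_set0.
have tm := tau_le mn.
have ttm : t <= tau m by rewrite /tau le_max lexx orbT.
rewrite (_ : [set` `]t, tau m.+1]] = `]t, tau m]%classic `|` `]tau m, tau m.+1]%classic); last first.
  by rewrite -itv_bndbnd_setU// bnd_simp.
have mse D : measurable_fun D (fun s : measurableTypeR R => (sp_eval H s w ^+ 2)%:E).
  apply/measurable_EFinP; apply: measurable_funX; apply: measurable_funTS.
  exact: measurable_sp_eval_section.
rewrite ge0_integral_setU//=; last 2 first.
- by move=> x _; rewrite lee_fin sqr_ge0.
- rewrite disj_set2E; apply/eqP/seteqP; split => // x []/=.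
  by rewrite !in_itv/= => /andP[_ xm] /andP[mx _]; rewrite ltNge xm in mx.
rewrite (IH (ltnW mn)) big_ord_recr/=; congr (_ + _)%E.
rewrite (eq_integral (fun=> (c m w ^+ 2)%:E)); last first.
  move=> s; rewrite inE/= in_itv/= => /andP[s1 s2]; rewrite (sp_eval_on (j := m))//.
  move: s1 s2; rewrite /tau gt_max le_max => /andP[-> ts] /orP[//|].
  by rewrite leNgt ts.
rewrite integral_cst//= lebesgue_measure_itv/= lte_fin.
case: ltgtP tm => // [_ _|-> _]; first by rewrite -EFinD -EFinM mulrC.
by rewrite subrr mul0r mule0.
Qed.

Lemma sp_future_integrable_sq :
  measurable_fun setT sp_future /\
  (\int[P]_w (sp_future w ^+ 2)%:E <=
   8%:E * \int[P]_w \int[leb]_(s in `]t, T]) (sp_eval H s w ^+ 2)%:E)%E /\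
  (\int[P]_w (sp_future w ^+ 2)%:E < +oo)%E.
Proof.
have tau0 : 0 <= tau 0 by rewrite /tau sp_time_start le_max lexx.
have cad i : (i < n)%N -> measurable_fun [set: F (tau i)] (c i).
  move=> ni; apply: (measurable_fun_filtration_le _ (sp_coef_adapted ni)).
  by rewrite /tau le_max lexx.
have tau_ge0 i : 0 <= tau i by rewrite /tau le_max t0 orbT.
have mf : measurable_fun setT sp_future.
  apply: measurable_sum => i; apply: measurable_funM; first exact: mc.
  by apply: measurable_funB; exact: (brownian_measurable B_bm).
have [le oo] := martingale_transform_sq_le P_complete B_bm tau0 tau_le cad
  (sp_coef_bounded (s := H)) (leqnn n).
split=> //; split => //; apply: (le_trans le).
rewrite (eq_integral _ _ (fun w _ => sp_energy w)).
rewrite ge0_integral_sum//; last 2 first.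
- move=> i; apply/measurable_EFinP; apply: measurable_funM => //.
  by apply: measurable_funX; exact: mc.
- by move=> i w _; rewrite lee_fin mulr_ge0 ?sqr_ge0// subr_ge0 tau_le.
rewrite ge0_sume_distrr; last first.
  move=> i _; apply: integral_ge0 => w _.
  by rewrite lee_fin mulr_ge0 ?sqr_ge0// subr_ge0 tau_le.
apply: lee_sum => i _.
have -> : (\int[P]_w ((tau i.+1 - tau i) * c i w ^+ 2)%:E =
    (tau i.+1 - tau i)%:E * \int[P]_w (c i w ^+ 2)%:E)%E.
  rewrite -ge0_integralZl//.
  - by apply/measurable_EFinP; apply: measurable_funX; exact: mc.
  - by move=> w _; rewrite lee_fin sqr_ge0.
  - by rewrite lee_fin subr_ge0 tau_le.
by rewrite muleA -EFinM.
Qed.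

End simple.

Section ito.
Context (R : realType) (dO : measure_display) (Omega : measurableType dO).
Context (P : probability Omega R) (B : R -> Omega -> R).
Hypotheses (P_complete : measure_is_complete P) (B_bm : brownian_motion P B).
Local Notation F := (filtration P B).
Local Notation leb := (@lebesgue_measure R).

(** The sign of an increment replaces the increment itself because it is bounded:
    its product with an integrable variable is integrable. *)
Definition incr_sg (t t' : R) (w : Omega) : R := Num.sg (B t' w - B t w).

Lemma incr_sg_le1 t t' w : `|incr_sg t t' w| <= 1.
Proof. by rewrite normr_sg; case: (_ != 0). Qed.

Lemma measurable_incr_sg t t' : 0 <= t -> t < t' ->
  measurable_fun setT (incr_sg t t').
Proof.
by move=> t0 tt'; exact: measurableT_comp (@measurable_sg R) (measurable_increment B_bm t0 tt').
Qed.

Lemma integrable_incr_sgM t t' (X : Omega -> R) : 0 <= t -> t < t' ->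
  P.-integrable setT (EFin \o X) ->
  P.-integrable setT (fun w => (incr_sg t t' w * X w)%:E).
Proof.
move=> t0 tt' Xi.
have := @integrableMr _ _ _ P setT measurableT _ _ (measurable_incr_sg t0 tt') _ Xi.
apply; exists 1; split => // x x1 w _; exact: le_trans (incr_sg_le1 t t' w) (ltW x1).
Qed.

Lemma integral_incr_sgM_le t t' (X : Omega -> R) : 0 <= t -> t < t' ->
  P.-integrable setT (EFin \o X) ->
  (`|\int[P]_w (incr_sg t t' w * X w)%:E| <= \int[P]_w `|X w|%:E)%E.
Proof.
move=> t0 tt' Xi; have Xi' := integrable_incr_sgM t0 tt' Xi.
apply: (le_trans (le_abse_integral _ measurableT (measurable_int _ Xi'))).
apply: ge0_le_integral => //.
- by apply: measurableT_comp => //; exact: measurable_int Xi'.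
- apply/measurable_EFinP; apply: measurableT_comp => //.
  by apply/measurable_EFinP; exact: measurable_int Xi.
- by move=> w _; rewrite abse_EFin lee_fin normrM ler_piMl// incr_sg_le1.
Qed.

Lemma integral_incr_sg_past t t' (X : Omega -> R) : 0 <= t -> t < t' ->
  measurable_fun [set: F t] X -> P.-integrable setT (EFin \o X) ->
  (\int[P]_w (incr_sg t t' w * X w)%:E = 0)%E.
Proof.
move=> t0 tt' mX Xi.
have sgi : P.-integrable setT (fun w => (Num.sg (B t' w - B t w))%:E).
  have := integrable_incr_sgM t0 tt' (X := cst 1).
  rewrite (_ : (fun w => (incr_sg t t' w * cst 1 w)%:E) = (fun w => (incr_sg t t' w)%:E)).
    by apply; exact: finite_measure_integrable_cst.
  by apply/funext => w; rewrite /= mulr1.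
have sgN (x : R) : Num.sg (- x) = - Num.sg x by rewrite sgrN.
have [_ E] := integral_past_increment_odd P_complete B_bm t0 tt' mX Xi (@measurable_sg R) sgN sgi.
by rewrite -[RHS]E; apply: eq_integral => w _; rewrite mulrC.
Qed.

Lemma cvge0_near_le (u : nat -> \bar R) (e : R) : 0 < e ->
  u k @[k --> \oo] --> 0%E -> \forall k \near \oo, (u k <= e%:E)%E.
Proof.
move=> e0 u0; suff : \forall k \near \oo, (u k < e%:E)%E.
  by apply: filterS => k /ltW.
have N : nbhs (0%E : \bar R) [set y : \bar R | (y < e%:E)%E].
  apply: open_nbhs_nbhs; split; last by rewrite /= lte_fin.
  exact: open_ereal_lt_ereal.
exact: (u0 _ N).
Qed.

(** Replace [h] by a simple process [H k]. The integral of [H k] over [[0, t]] is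
    [F t]-measurable, so it is orthogonal to the sign; the integral over [[t, T]]
    is bounded in [L^2] by the energy of [H k] on that interval, which is close to
    the energy of [h]. The parameter [e] serves both as the accuracy of the
    approximation and as the weight in [integral_abs_le_sq]. The constants come
    from the factor 8 of [integral_normal_sq_le] and from squares of sums. *)
Lemma integral_incr_sg_ito_le (T t t' A e : R) (h : R -> Omega -> R) (Z : Omega -> R) :
  0 <= t <= T -> t < t' -> 0 < e -> is_ito_integral P B T h Z ->
  (\int[P]_w \int[leb]_(s in `]t, T]) (h s w ^+ 2)%:E <= A%:E)%E ->
  P.-integrable setT (EFin \o Z) /\
  (`|\int[P]_w (incr_sg t t' w * Z w)%:E| <= (19 * e + 16 * e^-1 * A)%:E)%E.
Proof.
move=> tT tt' e0 [mh mZ [H [Hh IZ]]] hA.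
have t0 : 0 <= t by case/andP: tT.
have e20 : 0 < e ^+ 2 by rewrite exprn_gt0.
have [k [Hk Ik]] : exists k, ((\int[P]_w \int[leb]_(s in `[0%R, T])
           ((sp_eval (H k) s w - h s w) ^+ 2)%:E <= (e ^+ 2)%:E) /\
        \int[P]_w ((sp_integral (H k) w - Z w) ^+ 2)%:E <= (e ^+ 2)%:E)%E.
  have N1 := cvge0_near_le e20 Hh; have N2 := cvge0_near_le e20 IZ.
  by have [k [k1 k2]] := @filter_ex _ _ _ _ (filterI N1 N2); exists k.
set past := sp_past t (H k); set fut := sp_future t (H k).
have [mfut [fut_le fut_oo]] := sp_future_integrable_sq P_complete B_bm (H k) tT.
have pasti : P.-integrable setT (EFin \o past) := sp_past_integrable P_complete B_bm (H k) tT.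
have P1 : (P setT <= 1)%E := probability_le1 P measurableT.
have Poo : (P setT < +oo)%E by apply: le_lt_trans P1 _; rewrite ltry.
have futi : P.-integrable setT (EFin \o fut) by exact: integrable_sq.
pose err w := sp_integral (H k) w - Z w.
have merr : measurable_fun setT err.
  apply: measurable_funB => //.
  rewrite (_ : sp_integral (H k) = fun w => past w + fut w); last first.
    by apply/funext => w; exact: sp_integral_split.
  by apply: measurable_funD => //; apply/measurable_EFinP; exact: measurable_int pasti.
have erri : P.-integrable setT (EFin \o err).
  by apply: integrable_sq => //; rewrite (le_lt_trans Ik)// ltry.
have ZE w : Z w = past w + (fut w - err w).
  by rewrite /err (sp_integral_split t); rewrite -/past -/fut; ring.
have Zi : P.-integrable setT (EFin \o Z).
  rewrite (_ : EFin \o Z = ((EFin \o past) \+ ((EFin \o fut) \- (EFin \o err)))%E).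
    by apply: integrableD => //; exact: integrableB.
  by apply/funext => w /=; rewrite ZE EFinD EFinB.
split => //.
have abs_le X : measurable_fun setT X -> P.-integrable setT (EFin \o X) ->
   (`|\int[P]_w (incr_sg t t' w * X w)%:E| <=
     e%:E + e^-1%:E * \int[P]_w (X w ^+ 2)%:E)%E.
  move=> mX Xi; apply: le_trans (integral_incr_sgM_le t0 tt' Xi) _.
  apply: le_trans (integral_abs_le_sq P measurableT mX e0) _.
  apply: leeD => //; rewrite -[leRHS]mule1; apply: lee_wpmul2l => //.
  by rewrite lee_fin ltW.
have energy : (\int[P]_w \int[leb]_(s in `]t, T]) (sp_eval (H k) s w ^+ 2)%:E <=
    (2 * e ^+ 2 + 2 * A)%:E)%E.
  have sub : `]t, T]%classic `<=` `[0, T]%classic.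
    by move=> s /=; rewrite !in_itv/= => /andP[ts ->]; rewrite (le_trans t0 (ltW ts)).
  have mE : measurable_fun setT (fun p : measurableTypeR R * Omega =>
    sp_eval (H k) p.1 p.2) := measurable_sp_eval P_complete B_bm (H k).
  pose g s w := sp_eval (H k) s w - h s w.
  have mg : measurable_fun (`[0, T] `*` setT)
      (fun p : measurableTypeR R * Omega => g p.1 p.2).
    by apply: measurable_funB => //; exact: measurable_funTS.
  have m0T : measurable (`[0, T]%classic : set (measurableTypeR R)) by [].
  have mtT : measurable (`]t, T]%classic : set (measurableTypeR R)) by [].
  have meas (X : R -> Omega -> R) (D : set (measurableTypeR R)) : measurable D ->
      D `<=` `[0, T]%classic ->
      measurable_fun (`[0, T] `*` setT)
       (fun p : measurableTypeR R * Omega => X p.1 p.2) ->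
      measurable_fun setT (fun w => \int[leb]_(s in D) (X s w ^+ 2)%:E)%E /\
      forall w, measurable_fun D (fun s : measurableTypeR R => X s w).
    move=> mD D0 mX.
    have mXD : measurable_fun (D `*` setT) (fun p : measurableTypeR R * Omega => X p.1 p.2).
      apply: measurable_funS mX; first exact: measurableX.
      by move=> [s w] [/= /D0].
    split => [|w].
      apply: (measurable_integral_section2 leb (f := fun p => (X p.1 p.2 ^+ 2)%:E)) => //.
        by apply/measurable_EFinP; exact: measurable_funX.
      by move=> p _; rewrite lee_fin sqr_ge0.
    have : measurable_fun D (fun s : measurableTypeR R => (s, w)).
      by apply: measurable_funTS; exact: pair2_measurable.
    apply: (measurable_comp _ _ mXD) => //; first exact: measurableX.
    by move=> _ /= [s Ds <-]; split.
  have [mg1 mg2] := meas g _ mtT sub mg.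
  have [mg3 _] := meas g _ m0T (@subset_refl _ _) mg.
  have [mh1 mh2] := meas h _ mtT sub mh.
  have [ms1 ms2] := meas _ _ mtT sub (measurable_funTS mE).
  apply: (@le_trans _ _ (\int[P]_w (2%:E * \int[leb]_(s in `]t, T]) (g s w ^+ 2)%:E +
      2%:E * \int[leb]_(s in `]t, T]) (h s w ^+ 2)%:E)))%E.
    apply: ge0_le_integral => //.
    - by move=> w _; apply: integral_ge0 => s _; rewrite lee_fin sqr_ge0.
    - by apply: emeasurable_funD; exact: measurable_funeM.
    - move=> w _; apply: le_trans (integral_sqD_le leb mtT (mg2 w) (mh2 w)).
      by under eq_integral do rewrite /g subrK.
  rewrite ge0_integralD//; last 4 first.
  - by move=> w _; rewrite mule_ge0// integral_ge0// => s _; rewrite lee_fin sqr_ge0.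
  - exact: measurable_funeM.
  - by move=> w _; rewrite mule_ge0// integral_ge0// => s _; rewrite lee_fin sqr_ge0.
  - exact: measurable_funeM.
  rewrite !ge0_integralZl//; try by move=> w _; rewrite integral_ge0// => s _; rewrite lee_fin sqr_ge0.
  rewrite (_ : (2 * e ^+ 2 + 2 * A)%:E = (2%:E * (e ^+ 2)%:E + 2%:E * A%:E)%E); last first.
    by rewrite -!EFinM -EFinD.
  have two0 : (0 <= 2%:E :> \bar R)%E by rewrite lee_fin.
  apply: leeD; apply: (lee_wpmul2l two0); last exact: hA.
  apply: le_trans Hk; apply: ge0_le_integral => //.
  - by move=> w _; apply: integral_ge0 => s _; rewrite lee_fin sqr_ge0.
  - move=> w _; apply: ge0_subset_integral => //.
      apply/measurable_EFinP; apply: measurable_funX.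
      by case: (meas g _ m0T (@subset_refl _ _) mg).
    by move=> s _; rewrite lee_fin sqr_ge0.
have E : (\int[P]_w (incr_sg t t' w * Z w)%:E =
   \int[P]_w (incr_sg t t' w * fut w)%:E - \int[P]_w (incr_sg t t' w * err w)%:E)%E.
  transitivity (\int[P]_w ((incr_sg t t' w * past w)%:E +
     ((incr_sg t t' w * fut w)%:E - (incr_sg t t' w * err w)%:E)))%E.
    by apply: eq_integral => w _; rewrite -EFinB -EFinD ZE; congr EFin; ring.
  have i1 := integrable_incr_sgM t0 tt' pasti.
  have i2 := integrable_incr_sgM t0 tt' futi.
  have i3 := integrable_incr_sgM t0 tt' erri.
  rewrite integralD//; last exact: integrableB.
  rewrite (integral_incr_sg_past t0 tt' (sp_past_adapted (H k) tT) pasti).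
  by rewrite add0e integralB.
rewrite E; apply: le_trans (lee_abs_sub _ _) _.
apply: (@le_trans _ _ ((e + e^-1 * (8 * (2 * e ^+ 2 + 2 * A)))%:E + (e + e^-1 * e ^+ 2)%:E))%E.
  apply: leeD.
    apply: le_trans (abs_le _ mfut futi) _; rewrite [leRHS]EFinD; apply: leeD => //.
    rewrite EFinM; apply: lee_wpmul2l; first by rewrite lee_fin invr_ge0 ltW.
    apply: le_trans fut_le _; rewrite EFinM; exact: lee_wpmul2l.
  apply: le_trans (abs_le _ merr erri) _; rewrite [leRHS]EFinD; apply: leeD => //.
  by rewrite EFinM; apply: lee_wpmul2l => //; rewrite lee_fin invr_ge0 ltW.
rewrite -EFinD lee_fin le_eqVlt; apply/orP; left; apply/eqP.
by field; rewrite gt_eqF.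
Qed.

(** The obstruction to reachability: a variable that the dynamics can produce at
    time [T] owes to the increments of [B] after [t] only an amount of order
    [sqrt (T - t)]. *)
Definition correlation_decay (T : R) (K : Omega -> R) : Prop :=
  P.-integrable setT (EFin \o K) /\
  exists C, forall t t', 0 <= t < T -> t < t' ->
    (`|\int[P]_w (incr_sg t t' w * K w)%:E| <= (C * Num.sqrt (T - t))%:E)%E.

Lemma correlation_decayD T K1 K2 : correlation_decay T K1 ->
  correlation_decay T K2 -> correlation_decay T (fun w => K1 w + K2 w).
Proof.
move=> [i1 [C1 le1]] [i2 [C2 le2]]; split; first exact: (integrableD measurableT i1 i2).
exists (C1 + C2) => t t' tT tt'; have /andP[t0 _] := tT.
have j1 := integrable_incr_sgM t0 tt' i1.
have j2 := integrable_incr_sgM t0 tt' i2.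
under eq_integral do rewrite mulrDr EFinD.
rewrite integralD// mulrDl EFinD.
apply: le_trans (lee_abs_add _ _) _.
by apply: leeD; [exact: le1|exact: le2].
Qed.

End ito.

(** * Adapted square integrable processes and their time integrals *)

Section drift.
Context (R : realType) (dO : measure_display) (Omega : measurableType dO).
Context (P : probability Omega R) (B : R -> Omega -> R).
Hypotheses (P_complete : measure_is_complete P) (B_bm : brownian_motion P B).
Local Notation F := (filtration P B).
Local Notation leb := (@lebesgue_measure R).
Variables (T : R) (dE : measure_display) (E : measurableType dE).
Variables (m : {sigma_finite_measure set E -> \bar R}) (D : set E).
Hypotheses (mD : measurable D) (mDoo : (m D < +oo)%E).

Lemma F_measurable_section t (X : Omega -> E -> R) z : D z ->
  F_measurable P B D t X -> measurable_fun [set: F t] (X ^~ z).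
Proof.
move=> Dz mX.
have mp : measurable_fun [set: F t] (fun w : F t => (w, z)).
  exact: pair2_measurable.
apply: (measurable_comp _ _ mX mp); first exact: measurableX.
by move=> _ /= [w _ <-].
Qed.

(** Time is the outermost variable because the coefficients of the equation are
    bounded at almost every time only. *)
Definition L2_process (X : R -> Omega -> E -> R) : Prop :=
  adapted_process P B T D X /\
  (\int[leb]_(s in `[0%R, T]) \int[P]_w \int[m]_(z in D) (X s w z ^+ 2)%:E
    < +oo)%E.

Let A : set (measurableTypeR R * E) := `[0, T] `*` D.
Let nu : {sigma_finite_measure set (measurableTypeR R * E)%type -> \bar R} := product_sigma_finite leb m.
Let mA : measurable A. Proof. exact: measurableX. Qed.

Lemma measurable_process_swap (X : R -> Omega -> E -> R) (I : set (measurableTypeR R)) :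
  measurable I -> I `<=` `[0, T] -> adapted_process P B T D X ->
  measurable_fun (setT `*` (I `*` D))
    (fun p : Omega * (measurableTypeR R * E) => X p.2.1 p.1 p.2.2).
Proof.
move=> mI IT [mX _].
pose r (p : Omega * (measurableTypeR R * E)) := (p.2.1, (p.1, p.2.2)).
have mr : measurable_fun (setT `*` (I `*` D)) r.
  apply: measurable_funTS; apply/measurable_fun_pairP; split.
    exact: measurableT_comp measurable_fst measurable_snd.
  apply/measurable_fun_pairP; split; first exact: measurable_fst.
  exact: measurableT_comp measurable_snd measurable_snd.
apply: (measurable_comp _ _ mX mr); first by apply: measurableX => //; exact: measurableX.
by move=> _ /= [[w [s z]] /= [_ [/IT Is Dz]] <-].
Qed.

Lemma sq_integral_prod (X : R -> Omega -> E -> R) : adapted_process P B T D X ->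
  (\int[P \x nu]_(p in setT `*` A) (X p.2.1 p.1 p.2.2 ^+ 2)%:E =
   \int[leb]_(s in `[0%R, T]) \int[P]_w \int[m]_(z in D) (X s w z ^+ 2)%:E)%E.
Proof.
move=> aX.
have m0T : measurable (`[0, T]%classic : set (measurableTypeR R)) by [].
have mX2 : measurable_fun (setT `*` A)
  (fun p : Omega * (measurableTypeR R * E) => (X p.2.1 p.1 p.2.2 ^+ 2)%:E).
  by apply/measurable_EFinP; apply: measurable_funX; exact: measurable_process_swap.
rewrite (tonelli_prod_on P nu measurableT mA mX2); last first.
  by move=> p _; rewrite lee_fin sqr_ge0.
have mXw w : measurable_fun A (fun x => (X x.1 w x.2 ^+ 2)%:E).
  have mw : measurable_fun A (fun x : measurableTypeR R * E => (w, x)).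
    by apply: measurable_funTS; exact: pair1_measurable.
  apply: (measurable_comp _ _ mX2 mw); first exact: measurableX.
  by move=> _ /= [x Ax <-].
transitivity (\int[P]_w \int[leb]_(s in `[0%R, T]) \int[m]_(z in D) (X s w z ^+ 2)%:E)%E.
  apply: eq_integral => w _.
  by rewrite (tonelli_prod_on leb m m0T mD (mXw w))// => p _; rewrite lee_fin sqr_ge0.
pose f (p : Omega * measurableTypeR R) := (\int[m]_(z in D) (X p.2 p.1 z ^+ 2)%:E)%E.
have m1 : measurable_fun ((setT `*` `[0, T]) `*` D)
   (fun q : (Omega * measurableTypeR R) * E => (X q.1.2 q.1.1 q.2 ^+ 2)%:E).
  pose r (q : (Omega * measurableTypeR R) * E) := (q.1.1, (q.1.2, q.2)).
  have mr : measurable_fun ((setT `*` `[0, T]) `*` D) r.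
    apply: measurable_funTS; apply/measurable_fun_pairP; split.
      exact: measurableT_comp measurable_fst measurable_fst.
    apply/measurable_fun_pairP; split; last exact: measurable_snd.
    exact: measurableT_comp measurable_snd measurable_fst.
  apply: (measurable_comp _ _ mX2 mr); first exact: measurableX.
  by move=> _ /= [[[w s] z] /= [[_ sT] Dz] <-].
have mf : measurable_fun (setT `*` `[0, T]) f.
  have mT0 : measurable (setT `*` `[0, T] : set (Omega * measurableTypeR R)).
    exact: measurableX.
  apply: (@measurable_integral_section1 _ _ _ _ _ m _ _ _ mT0 mD m1).
  by move=> p _; rewrite lee_fin sqr_ge0.
apply: (@tonelli_on _ _ _ _ _ P leb setT `[0, T]%classic f measurableT m0T mf) => p _.
by apply: integral_ge0 => z _; rewrite lee_fin sqr_ge0.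
Qed.

(** By Fubini's theorem the expectation is the integral over [(s, z)] of the
    expectations of [incr_sg B t t' w * X s w z]. These vanish for [s <= t], where
    [X s] is [F t]-measurable, and for [s > t] the bound in [L^2] yields the
    factor [sqrt (T - t)]. The variable [K] is the measurable version of the time
    integral of [X] that Fubini's theorem provides. *)
Lemma integral_incr_sg_drift_le (X : R -> Omega -> E -> R) : L2_process X ->
  exists2 K, {ae P, forall w,
    \int[leb]_(s in `[0, T]) \int[m]_(z in D) X s w z = K w} &
    correlation_decay P B T K.
Proof.
move=> [aX X2oo].
have m0T : measurable (`[0, T]%classic : set (measurableTypeR R)) by [].
have mX := measurable_process_swap m0T (@subset_refl _ _) aX.
pose psi (p : Omega * (measurableTypeR R * E)) := X p.2.1 p.1 p.2.2.
have mTA : measurable (setT `*` A : set (Omega * (measurableTypeR R * E))).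
  exact: measurableX.
pose PN : {sigma_finite_measure set (Omega * (measurableTypeR R * E))%type -> \bar R} :=
  product_sigma_finite P nu.
have PNE (I : set (measurableTypeR R)) : measurable I ->
    PN (setT `*` (I `*` D)) = (leb I * m D)%E.
  move=> mI; have mID : measurable (I `*` D) by exact: measurableX.
  rewrite [LHS](product_measure1E P nu measurableT mID).
  rewrite [X in (_ * X)%E](product_measure1E leb m mI mD).
  by rewrite [X in (X * _)%E](@probability_setT _ _ _ P) mul1e.
have mDge0 : (0 <= m D)%E by exact: measure_ge0.
have mDfin : m D \is a fin_num by rewrite ge0_fin_numE.
have PNoo : (PN (setT `*` A) < +oo)%E.
  have l0 : (leb `[0%R, T]%classic < +oo)%E.
    by rewrite lebesgue_measure_itv/=; case: ifP => _; rewrite -?EFinB ltry.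
  by rewrite PNE//; apply: lte_mul_pinfty => //; rewrite ge0_fin_numE.
pose L := (\int[PN]_(p in setT `*` A) (psi p ^+ 2)%:E)%E.
have L0 : (0 <= L)%E by apply: integral_ge0 => p _; rewrite lee_fin sqr_ge0.
have Loo : (L < +oo)%E by rewrite /L [ltLHS](sq_integral_prod aX).
have Lfin : L \is a fin_num by rewrite ge0_fin_numE.
have psii : PN.-integrable (setT `*` A) (EFin \o psi) by exact: integrable_sq.
pose g := (EFin \o psi) \_ (setT `*` A).
have gi : PN.-integrable setT g by apply/(integrable_mkcond _ mTA).
have mg : measurable_fun setT g := measurable_int _ gi.
pose FF := fubini_F nu g.
have FFi : P.-integrable setT FF := integrable_fubini_F gi.
pose K w := fine (FF w).
have mK : measurable_fun setT K.
  exact: measurableT_comp (fine_measurable measurableT) (measurable_int _ FFi).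
have KFF : {ae P, forall w, (K w)%:E = FF w}.
  have := integrable_ae measurableT FFi.
  by apply: filterS => w /(_ Logic.I) fin; rewrite /K fineK.

have Ki : P.-integrable setT (EFin \o K).
  apply: (le_integrable measurableT _ _ FFi); first exact/measurable_EFinP.
  by move=> w _ /=; rewrite /K; case: (FF w) => //= ; rewrite normr0 ?leey.
have gae : {ae P, forall w, nu.-integrable setT (fun x => g (w, x))} := ae_integrable1 gi.
exists K.
  apply: filterS gae => w gw.
  pose q : measurableTypeR R * E -> \bar R := fun x => (X x.1 w x.2)%:E.
  have gwE : (fun x => g (w, x)) = q \_ A.
    by apply/funext => x; rewrite /g !patchE in_setX/= in_setT.
  have qi : nu.-integrable A q by apply/(integrable_mkcond _ mA); rewrite -gwE.
  have <- := Rintegral_fubini_on m0T mD qi.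
  by rewrite /K /FF /fubini_F gwE -integral_mkcond.
split; first exact: Ki.
exists (fine (m D) + fine L).
move=> t t' /andP[t0 tT] tt'.
pose It : set (measurableTypeR R) := `]t, T]%classic.
have mIt : measurable It by exact: measurable_itv.
have ItT : It `<=` `[0, T]%classic.
  by rewrite /It => s /=; rewrite !in_itv/= => /andP[ts ->]; rewrite (le_trans t0 (ltW ts)).
pose At := It `*` D.
have mAt : measurable At by exact: measurableX.
have meps := measurable_incr_sg B_bm t0 tt'.
pose eps := incr_sg B t t'.
pose G p := ((eps p.1)%:E * g p)%E.
have Gi : PN.-integrable setT G.
  have := @integrableMr _ _ _ PN setT measurableT (eps \o fst) g _ _ gi.
  apply; first exact: measurableT_comp meps measurable_fst.
  by exists 1; split => // x x1 p _; exact: le_trans (incr_sg_le1 B t t' p.1) (ltW x1).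
have -> : (\int[P]_w (incr_sg B t t' w * K w)%:E = \int[P]_w \int[nu]_x G (w, x))%E.
  apply: ae_eq_integral => //.
  - apply/measurable_EFinP; exact: measurable_funM.
  - exact: measurable_int (integrable_fubini_F Gi).
  - apply: filterS2 KFF gae => w KE gw _.
    by rewrite EFinM KE /G/= integralZl.
rewrite (Fubini Gi).
pose J x := (\int[P]_w G (w, x))%E.
have mJ : measurable_fun setT J := measurable_fubini_G Gi.
apply: le_trans (le_abse_integral _ measurableT mJ) _.
pose H x := (\int[P]_w `|g (w, x)|)%E.
have mag : measurable_fun setT (fun p => `|g p|)%E by exact: measurableT_comp.
have mH : measurable_fun setT H.
  exact: (measurable_fun_fubini_tonelli_G (fun p => `|g p|)%E mag).
have H0 x : (0 <= H x)%E by exact: integral_ge0.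
apply: (@le_trans _ _ (\int[nu]_x (H \_ At) x)%E).
  apply: ae_ge0_le_integral => //.
  - exact: measurableT_comp.
  - by move=> x _; rewrite patchE; case: ifP.
  - by apply: (measurable_restrictT H mAt).1; exact: measurable_funTS.
  have := ae_integrable2 gi.
  apply: filterS => -[s z] gsi _; rewrite patchE; case: ifPn => [_|].
    have Gsi : P.-integrable setT (fun w => G (w, (s, z))).
      have := @integrableMr _ _ _ P setT measurableT eps _ meps _ gsi.
      by apply; exists 1; split => // x x1 w _; exact: le_trans (incr_sg_le1 B t t' w) (ltW x1).
    apply: le_trans (le_abse_integral _ measurableT (measurable_int _ Gsi)) _.
    apply: ge0_le_integral => //.
    - by apply: measurableT_comp => //; exact: measurable_int Gsi.
    - by apply: measurableT_comp => //; exact: measurable_int gsi.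
    - move=> w _; rewrite /G abseM -[leRHS]mul1e; apply: lee_wpmul2r => //.
      by rewrite abse_EFin lee_fin incr_sg_le1.
  move=> /negP nAt; suff -> : J (s, z) = 0%E by rewrite abse0.
  have [sA|sA] := pselect (A (s, z)); last first.
    apply: integral0_eq => w _; rewrite /G /g patchE memNset ?mule0//.
    by move=> [_].
  have [/= sT Dz] := sA.
  have st : s <= t.
    rewrite leNgt; apply/negP => ts; apply: nAt; rewrite inE; split => //.
    by rewrite /It/=; move: sT; rewrite !in_itv/= ts/= => /andP[_ ->].
  have gE : (fun w => g (w, (s, z))) = EFin \o (X s ^~ z).
    by apply/funext => w; rewrite /g patchE mem_set.
  rewrite gE in gsi.
  have sT' : 0 <= s <= T by move: sT; rewrite in_itv.
  have ms := aX.2 s sT'.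
  rewrite -(integral_incr_sg_past P_complete B_bm t0 tt' _ gsi).
    apply: eq_integral => w _; rewrite EFinM /G/=; congr (_ * _)%E.
    by have := congr1 (fun f => f w) gE.
  exact: (measurable_fun_filtration_le st (F_measurable_section Dz ms)).
rewrite -integral_mkcond.
have mpt : measurable_fun (setT `*` At) psi.
  by apply: measurable_funS mX => //; move=> [w [s z]] [_ [/ItT]].
have mTAt : measurable (setT `*` At : set (Omega * (measurableTypeR R * E))).
  exact: measurableX.
have mapt : measurable_fun (setT `*` At) (fun p => `|psi p|%:E).
  by apply/measurable_EFinP; exact: measurableT_comp.
have -> : (\int[nu]_(x in At) H x = \int[PN]_(p in setT `*` At) `|psi p|%:E)%E.
  rewrite [RHS](tonelli_prod_on P nu measurableT mAt mapt)// (tonelli_on P nu measurableT mAt mapt)//.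
  apply: eq_integral => -[s z]; rewrite inE => -[/= /ItT sT Dz].
  by apply: eq_integral => w _; rewrite /g patchE mem_set.
(* The region of integration has measure (T - t) * m D: this weight balances
   the two terms of the estimate. *)
pose e := (Num.sqrt (T - t))^-1.
have e0 : 0 < e by rewrite invr_gt0 sqrtr_gt0 subr_gt0.
apply: le_trans (integral_abs_le_sq PN mTAt mpt e0) _.
have PNAt : PN (setT `*` At) = ((T - t)%:E * m D)%E.
  by rewrite (PNE It mIt) /It lebesgue_measure_itv/= lte_fin tT EFinB.
rewrite [X in (_ * X + _)%E]PNAt.
rewrite mulrDl [leRHS]EFinD; apply: leeD.
  rewrite -{1}(fineK mDfin) -!EFinM lee_fin mulrA [leRHS]mulrC.
  apply: ler_wpM2r; first by rewrite fine_ge0.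
  have sq : Num.sqrt (T - t) != 0 by rewrite -invr_eq0 gt_eqF.
  rewrite -{1}[T - t]sqr_sqrtr ?subr_ge0 ?(ltW tT)//.
  by rewrite /e expr2 mulrA mulVf// mul1r.
rewrite EFinM fineK// /e invrK muleC; apply: lee_wpmul2r.
  by rewrite lee_fin sqrtr_ge0.
apply: ge0_subset_integral => //.
- by apply/measurable_EFinP; apply: measurable_funX.
- by move=> p _; rewrite lee_fin sqr_ge0.
- by move=> [w [s z]] [_ [/ItT]].
Qed.

End drift.

Section adapted.
Context (R : realType) (dO : measure_display) (Omega : measurableType dO).
Context (P : probability Omega R) (B : R -> Omega -> R) (T : R).
Local Notation leb := (@lebesgue_measure R).
Local Notation I := (`[0, T]%classic : set (measurableTypeR R)).

Section closure.
Context (dE : measure_display) (E : measurableType dE) (D : set E).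
Local Notation adapted := (adapted_process P B T D).

Lemma adapted_processD X Y : adapted X -> adapted Y ->
  adapted (fun s w z => X s w z + Y s w z).
Proof.
move=> [mX aX] [mY aY]; split; first exact: measurable_funD.
by move=> t tT; apply: measurable_funD; [exact: aX|exact: aY].
Qed.

Lemma adapted_processM X Y : adapted X -> adapted Y ->
  adapted (fun s w z => X s w z * Y s w z).
Proof.
move=> [mX aX] [mY aY]; split; first exact: measurable_funM.
by move=> t tT; apply: measurable_funM; [exact: aX|exact: aY].
Qed.

(** A function of the space variable is a deterministic process. *)
Lemma adapted_process_space (mD : measurable D) (g : E -> R) :
  measurable_fun D g -> adapted (fun _ _ => g).
Proof.
move=> mg; split => [|t tT].
  have mp : measurable_fun (I `*` (setT `*` D))
      (fun p : measurableTypeR R * (Omega * E) => p.2.2).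
    by apply: measurable_funTS; exact: measurableT_comp measurable_snd measurable_snd.
  by apply: (measurable_comp _ _ mg mp) => // _ [[s [w z]] /= [_ [_ Dz]] <-].
have mp : measurable_fun ([set: filtration P B t] `*` D)
    (fun p : filtration P B t * E => p.2).
  by apply: measurable_funTS; exact: measurable_snd.
by apply: (measurable_comp _ _ mg mp) => // _ [[w z] /= [_ Dz] <-].
Qed.

End closure.

Lemma adapted_process_comp d1 d2 (E1 : measurableType d1) (E2 : measurableType d2)
    (D1 : set E1) (D2 : set E2) (r : E2 -> E1) (X : R -> Omega -> E1 -> R) :
  measurable D1 -> measurable D2 -> measurable_fun setT r ->
  (forall x, D2 x -> D1 (r x)) -> adapted_process P B T D1 X ->
  adapted_process P B T D2 (fun s w x => X s w (r x)).
Proof.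
move=> mD1 mD2 mr rD [mX aX]; split => [|t tT].
  have mp : measurable_fun (I `*` (setT `*` D2))
      (fun p : measurableTypeR R * (Omega * E2) => (p.1, (p.2.1, r p.2.2))).
    apply: measurable_funTS; apply/measurable_fun_pairP; split; first exact: measurable_fst.
    apply/measurable_fun_pairP; split.
      exact: measurableT_comp measurable_fst measurable_snd.
    apply: (measurableT_comp mr); exact: measurableT_comp measurable_snd measurable_snd.
  apply: (measurable_comp _ _ mX mp).
    by apply: measurableX => //; exact: measurableX.
  by move=> _ [[s [w z]] /= [sT [_ Dz]] <-]; split => //; split => //; exact: rD.
have mp : measurable_fun ([set: filtration P B t] `*` D2)
    (fun p : filtration P B t * E2 => (p.1, r p.2)).
  apply: measurable_funTS; apply/measurable_fun_pairP; split; first exact: measurable_fst.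
  exact: measurableT_comp mr measurable_snd.
apply: (measurable_comp _ _ (aX t tT) mp); first exact: measurableX.
by move=> _ [[w z] /= [_ Dz] <-]; split => //; exact: rD.
Qed.

Lemma adapted_processS (dE : measure_display) (E : measurableType dE) (D D' : set E) X :
  measurable D -> measurable D' -> D' `<=` D ->
  adapted_process P B T D X -> adapted_process P B T D' X.
Proof.
by move=> mD mD' DD'; apply: (@adapted_process_comp _ _ _ _ D D' id) => // x /DD'.
Qed.

Section L2.
Context (dE : measure_display) (E : measurableType dE).
Variables (m : {sigma_finite_measure set E -> \bar R}) (D : set E).
Hypotheses (mD : measurable D) (mDoo : (m D < +oo)%E).
Local Notation adapted := (adapted_process P B T D).
Local Notation L2 := (L2_process P B T m D).

Definition sq_norm (X : R -> Omega -> E -> R) s w :=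
  (\int[m]_(z in D) (X s w z ^+ 2)%:E)%E.

Lemma sq_norm_ge0 X s w : (0 <= sq_norm X s w)%E.
Proof. by apply: integral_ge0 => z _; rewrite lee_fin sqr_ge0. Qed.

Lemma measurable_process_section X s w : adapted X -> 0 <= s <= T ->
  measurable_fun D (X s w).
Proof.
move=> [mX _] sT.
have mp : measurable_fun D (fun z => (s : measurableTypeR R, (w, z))).
  apply: measurable_funTS; apply/measurable_fun_pairP; split; first exact: measurable_cst.
  by apply/measurable_fun_pairP; split; [exact: measurable_cst|exact: measurable_id].
apply: (measurable_comp _ _ mX mp).
  by apply: measurableX => //; exact: measurableX.
by move=> _ [z Dz <-]; split => //=; rewrite in_itv.
Qed.

Lemma measurable_sq_norm X : adapted X ->
  measurable_fun (I `*` setT) (fun p : measurableTypeR R * Omega => sq_norm X p.1 p.2).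
Proof.
move=> [mX _].
have mIT : measurable (I `*` setT : set (measurableTypeR R * Omega)) by exact: measurableX.
have mp : measurable_fun ((I `*` setT) `*` D)
    (fun q : (measurableTypeR R * Omega) * E => (q.1.1, (q.1.2, q.2))).
  apply: measurable_funTS; apply/measurable_fun_pairP; split.
    exact: measurableT_comp measurable_fst measurable_fst.
  apply/measurable_fun_pairP; split; last exact: measurable_snd.
  exact: measurableT_comp measurable_snd measurable_fst.
have m1 : measurable_fun ((I `*` setT) `*` D)
   (fun q : (measurableTypeR R * Omega) * E => (X q.1.1 q.1.2 q.2 ^+ 2)%:E).
  apply/measurable_EFinP; apply: measurable_funX.
  apply: (measurable_comp _ _ mX mp).
    by apply: measurableX => //; exact: measurableX.
  by move=> _ [[[s w] z] /= [[sT _] Dz] <-].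
apply: (@measurable_integral_section1 _ _ _ _ _ m _ _ _ mIT mD m1).
by move=> p _; rewrite lee_fin sqr_ge0.
Qed.

Lemma measurable_sq_norm_section X s : adapted X -> 0 <= s <= T ->
  measurable_fun setT (sq_norm X s).
Proof.
move=> aX sT.
have mp : measurable_fun setT (fun w : Omega => (s : measurableTypeR R, w)).
  exact: pair1_measurable.
apply: (measurable_comp _ _ (measurable_sq_norm aX) mp).
  exact: measurableX.
by move=> _ [w _ <-]; split => //=; rewrite in_itv.
Qed.

Lemma measurable_expected_sq_norm X : adapted X ->
  measurable_fun I (fun s => \int[P]_w sq_norm X s w)%E.
Proof.
move=> aX.
have mI : measurable I by exact: measurable_itv.
apply: (@measurable_integral_section1 _ _ _ _ _ P _ _
  (fun p : measurableTypeR R * Omega => sq_norm X p.1 p.2) mI measurableT).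
  exact: measurable_sq_norm.
by move=> p _; exact: sq_norm_ge0.
Qed.

Lemma L2_processE X : adapted X ->
  (\int[P]_w \int[leb]_(s in `[0%R, T]) sq_norm X s w < +oo)%E -> L2 X.
Proof.
move=> aX oo; split => //.
have mI : measurable I by exact: measurable_itv.
by rewrite (@tonelli_on _ _ _ _ _ leb P I setT
  (fun p : measurableTypeR R * Omega => sq_norm X p.1 p.2) mI measurableT
  (measurable_sq_norm aX))// => p _; exact: sq_norm_ge0.
Qed.

Lemma expected_sq_norm_le X Y (k s : R) : adapted X -> adapted Y ->
  0 <= s <= T -> 0 <= k ->
  {ae P, forall w, {ae m, forall z, D z -> `|X s w z| <= k * `|Y s w z|}} ->
  (\int[P]_w sq_norm X s w <= (k ^+ 2)%:E * \int[P]_w sq_norm Y s w)%E.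
Proof.
move=> aX aY sT k0 XYs.
have mYs := measurable_sq_norm_section aY sT.
rewrite -ge0_integralZl//; last 2 first.
- by move=> w _; exact: sq_norm_ge0.
- by rewrite lee_fin sqr_ge0.
apply: (ae_ge0_le_integral measurableT).
- by move=> w _; exact: sq_norm_ge0.
- exact: measurable_sq_norm_section.
- by move=> w _; rewrite mule_ge0 ?sq_norm_ge0// lee_fin sqr_ge0.
- exact: measurable_funeM.
move: XYs; apply: filterS => w XYw _.
have mXz := measurable_process_section w aX sT.
have mYz := measurable_process_section w aY sT.
have mY2 : measurable_fun D (fun z => (Y s w z ^+ 2)%:E).
  by apply/measurable_EFinP; exact: measurable_funX.
rewrite -ge0_integralZl//; last 2 first.
- by move=> z _; rewrite lee_fin sqr_ge0.
- by rewrite lee_fin sqr_ge0.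
apply: (ae_ge0_le_integral mD).
- by move=> z _; rewrite lee_fin sqr_ge0.
- by apply/measurable_EFinP; exact: measurable_funX.
- by move=> z _; rewrite -EFinM lee_fin mulr_ge0 ?sqr_ge0.
- exact: measurable_funeM.
move: XYw; apply: filterS => z + Dz => /(_ Dz) h.
rewrite -EFinM lee_fin -exprMn -[leLHS]real_normK ?num_real//.
rewrite -[leRHS]real_normK ?num_real// lerXn2r ?nnegrE//.
by rewrite normrM (ger0_norm k0).
Qed.

Lemma L2_process_le X Y (k : R) : adapted X -> L2 Y -> 0 <= k ->
  {ae leb, forall s, 0 <= s <= T -> {ae P, forall w, {ae m, forall z, D z ->
     `|X s w z| <= k * `|Y s w z|}}} -> L2 X.
Proof.
move=> aX [aY Yoo] k0 XY; split; first exact: aX.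
have mI : measurable I by exact: measurable_itv.
have IT s : I s -> 0 <= s <= T by rewrite /= in_itv.
apply: (@le_lt_trans _ _ ((k ^+ 2)%:E * \int[leb]_(s in `[0%R, T]) \int[P]_w sq_norm Y s w)%E); last first.
  by apply: lte_mul_pinfty => //; rewrite lee_fin sqr_ge0.
have kY0 s : (0 <= \int[P]_w sq_norm Y s w)%E by apply: integral_ge0 => w _; exact: sq_norm_ge0.
have mEY := measurable_expected_sq_norm aY.
rewrite -ge0_integralZl//; last by rewrite lee_fin sqr_ge0.
apply: (ae_ge0_le_integral mI).
- by move=> s _; apply: integral_ge0 => w _; exact: sq_norm_ge0.
- exact: measurable_expected_sq_norm.
- by move=> s _; rewrite mule_ge0// lee_fin sqr_ge0.
- exact: measurable_funeM.
move: XY; apply: (@filterS _ _ (ae_filter_ringOfSetsType leb)) => s XYs /IT sT.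
exact: expected_sq_norm_le (XYs sT).
Qed.

Lemma L2_processD X Y : L2 X -> L2 Y -> L2 (fun s w z => X s w z + Y s w z).
Proof.
move=> [aX Xoo] [aY Yoo]; have aXY := adapted_processD aX aY; split; first exact: aXY.
have mI : measurable I by exact: measurable_itv.
have IT s : I s -> 0 <= s <= T by rewrite /= in_itv.
have E0 Z s : (0 <= \int[P]_w sq_norm Z s w)%E.
  by apply: integral_ge0 => w _; exact: sq_norm_ge0.
have mEX := measurable_expected_sq_norm aX.
have mEY := measurable_expected_sq_norm aY.
have mEXY := measurable_expected_sq_norm aXY.
apply: (le_lt_trans (integral_le_2D leb mI mEXY mEX mEY (E0 _) (E0 X) (E0 Y) _)).
  move=> s /IT sT.
  have mXs := measurable_sq_norm_section aX sT.
  have mYs := measurable_sq_norm_section aY sT.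
  have mXYs := measurable_sq_norm_section aXY sT.
  apply: (integral_le_2D P measurableT mXYs mXs mYs).
  - by move=> w; exact: sq_norm_ge0.
  - by move=> w; exact: sq_norm_ge0.
  - by move=> w; exact: sq_norm_ge0.
  move=> w _; apply: integral_sqD_le; first exact: mD.
    exact: measurable_process_section aX sT.
  exact: measurable_process_section aY sT.
have two0 : (0 <= 2%:E :> \bar R)%E by rewrite lee_fin.
apply: lte_add_pinfty.
  by apply: (lte_mul_pinfty two0 isT); exact: Xoo.
by apply: (lte_mul_pinfty two0 isT); exact: Yoo.
Qed.

Lemma L2_mulLinfty (a Y : R -> Omega -> E -> R) :
  LinftyF P B T D m a -> L2 Y -> L2 (fun s w z => a s w z * Y s w z).
Proof.
move=> [aa [M aM]] LY; have [aY _] := LY.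
apply: (L2_process_le (k := `|M|) _ LY) => //; first exact: adapted_processM.
move: aM; apply: (@filterS _ _ (ae_filter_ringOfSetsType leb)) => s + sT => /(_ sT).
apply: filterS => w; apply: filterS => z + Dz => /(_ Dz) h.
by rewrite normrM ler_wpM2r// (le_trans h)// ler_norm.
Qed.

Lemma adapted_process_mul_space (g : E -> R) X :
  measurable_fun setT g -> adapted X -> adapted (fun s w z => X s w z * g z).
Proof.
move=> mg aX; apply: adapted_processM => //; apply: adapted_process_space => //.
exact: measurable_funTS.
Qed.

Lemma L2_mul_space (g : E -> R) (M : R) (Y : R -> Omega -> E -> R) :
  measurable_fun setT g -> (forall z, D z -> `|g z| <= M) -> L2 Y ->
  L2 (fun s w z => Y s w z * g z).
Proof.
move=> mg gM LY; have [aY _] := LY.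
apply: (L2_process_le (k := `|M|) _ LY) => //; first exact: adapted_process_mul_space.
apply: aeW => s sT; apply: aeW => w; apply: aeW => z Dz.
by rewrite normrM mulrC ler_wpM2r// (le_trans (gM z Dz))// ler_norm.
Qed.

End L2.
End adapted.

(** * The phase space *)

Section geometry.
Context (R : realType) (d : nat).
Local Notation V := 'rV[R]_d.

(** The sigma-algebra is generated by the coordinates, and an open set is a countable
    union of boxes with rational centres. *)
Lemma open_measurable_rV (G : set V) : open G -> measurable G.
Proof.
move=> oG.
pose box (p : 'rV[rat]_d * nat) : set V :=
  [set x | forall i, `|x ord0 i - ratr (p.1 ord0 i)| < p.2.+1%:R^-1].
pose S p := if `[< box p `<=` G >] then box p else set0.
have mbox p : measurable (box p).
  rewrite (_ : box p = \bigcap_(i in [set: 'I_d])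
      ((fun x : V => x ord0 i) @^-1` (ball (ratr (p.1 ord0 i) : R) p.2.+1%:R^-1))).
    apply: fin_bigcap_measurable => // i _.
    rewrite -[X in measurable X]setTI.
    by apply: (@measurable_coord_rV R d i) => //; exact: measurable_ball.
  apply/seteqP; split => x /= H i; rewrite /ball/= distrC; first by move=> _; exact: H.
  by have := H i Logic.I; rewrite /ball/= distrC.
have mS p : measurable (S p) by rewrite /S; case: ifP.
rewrite (_ : G = \bigcup_n (if unpickle n is Some p then S p else set0)).
  by apply: bigcupT_measurable => n; case: unpickle.
apply/seteqP; split => [x Gx|x [n _]]; last first.
  case: unpickle => // p; rewrite /S; case: ifPn => // /asboolP bG.
  exact: bG.
have /nbhs_ballP[e /= e0 eG] : nbhs x G by apply: open_nbhs_nbhs.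
pose k := Num.truncn (2 / e).
have ke : k.+1%:R^-1 < e / 2.
  rewrite -[e / 2]invrK ltf_pV2 ?posrE ?invr_gt0 ?divr_gt0//.
  by rewrite invf_div; exact: truncnS_gt.
have k0 : 0 < k.+1%:R^-1 :> R by rewrite invr_gt0.
have [dl dlE] : exists dl : R, k.+1%:R^-1 = dl by exists (k.+1%:R^-1).
rewrite dlE in ke k0.
have /choice[q qP] : forall i, exists q : rat, `|x ord0 i - ratr q| < dl.
  move=> i; have : x ord0 i - dl < x ord0 i + dl by lra.
  move=> /rat_in_itvoo[q]; rewrite in_itv/= => /andP[q1 q2]; exists q.
  by rewrite ltr_norml; apply/andP; split; lra.
pose p : 'rV[rat]_d * nat := (\row_i q i, k).
exists (pickle p) => //; rewrite pickleK /S.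
have bx : box p x by move=> i; rewrite mxE dlE.
suff bG : box p `<=` G by rewrite (asboolT bG).
move=> y ly; apply: eG; split => // i j.
rewrite (ord1 i); have := ly j; have := bx j; rewrite /ball/= dlE; move: (ratr _ : R) => z.
rewrite !ltr_norml => /andP[a1 a2] /andP[b1 b2]; apply/andP; split; lra.
Qed.

Lemma closed_measurable_rV (G : set V) : closed G -> measurable G.
Proof.
by move=> cG; rewrite -(setCK G); apply: measurableC; apply: open_measurable_rV; exact: closed_openC.
Qed.

Lemma measurable_sphere : measurable (@sphere R d).
Proof.
rewrite (_ : @sphere R d = @enorm R d @^-1` [set 1]).
  by rewrite -[X in measurable X]setTI; apply: measurable_enorm => //.
by apply/seteqP; split.
Qed.

Definition open_box n (a b : R) (c : 'rV[R]_n) : set 'rV[R]_n :=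
  [set x | forall i, a < x ord0 i - c ord0 i < b].

Lemma measurable_open_box n (a b : R) (c : 'rV[R]_n) : measurable (open_box a b c).
Proof.
rewrite (_ : open_box a b c = \bigcap_(i in [set: 'I_n])
    ((fun x : 'rV[R]_n => x ord0 i) @^-1` `]a + c ord0 i, b + c ord0 i[%classic)).
  apply: fin_bigcap_measurable => // i _.
  rewrite -[X in measurable X]setTI.
  exact: (@measurable_coord_rV R n i).
apply/seteqP; split => x /= H i.
  by move=> _; have := H i; rewrite /= in_itv/= => /andP[? ?]; apply/andP; split; lra.
by have := H i Logic.I; rewrite /= in_itv/= => /andP[? ?]; apply/andP; split; lra.
Qed.

Lemma lebesgue_rV_box n (a b : R) (c : 'rV[R]_n) : a < b ->
  lebesgue_rV (open_box a b c) = ((b - a) ^+ n)%:E.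
Proof.
move=> ab; elim: n c => [|n IH] c.
  by rewrite /= diracE mem_set// => -[].
pose c' : 'rV[R]_n := \row_j c ord0 (lift ord0 j).
rewrite /= /pushforward.
rewrite (_ : _ @^-1` _ = `]a + c ord0 ord0, b + c ord0 ord0[%classic `*` open_box a b c'); last first.
  apply/seteqP; split => [[r x] /= H|[r x] /= [Hr Hx] i].
    split => [|i].
      by have := H ord0; rewrite mxE unlift_none in_itv/= => /andP[? ?]; apply/andP; split; lra.
    by have := H (lift ord0 i); rewrite !mxE liftK.
  move: Hr; rewrite in_itv/= => /andP[? ?].
  rewrite mxE; case: (unliftP ord0 i) => [j ->|->] /=; last by apply/andP; split; lra.
  by have := Hx j; rewrite mxE.
rewrite [LHS](product_measure1E (@lebesgue_measure R) (@lebesgue_rV R n))//=; last first.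
  exact: measurable_open_box.
rewrite IH lebesgue_measure_itv/= lte_fin ltrD2r ab -EFinB -EFinM exprS.
by congr (_ * _)%:E; ring.
Qed.

Lemma dotrv_ge0 n (x : 'rV[R]_n) : 0 <= dotrv x x.
Proof. by apply: sumr_ge0 => i _; rewrite -expr2 sqr_ge0. Qed.

Lemma sqr_coord_le_dotrv n (x : 'rV[R]_n) i : x ord0 i ^+ 2 <= dotrv x x.
Proof.
rewrite /dotrv (bigD1 i)//= expr2 lerDl.
by apply: sumr_ge0 => j _; rewrite -expr2 sqr_ge0.
Qed.

Lemma dotrv_le_box n (x : 'rV[R]_n) r : (forall i, `|x ord0 i| <= r) ->
  dotrv x x <= n%:R * r ^+ 2.
Proof.
move=> xr; rewrite mulr_natl -[n in _ *+ n]card_ord -sumr_const.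
apply: ler_sum => i _; rewrite -expr2 -[leLHS]real_normK ?num_real//.
by rewrite lerXn2r ?nnegrE// (le_trans _ (xr i)).
Qed.

(** The surface measure of the sphere is [d] times the volume of the punctured unit
    ball, which contains the cube [`]0, 1/d[^d]. *)
Lemma sphere_measure_gt0 : (0 < d)%N -> (0 < @sphere_measure R d (@sphere R d))%E.
Proof.
move=> d0; rewrite /sphere_measure; apply: mule_gt0; first by rewrite lte_fin ltr0n.
have dR : 0 < d%:R :> R by rewrite ltr0n.
pose W : set V := open_box 0 d%:R^-1 0.
apply: (@lt_le_trans _ _ (lebesgue_rV W)).
  by rewrite lebesgue_rV_box ?lte_fin ?subr0 ?exprn_gt0 ?invr_gt0.
have enormZ (x : V) : 0 < enorm x -> sphere ((enorm x)^-1 *: x).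
  move=> x0; rewrite /sphere/= /enorm (_ : dotrv _ _ = (enorm x)^-2 * dotrv x x).
    rewrite /enorm sqr_sqrtr ?dotrv_ge0// mulVf ?sqrtr1//.
    by move: x0; rewrite /enorm sqrtr_gt0 => /gt_eqF ->.
  rewrite /dotrv mulr_sumr; apply: eq_bigr => i _; by rewrite !mxE -exprVn; ring.
have WE : W `<=` [set x | 0 < enorm x <= 1].
  move=> x Wx /=; rewrite /enorm sqrtr_gt0; apply/andP; split.
    apply: lt_le_trans (sqr_coord_le_dotrv x (Ordinal d0)).
    have := Wx (Ordinal d0); rewrite mxE subr0 => /andP[x0 _].
    by rewrite exprn_gt0.
  rewrite -[leRHS]sqrtr1 ler_sqrt//.
  apply: le_trans (dotrv_le_box (r := d%:R^-1) _) _.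
    by move=> i; have := Wx i; rewrite mxE subr0 => /andP[x0 /ltW xd]; rewrite ger0_norm// ltW.
  rewrite expr2 mulrA mulfV ?gt_eqF// mul1r invf_le1//.
  by rewrite ler1n.
apply: le_measure; rewrite ?inE.
- exact: measurable_open_box.
- rewrite (_ : [set _ | _] = @enorm R d @^-1` `]0, 1]%classic).
    by rewrite -[X in measurable X]setTI; exact: (@measurable_enorm R d).
  apply/seteqP; split => x /=; rewrite in_itv/=; first by case.
  by move=> x01; split => //; apply: enormZ; case/andP: x01.
- by move=> x Wx; have x01 := WE x Wx; split => //; apply: enormZ; case/andP: x01.
Qed.

Variable G : set V.
Hypotheses (G_open : open G) (G_bounded : bounded_set G).

Lemma measurable_GS : measurable (GS G).
Proof.
by apply: measurableX; [exact: open_measurable_rV|exact: measurable_sphere].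
Qed.

(** This is [mu_GS] again, with its sigma-finiteness. *)
Definition mu_GS_sigma_finite :
    {sigma_finite_measure set (V * V)%type -> \bar R} :=
  product_sigma_finite (@lebesgue_rV R d) (@sphere_measure R d).

Lemma sphere_measure_lty : (@sphere_measure R d (@sphere R d) < +oo)%E.
Proof.
rewrite -ge0_fin_numE; last exact: measure_ge0.
by apply: fin_num_measure; exact: measurable_sphere.
Qed.

Lemma mu_GS_lty : (mu_GS (GS G) < +oo)%E.
Proof.
have mG := open_measurable_rV G_open.
rewrite [ltLHS](product_measure1E (@lebesgue_rV R d) (@sphere_measure R d) mG measurable_sphere).
have [M M0 GM] := pinfty_ex_gt0 G_bounded.
have GW : G `<=` open_box (- (M + 1)) (M + 1) (0 : V).
  move=> x Gx i; rewrite mxE subr0 -ltr_norml.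
  have : `|x ord0 i| <= `|x|.
    rewrite [leRHS]/Num.norm/= mx_normrE; apply/bigmax_geP; right.
    by exists (ord0, i).
  have := GM x Gx => /= h1 h2; apply: le_lt_trans (le_trans h2 h1) _; lra.
apply: lte_mul_pinfty => //; last exact: sphere_measure_lty.
have mW := @measurable_open_box d (- (M + 1)) (M + 1) 0.
have leW : (lebesgue_rV G <= lebesgue_rV (open_box (- (M + 1)) (M + 1) (0 : V)))%E.
  by apply: le_measure; rewrite ?inE.
rewrite ge0_fin_numE; last exact: measure_ge0.
by apply: le_lt_trans leW _; rewrite lebesgue_rV_box ?ltry//; lra.
Qed.

End geometry.

(** * A test function supported inside the domain *)

Lemma derive_of_quadratic_remainder (R : realType) (V : normedModType R)
    (f : V -> R) (x v : V) (l C : R) :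
  (forall t, `|t| <= 1 -> `|f (t *: v + x) - f x - t * l| <= C * t ^+ 2) ->
  derivable f x v /\ 'D_v f x = l.
Proof.
move=> H.
suff L : (fun h => h^-1 *: ((f \o shift x) (h *: v) - f x)) @ 0^' --> l.
  by split; [apply/cvg_ex; exists l|exact: cvg_lim].
apply/cvgrPdist_le => e e0; near=> h.
have h0 : h != 0 by near: h; exact: nbhs_dnbhs_neq.
have h1 : `|h| <= 1.
  near: h; exact: dnbhs0_le.
have hC : `|h| * (`|C| + 1) <= e.
  rewrite -ler_pdivlMr; last by rewrite ltr_pwDr.
  near: h; apply: dnbhs0_le.
  by rewrite divr_gt0// ltr_pwDr.
rewrite /= distrC.
have -> : h^-1 *: (f (h *: v + x) - f x) - l = h^-1 * (f (h *: v + x) - f x - h * l).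
  by rewrite -[_ *: _]/(h^-1 * _) [RHS]mulrBr mulKf.
rewrite normrM normfV ler_pdivrMl ?normr_gt0//.
apply: (le_trans (H h h1)); apply: le_trans (ler_wpM2l (normr_ge0 h) hC).
rewrite -[h ^+ 2]real_normK ?num_real//.
have := ler_norm C; have := normr_ge0 h; move: `|h| `|C| => y z y0 Cz; nra.
Unshelve. all: by end_near. Qed.

Section bump.
Context (R : realType) (d : nat) (c : 'rV[R]_d) (r : R).
Local Notation V := 'rV[R]_d.

Definition bump_arg (x : V) : R := r - dotrv (x - c) (x - c).
(** The square of a positive part is of class [C^1]. The support of [bump] is the
    closed Euclidean ball of centre [c] and radius [sqrt r]. *)
Definition bump (x : V) : R := Num.max 0 (bump_arg x) ^+ 2.
Definition bump_deriv (x v : V) : R :=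
  2 * Num.max 0 (bump_arg x) * (- 2 * dotrv (x - c) v).

Lemma bump_arg_line x v t : bump_arg (t *: v + x) =
  bump_arg x + t * (- 2 * dotrv (x - c) v) - t ^+ 2 * dotrv v v.
Proof.
suff : dotrv (t *: v + x - c) (t *: v + x - c) =
    dotrv (x - c) (x - c) + 2 * t * dotrv (x - c) v + t ^+ 2 * dotrv v v.
  by rewrite /bump_arg => ->; ring.
rewrite /dotrv !mulr_sumr -!big_split/=; apply: eq_bigr => i _.
by rewrite !mxE; ring.
Qed.

(** The derivative [2 * Num.max 0 a] of the square of the positive part is
    nondecreasing and 2-Lipschitz. *)
Lemma sq_pos_part_remainder (a b : R) :
  0 <= Num.max 0 b ^+ 2 - Num.max 0 a ^+ 2 - 2 * Num.max 0 a * (b - a) <= (b - a) ^+ 2.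
Proof.
have a2 := sqr_ge0 a; have b2 := sqr_ge0 b; have ab2 := sqr_ge0 (b - a).
have E : (b - a) ^+ 2 = b ^+ 2 - 2 * (a * b) + a ^+ 2 by ring.
rewrite E in ab2 *.
have [a0|a0] := leP 0 a; have [b0|b0] := leP 0 b; rewrite ?expr0n/= ?mulr0 ?mul0r.
- rewrite (_ : _ - _ - _ = b ^+ 2 - 2 * (a * b) + a ^+ 2); last by ring.
  by rewrite ab2 lexx.
- have ab : a * b <= 0 by rewrite mulr_ge0_le0// ltW.
  rewrite (_ : _ - _ - _ = - 2 * (a * b) + a ^+ 2); last by ring.
  by apply/andP; split; lra.
- have ab : a * b <= 0 by rewrite mulr_le0_ge0// ltW.
  by apply/andP; split; lra.
- by rewrite !subr0 lexx.
Qed.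

Lemma bump_derive x v : derivable bump x v /\ 'D_v bump x = bump_deriv x v.
Proof.
pose be := - 2 * dotrv (x - c) v; pose ga := dotrv v v; pose m0 := Num.max 0 (bump_arg x).
have m00 : 0 <= m0 by rewrite le_max lexx.
have ga0 : 0 <= ga by exact: dotrv_ge0.
apply: (@derive_of_quadratic_remainder _ _ _ _ _ _ ((`|be| + ga) ^+ 2 + 2 * m0 * ga)) => t t1.
have := sq_pos_part_remainder (bump_arg x) (bump_arg (t *: v + x)).
rewrite bump_arg_line -/be -/ga /bump /bump_deriv -/m0 bump_arg_line -/be -/ga -/m0.
set M := Num.max 0 _; set a := bump_arg x => /andP[l0 l1].
have sq : (a + t * be - t ^+ 2 * ga - a) ^+ 2 <= (`|be| + ga) ^+ 2 * t ^+ 2.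
  have -> : a + t * be - t ^+ 2 * ga - a = t * (be - t * ga) by ring.
  rewrite exprMn mulrC; apply: ler_wpM2r; first exact: sqr_ge0.
  rewrite -[leLHS]real_normK ?num_real// lerXn2r ?nnegrE ?addr_ge0//.
  apply: le_trans (ler_normB _ _) _; rewrite lerD2l normrM (ger0_norm ga0).
  by rewrite ler_piMl.
have t20 := sqr_ge0 t.
have mg : 0 <= m0 * (t ^+ 2 * ga) by rewrite mulr_ge0// mulr_ge0.
have E1 : a + t * be - t ^+ 2 * ga - a = t * be - t ^+ 2 * ga by ring.
have E2 : 2 * m0 * (t * be - t ^+ 2 * ga) =
    t * (2 * m0 * be) - 2 * (m0 * (t ^+ 2 * ga)) by ring.
have E3 : ((`|be| + ga) ^+ 2 + 2 * m0 * ga) * t ^+ 2 =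
    (`|be| + ga) ^+ 2 * t ^+ 2 + 2 * (m0 * (t ^+ 2 * ga)) by ring.
rewrite E1 E2 in l0 l1; rewrite E1 in sq; rewrite E3 ler_norml.
move: l0 l1 sq mg; move: (t * (2 * m0 * be)) (m0 * _) (_ ^+ 2 * t ^+ 2) => x1 x2 x3.
move: (_ ^+ 2) (M ^+ 2) (m0 ^+ 2) => y1 y2 y3 h0 h1 h2 h3.
by apply/andP; split; lra.
Qed.

Lemma bump_arg_gt0_coord x i : 0 <= bump_arg x -> `|x ord0 i - c ord0 i| <= 1 + r.
Proof.
rewrite subr_ge0 => xr.
have := sqr_coord_le_dotrv (x - c) i; rewrite !mxE => h.
have := le_trans h xr; rewrite -real_normK ?num_real//.
move: `|_| (normr_ge0 (x ord0 i - c ord0 i)) => y y0; nra.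
Qed.

Lemma dotrv_delta (x : V) i : dotrv x (delta_mx ord0 i) = x ord0 i.
Proof.
rewrite /dotrv (bigD1 i)//= mxE !eqxx mulr1 big1 ?addr0// => j ji.
by rewrite mxE (negbTE ji) andbF mulr0.
Qed.

Lemma measurable_bump_arg : measurable_fun setT bump_arg.
Proof.
apply: measurable_funB => //; apply: measurable_sum => i.
have E : (fun x : V => (x - c) ord0 i) = fun x => x ord0 i - c ord0 i.
  by apply/funext => x; rewrite !mxE.
by apply: measurable_funM; rewrite E; apply: measurable_funB => //; exact: measurable_coord_rV.
Qed.

Lemma measurable_bump : measurable_fun setT bump.
Proof.
apply: measurable_funX; apply: measurable_maxr => //; exact: measurable_bump_arg.
Qed.

Lemma measurable_bump_deriv v : measurable_fun setT (bump_deriv ^~ v).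
Proof.
apply: measurable_funM.
  apply: measurable_funM => //; apply: measurable_maxr => //.
  exact: measurable_bump_arg.
apply: measurable_funM => //; apply: measurable_sum => i.
apply: measurable_funM => //.
have E : (fun x : V => (x - c) ord0 i) = fun x => x ord0 i - c ord0 i.
  by apply/funext => x; rewrite !mxE.
by rewrite E; apply: measurable_funB => //; exact: measurable_coord_rV.
Qed.

Hypothesis r0 : 0 < r.

Lemma max_bump_arg_le x : Num.max 0 (bump_arg x) <= r.
Proof. by rewrite ge_max (ltW r0) /bump_arg gerBl dotrv_ge0. Qed.

Lemma bump_le x : `|bump x| <= r ^+ 2.
Proof.
rewrite ger0_norm ?sqr_ge0// lerXn2r ?nnegrE ?le_max ?lexx ?(ltW r0)//.
exact: max_bump_arg_le.
Qed.

Lemma bump_deriv_delta_le x i :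
  `|bump_deriv x (delta_mx ord0 i)| <= 4 * r * (1 + r).
Proof.
rewrite /bump_deriv dotrv_delta !mxE.
have := max_bump_arg_le x; have [x0|x0] := leP 0 (bump_arg x) => mr; last first.
  by rewrite mulr0 mul0r normr0 !mulr_ge0// ?addr_ge0// ltW.
have := bump_arg_gt0_coord i x0; move: (x ord0 i - c ord0 i) => y yr.
rewrite (_ : 2 * _ * _ = - 4 * (bump_arg x * y)); last by ring.
rewrite normrM normrN normr_nat normrM (ger0_norm x0) -!mulrA.
by rewrite ler_pM2l// ler_pM// normr_ge0.
Qed.

Definition bump_test (z : V * V) : R := bump z.1.

Lemma continuous_coordB i : continuous (fun x : V => (x - c) ord0 i).
Proof.
have -> : (fun x : V => (x - c) ord0 i) = (fun x => x ord0 i - c ord0 i).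
  by apply/funext => y; rewrite !mxE.
move=> x; apply: (@continuousB _ _ _ (fun x : V => x ord0 i) (fun=> c ord0 i) x).
  exact: coord_continuous.
exact: cst_continuous.
Qed.

Lemma continuous_bump_deriv v : continuous (bump_deriv ^~ v).
Proof.
have cdot (w : V -> V) : (forall i, continuous (fun x : V => w x ord0 i)) ->
    continuous (fun x : V => dotrv (x - c) (w x)).
  move=> cw; rewrite /dotrv; apply: continuous_big => [|i _ x].
    exact: add_continuous.
  apply: (@continuousM _ _ (fun x : V => (x - c) ord0 i) (fun x => w x ord0 i) x).
    exact: continuous_coordB.
  exact: cw.
have carg : continuous bump_arg.
  move=> x.
  apply: (@continuousB _ _ _ (fun=> r) (fun x : V => dotrv (x - c) (x - c)) x).
    exact: cst_continuous.
  by apply: (cdot (fun x : V => x - c)) => i; exact: continuous_coordB.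
move=> x.
apply: (@continuousM _ _ (fun x : V => 2 * Num.max 0 (bump_arg x))
  (fun x : V => - 2 * dotrv (x - c) v) x).
  apply: (@continuousM _ _ (fun=> 2) (fun x : V => Num.max 0 (bump_arg x)) x).
    exact: cst_continuous.
  apply: (@continuous_max _ _ (fun=> 0) bump_arg); last exact: carg.
  exact: cst_continuous.
apply: (@continuousM _ _ (fun=> - 2) (fun x : V => dotrv (x - c) v) x).
  exact: cst_continuous.
by apply: (cdot (fun=> v)) => i; exact: cst_continuous.
Qed.

Lemma derive_bump_test (z v : V * V) :
  derivable bump_test z v /\ 'D_v bump_test z = bump_deriv z.1 v.1.
Proof. exact: bump_derive. Qed.

Lemma transport_bump_test z : transport bump_test z =
  \sum_i z.2 ord0 i * bump_deriv z.1 (delta_mx ord0 i).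
Proof.
rewrite /transport /dotrv; apply: eq_bigr => i _; rewrite mxE; congr (_ * _).
by case: (bump_derive z.1 (delta_mx ord0 i)).
Qed.

Lemma measurable_transport_bump_test : measurable_fun setT (transport bump_test).
Proof.
rewrite (_ : transport bump_test = fun z => \sum_i z.2 ord0 i * bump_deriv z.1 (delta_mx ord0 i)).
  apply: measurable_sum => i; apply: measurable_funM.
    exact: (measurableT_comp (@measurable_coord_rV R d i) measurable_snd).
  exact: (measurableT_comp (measurable_bump_deriv _) measurable_fst).
by apply/funext => z; exact: transport_bump_test.
Qed.

Lemma transport_bump_test_le z : sphere z.2 ->
  `|transport bump_test z| <= d%:R * (4 * r * (1 + r)).
Proof.
move=> z1; rewrite transport_bump_test mulr_natl -[d in _ *+ d]card_ord -sumr_const.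
apply: le_trans (ler_norm_sum _ _ _) _; apply: ler_sum => i _.
rewrite normrM -[leRHS]mul1r; apply: ler_pM => //; last exact: bump_deriv_delta_le.
have := sqr_coord_le_dotrv z.2 i; rewrite -[dotrv _ _]sqr_sqrtr ?dotrv_ge0//.
move: z1; rewrite /sphere/= /enorm => ->; rewrite expr1n -real_normK ?num_real//.
by rewrite expr_le1.
Qed.

Variable G : set V.
Hypotheses (G_open : open G)
  (ballG : forall x, dotrv (x - c) (x - c) < r -> G x).

Lemma bump_eq0 x : ~ G x -> bump x = 0.
Proof.
move=> nG; rewrite /bump max_l ?expr0n// subr_le0 leNgt; apply/negP => xr.
exact/nG/ballG.
Qed.

Lemma bump_test_boundary z : boundary G z.1 -> bump_test z = 0.
Proof.
by move=> [_ nG]; apply: bump_eq0 => Gz; apply: nG; exact: open_nbhs_nbhs.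
Qed.

Lemma test_function_bump_test : test_function G bump_test.
Proof.
split=> [z _ v|z [[zb _] _]]; last exact: bump_test_boundary.
have [dz _] := derive_bump_test z v; split => //.
rewrite (_ : (fun z => 'D_v bump_test z) = (fun x => bump_deriv x v.1) \o fst).
  by apply: continuous_comp; [exact: cvg_fst|exact: continuous_bump_deriv].
by apply/funext => z'; have [_] := derive_bump_test z' v.
Qed.

Lemma bump_test_sq_integral_gt0 : (0 < d)%N ->
  (0 < \int[@mu_GS R d]_(z in GS G) (bump_test z * bump_test z)%:E)%E.
Proof.
move=> d0.
have dR : 0 < d%:R :> R by rewrite ltr0n.
(* On the cube of centre c and half-side rho, |x - c|^2 is at most d rho^2, hence
   at most d rho <= r / 2. *)
pose rho := Num.min 1 (r / (2 * d%:R)).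
have rho0 : 0 < rho by rewrite lt_min ltr01 divr_gt0// mulr_gt0.
pose W := open_box (- rho) rho c.
have WG x : W x -> dotrv (x - c) (x - c) <= r / 2.
  move=> Wx; apply: le_trans (dotrv_le_box (r := rho) _) _.
    by move=> i; rewrite !mxE; have := Wx i; rewrite -ltr_norml => /ltW.
  have r1 : rho <= 1 by rewrite ge_min lexx.
  have r2 : rho <= r / (2 * d%:R) by rewrite ge_min lexx orbT.
  apply: (@le_trans _ _ (d%:R * (r / (2 * d%:R)))).
    rewrite ler_pM2l// expr2; apply: le_trans r2.
    by rewrite ler_piMr// ltW.
  by rewrite le_eqVlt; apply/orP; left; apply/eqP; field; rewrite gt_eqF.
pose WS : set (V * V) := W `*` @sphere R d.
have mW : measurable W by exact: measurable_open_box.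
have mWS : measurable WS by apply: measurableX => //; exact: measurable_sphere.
have WSG : WS `<=` GS G.
  by move=> z [Wz sz]; split => //; apply: ballG; apply: le_lt_trans (WG _ Wz) _; rewrite ltr_pdivrMr// ltr_pMr// ltr1n.
have mb : measurable_fun setT bump_test.
  exact: (measurableT_comp measurable_bump measurable_fst).
have mbb D : measurable_fun D (fun z => (bump_test z * bump_test z)%:E).
  by apply: measurable_funTS; apply/measurable_EFinP; exact: measurable_funM.
pose k := ((r / 2) ^+ 2) ^+ 2.
have k0 : 0 < k by rewrite !exprn_gt0// divr_gt0.
apply: (@lt_le_trans _ _ (\int[@mu_GS R d]_(z in WS) k%:E)%E).
  rewrite integral_cst//; apply: mule_gt0; first by rewrite lte_fin.
  rewrite [ltRHS](product_measure1E (@lebesgue_rV R d) (@sphere_measure R d) mW (@measurable_sphere R d)).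
  apply: mule_gt0; last exact: sphere_measure_gt0.
  have rr : - rho < rho by rewrite -subr_gt0 opprK addr_gt0.
  have W0 : (0 < lebesgue_rV W)%E by rewrite lebesgue_rV_box// lte_fin exprn_gt0// subr_gt0.
  exact: W0.
apply: (@le_trans _ _ (\int[@mu_GS R d]_(z in WS) (bump_test z * bump_test z)%:E)%E).
  apply: ge0_le_integral => //.
  - by move=> z _; rewrite lee_fin ltW.
  - move=> z [Wz _]; rewrite lee_fin -expr2 /k lerXn2r ?nnegrE ?sqr_ge0//.
    rewrite /bump_test /bump lerXn2r ?nnegrE ?le_max ?lexx//; first by rewrite divr_ge0// ltW.
    apply/orP; right; rewrite /bump_arg (_ : r / 2 = r - r / 2); last by field.
    by rewrite lerB// WG.
apply: ge0_subset_integral => //; first exact: measurable_GS.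
by move=> z _; rewrite lee_fin -expr2 sqr_ge0.
Qed.

End bump.

Lemma open_euclidean_ball (R : realType) (d : nat) (G : set 'rV[R]_d) : open G -> G !=set0 ->
  exists c r, 0 < r /\ forall x, dotrv (x - c) (x - c) < r -> G x.
Proof.
move=> oG [c Gc].
have /nbhs_ballP[e /= e0 eG] : nbhs c G by apply: open_nbhs_nbhs.
exists c, (e ^+ 2); split; first by rewrite exprn_gt0.
move=> x xe; apply: eG; split => // i j; rewrite (ord1 i) /ball/= distrC.
have := le_lt_trans (sqr_coord_le_dotrv (x - c) j) xe.
rewrite !mxE -(real_normK (num_real (x ord0 j - c ord0 j))).
by rewrite ltr_pXn2r ?nnegrE ?(ltW e0).
Qed.

(** * A random series that correlates with late increments *)

Section sign_series.
Context (R : realType) (dO : measure_display) (Omega : measurableType dO).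
Context (P : probability Omega R) (B : R -> Omega -> R).
Hypotheses (P_complete : measure_is_complete P) (B_bm : brownian_motion P B).
Local Notation F := (filtration P B).
Variable T : R.
Hypothesis T0 : 0 < T.

Let bounded_integrable1 (X : Omega -> R) M : measurable_fun setT X ->
  (forall w, `|X w| <= M) -> P.-integrable setT (EFin \o X).
Proof.
move=> mX XM; apply: (bounded_integrable measurableT _ mX) => [|w _]; last exact: XM.
by apply: (le_lt_trans (probability_le1 P measurableT)); rewrite ltry.
Qed.

(** The ratio 16 makes [Num.sqrt (T - grid_time n)] of order [4^-n], which is smaller
    than the weights [3^-n] of the series below. *)
Definition grid_time (n : nat) : R := T * (1 - 16^-1 ^+ n).

Lemma grid_time_lt n : 0 <= grid_time n < grid_time n.+1 /\ grid_time n < T.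
Proof.
have q0 k : 0 < 16^-1 ^+ k :> R by rewrite exprn_gt0.
have q1 k : 16^-1 ^+ k <= 1 :> R by rewrite exprn_ile1//; lra.
rewrite /grid_time; split.
  rewrite mulr_ge0 ?(ltW T0) ?subr_ge0//= ltr_pM2l// exprS; have := q0 n; lra.
by rewrite -[ltRHS]mulr1 ltr_pM2l//; have := q0 n; lra.
Qed.

Lemma sqrt_grid_time n : Num.sqrt (T - grid_time n) = Num.sqrt T * 4^-1 ^+ n.
Proof.
rewrite (_ : T - grid_time n = T * (4^-1 ^+ n) ^+ 2).
  by rewrite sqrtrM ?(ltW T0)// sqrtr_sqr ger0_norm// exprn_ge0.
rewrite /grid_time -exprM mulnC exprM (_ : 4^-1 ^+ 2 = 16^-1); last by field.
by ring.
Qed.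

Definition sgn_incr n w := incr_sg B (grid_time n) (grid_time n.+1) w.
Definition sign_sum n w : R := \sum_(0 <= k < n) 3^-1 ^+ k * sgn_incr k w.
Definition sign_series w : R := limn (sign_sum ^~ w).

Lemma sign_sum_dist m n w : (n <= m)%N ->
  `|sign_sum m w - sign_sum n w| <= 3 / 2 * (3^-1 ^+ n - 3^-1 ^+ m).
Proof.
elim: m => [|m IH].
  by rewrite leqn0 => /eqP ->; rewrite !subrr normr0 mulr0.
rewrite leq_eqVlt => /orP[/eqP <-|/IH {}IH].
  by rewrite !subrr normr0 mulr0.
rewrite /sign_sum big_nat_recr//= -/(sign_sum m w) addrAC.
apply: le_trans (ler_normD _ _) _; rewrite normrM.
have h := incr_sg_le1 B (grid_time m) (grid_time m.+1) w.
have q0 : 0 <= 3^-1 ^+ m :> R by rewrite exprn_ge0.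
have := ler_wpM2l q0 h; rewrite mulr1 (ger0_norm q0) exprS -/(sign_sum n w).
rewrite /sgn_incr; move: `|incr_sg _ _ _ _| `|_ - _| IH => x y; move: (3^-1 ^+ m) q0 => a.
lra.
Qed.

Lemma sign_sum_cvg w : sign_sum ^~ w @ \oo --> sign_series w.
Proof.
suff : cvgn (sign_sum ^~ w) by [].
apply: (@normed_cvg R R^o).
apply: (@series_le_cvg _ _ (geometric 1 3^-1)) => [n|n|n|].
- exact: normr_ge0.
- by rewrite /= mulr_ge0// exprn_ge0.
- rewrite /= mul1r normrM -[leRHS]mulr1; apply: ler_pM => //.
    by rewrite ger0_norm// exprn_ge0.
  exact: incr_sg_le1.
- by apply: is_cvg_geometric_series; rewrite ger0_norm; lra.
Qed.

Lemma sign_series_dist n w : `|sign_series w - sign_sum n w| <= 3 / 2 * 3^-1 ^+ n.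
Proof.
have c : `|sign_sum m w - sign_sum n w| @[m --> \oo] --> `|sign_series w - sign_sum n w|.
  by apply: cvg_norm; apply: cvgB; [exact: sign_sum_cvg|exact: cvg_cst].
apply: (cvgr_to_le c); exists n => // m /= nm; apply: le_trans (sign_sum_dist w nm) _.
by rewrite ler_pM2l// gerBl exprn_ge0.
Qed.

Lemma sign_sum_adapted n : measurable_fun [set: F (grid_time n)] (sign_sum n).
Proof.
elim: n => [|n IH].
  by rewrite (_ : sign_sum 0 = cst 0)//; apply/funext => w; rewrite /sign_sum big_geq.
have [/andP[t0 tn] _] := grid_time_lt n.
rewrite (_ : sign_sum n.+1 = fun w => sign_sum n w + 3^-1 ^+ n * sgn_incr n w); last first.
  by apply/funext => w; rewrite /sign_sum big_nat_recr.
apply: measurable_funD; first exact: (measurable_fun_filtration_le (ltW tn)).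
apply: measurable_funM => //; apply: (measurableT_comp (@measurable_sg R)).
by apply: measurable_funB; apply: measurable_brownian_filtration; rewrite ?t0 ?lexx ?(ltW tn)//= (le_trans t0 (ltW tn)).
Qed.

Lemma sign_series_adapted : measurable_fun [set: F T] sign_series.
Proof.
apply: (@measurable_fun_cvg _ (F T) R setT sign_sum sign_series) => [n|w _]; last exact: sign_sum_cvg.
have [_ tT] := grid_time_lt n.
exact: (measurable_fun_filtration_le (ltW tT) (@sign_sum_adapted n)).
Qed.

Lemma sign_series_le w : `|sign_series w| <= 3 / 2.
Proof. by have := sign_series_dist 0 w; rewrite /sign_sum big_geq// subr0 expr0 mulr1. Qed.

(** The terms of the series before the [n]-th are known at time [grid_time n], so
    they are orthogonal to [sgn_incr n]; the [n]-th term contributes [3^-n], and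
    the later ones at most the sum of their weights, which is [3^-n / 2]. *)
Lemma sign_series_correlation n :
  ((3^-1 ^+ n / 2)%:E <= \int[P]_w (sgn_incr n w * sign_series w)%:E)%E.
Proof.
have [/andP[t0 tn] tT] := grid_time_lt n.
have mS k : measurable_fun setT (sign_sum k).
  exact: (measurable_fun_filtration P_complete B_bm (@sign_sum_adapted k)).
have mX : measurable_fun setT sign_series.
  exact: (measurable_fun_filtration P_complete B_bm sign_series_adapted).
have me : measurable_fun setT (sgn_incr n) := measurable_incr_sg B_bm t0 tn.
have e1 := incr_sg_le1 B (grid_time n) (grid_time n.+1).
pose r w := sign_series w - sign_sum n.+1 w.
have mr : measurable_fun setT r by exact: measurable_funB.
have Si : P.-integrable setT (EFin \o sign_sum n).
  apply: (@bounded_integrable1 _ (3 / 2)) => // w.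
  have := sign_sum_dist w (leq0n n); rewrite /sign_sum [X in _ - X]big_geq// subr0 expr0.
  by move/le_trans; apply; rewrite ler_piMr//; have : 0 <= 3^-1 ^+ n :> R by rewrite exprn_ge0.
have i1 := integrable_incr_sgM B_bm t0 tn Si.
have i2 : P.-integrable setT (fun w => (sgn_incr n w ^+ 2)%:E).
  apply: (@bounded_integrable1 _ 1); first exact: measurable_funX.
  by move=> w; rewrite normrX; apply: exprn_ile1 => //; exact: e1.
have ri w : `|r w| <= 3^-1 ^+ n / 2.
  apply: le_trans (sign_series_dist n.+1 w) _; rewrite exprS.
  have : 0 <= 3^-1 ^+ n :> R by rewrite exprn_ge0.
  lra.
have i3 : P.-integrable setT (fun w => (sgn_incr n w * r w)%:E).
  by apply: integrable_incr_sgM => //; exact: bounded_integrable1 ri.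
have -> : (\int[P]_w (sgn_incr n w * sign_series w)%:E =
  \int[P]_w ((sgn_incr n w * sign_sum n w)%:E + ((3^-1 ^+ n)%:E * (sgn_incr n w ^+ 2)%:E
     + (sgn_incr n w * r w)%:E)))%E.
  apply: eq_integral => w _; rewrite -EFinM -!EFinD; congr EFin.
  by rewrite /r /sign_sum [in RHS]big_nat_recr//=; ring.
have i2' : P.-integrable setT (fun w => (3^-1 ^+ n)%:E * (sgn_incr n w ^+ 2)%:E)%E.
  exact: integrableZl.
rewrite integralD//; last exact: integrableD.
rewrite (integral_incr_sg_past P_complete B_bm t0 tn (@sign_sum_adapted n) Si) add0e.
rewrite integralD// integralZl// (integral_increment_sg_sq B_bm t0 tn) mule1.
have : (`|\int[P]_w (sgn_incr n w * r w)%:E| <= (3^-1 ^+ n / 2)%:E)%E.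
  apply: le_trans (le_abse_integral _ measurableT (measurable_int _ i3)) _.
  apply: (@le_trans _ _ (\int[P]_w (cst (3^-1 ^+ n / 2)%:E w)))%E.
    apply: ge0_le_integral => //.
    - by apply: measurableT_comp => //; exact: measurable_int i3.
    - move=> w _; rewrite abse_EFin lee_fin normrM; apply: le_trans (ri w).
      by rewrite ler_piMl//; exact: e1.
  rewrite integral_cst// -[leRHS]mule1; apply: lee_wpmul2l; last exact: probability_le1.
  by rewrite lee_fin divr_ge0// exprn_ge0.
have fi : (\int[P]_w (sgn_incr n w * r w)%:E)%E \is a fin_num := integrable_fin_num measurableT i3.
rewrite -(fineK fi) -EFinD abse_EFin !lee_fin ler_norml => /andP[l _].
move: l; move: (3^-1 ^+ n) => a; lra.
Qed.

(** Otherwise [c / 2 * (4 / 3) ^+ n] would be bounded in [n]. *)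
Lemma sign_series_not_decay (c : R) (K : Omega -> R) : 0 < c ->
  {ae P, forall w, c * sign_series w = K w} -> ~ correlation_decay P B T K.
Proof.
move=> c0 KE [Ki [C leC]].
have mX : measurable_fun setT sign_series.
  exact: (measurable_fun_filtration P_complete B_bm sign_series_adapted).
have Xi : P.-integrable setT (EFin \o sign_series) by exact: bounded_integrable1 sign_series_le.
have bound n : c / 2 * (4 / 3) ^+ n <= C * Num.sqrt T.
  have [/andP[t0 tn] tT] := grid_time_lt n.
  have tT' : 0 <= grid_time n < T by rewrite t0.
  have := leC _ _ tT' tn; rewrite sqrt_grid_time.
  have -> : (\int[P]_w (incr_sg B (grid_time n) (grid_time n.+1) w * K w)%:E =
      c%:E * \int[P]_w (sgn_incr n w * sign_series w)%:E)%E.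
    have iX := integrable_incr_sgM B_bm t0 tn Xi.
    have iK := integrable_incr_sgM B_bm t0 tn Ki.
    rewrite -integralZl//; apply: ae_eq_integral => //.
    - exact: measurable_int iK.
    - by apply: measurable_funeM; exact: measurable_int iX.
    - by apply: filterS KE => w <- _; rewrite -EFinM /sgn_incr mulrCA.
  move=> h; have := lee_wpmul2l _ (sign_series_correlation n).
  move=> /(_ c%:E); rewrite lee_fin => /(_ (ltW c0)).
  move=> /le_trans /(_ (lee_abs _)) /le_trans /(_ h).
  rewrite -EFinM lee_fin => {}h.
  rewrite -(ler_pM2r (_ : 0 < 4^-1 ^+ n)) ?exprn_gt0// -!mulrA -exprMn.
  by rewrite (_ : 4 / 3 * 4^-1 = 3^-1 :> R)//; [rewrite (mulrC 2^-1)|field].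
have bern n : 1 + n%:R / 3 <= (4 / 3) ^+ n :> R.
  elim: n => [|n IH]; first by rewrite mul0r addr0.
  rewrite exprS -natr1; have : 0 <= n%:R :> R by []; nra.
pose M := C * Num.sqrt T.
have [n nM] : exists n, 6 * `|M| / c < n%:R.
  by exists (Num.bound (6 * `|M| / c)); apply: archi_boundP; rewrite divr_ge0 ?(ltW c0)// mulr_ge0.
have := bound n; apply/negP; rewrite -ltNge -/M.
apply: (@lt_le_trans _ _ (c / 2 * (1 + n%:R / 3))); last by rewrite ler_pM2l// divr_gt0.
move: nM; rewrite ltr_pdivrMr// => nM.
have := ler_norm M; lra.
Qed.

End sign_series.

(** * The terms of the transport equation *)

Section equation.
Context (R : realType) (d : nat) (G : set 'rV[R]_d).
Hypotheses (G_open : open G) (G_bounded : bounded_set G).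
Context (dO : measure_display) (Omega : measurableType dO).
Context (P : probability Omega R) (B : R -> Omega -> R).
Hypotheses (P_complete : measure_is_complete P) (B_bm : brownian_motion P B).
Variable T : R.
Hypothesis T0 : 0 < T.
Local Notation V := 'rV[R]_d.
Local Notation X := (V * V)%type.
Local Notation leb := (@lebesgue_measure R).
Local Notation D := (GS G).
Local Notation m := (@mu_GS_sigma_finite R d).
Local Notation adapted := (adapted_process P B T).
Local Notation L2 := (L2_process P B T m D).

Let mD : measurable D. Proof. exact: measurable_GS. Qed.
Let mDoo : (m D < +oo)%E. Proof. exact: (mu_GS_lty G_open G_bounded). Qed.

(** This uniformity in time gives the diffusion term an energy of order [T - t]
    after the time [t]; a general process in [L2_process] has no such bound. *)
Lemma L2FC_sup_expected (y : R -> Omega -> X -> R) : L2FC P B T D (sqnorm_GS G) y ->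
  exists2 K, 0 <= K & forall s, 0 <= s <= T -> (\int[P]_w sq_norm m D y s w <= K%:E)%E.
Proof.
move=> [ay _ yoo].
pose S w := ereal_sup [set sqnorm_GS G (y t w) | t in `[0%R, T]].
have yS s w : 0 <= s <= T -> (sq_norm m D y s w <= S w)%E.
  by move=> sT; apply: ereal_sup_ubound; exists s => //=; rewrite in_itv.
have S0 w : (0 <= S w)%E.
  by apply: le_trans (yS 0 w _); [exact: sq_norm_ge0|rewrite lexx ltW].
have SI0 : (0 <= \int[P]_w S w)%E by apply: integral_ge0.
exists (fine (\int[P]_w S w)%E); first by rewrite fine_ge0.
move=> s sT; rewrite fineK ?ge0_fin_numE//.
by apply: le_integral_ge0 => w; [exact: sq_norm_ge0|exact: yS].
Qed.

Lemma L2FC_L2 (y : R -> Omega -> X -> R) : L2FC P B T D (sqnorm_GS G) y -> L2 y.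
Proof.
move=> yFC; have [K K0 yK] := L2FC_sup_expected yFC.
have [ay _ _] := yFC; split; first exact: ay.
apply: (@le_lt_trans _ _ (\int[leb]_(s in `[0%R, T]) cst K%:E s)%E).
  apply: ge0_le_integral.
  - exact: measurable_itv.
  - by move=> s _; apply: integral_ge0 => w _; exact: sq_norm_ge0.
  - exact: (measurable_expected_sq_norm m mD ay).
  - exact: measurable_cst.
  - by move=> s; rewrite /= in_itv/= => /yK.
have l0 : (leb `[0%R, T]%classic < +oo)%E.
  by rewrite lebesgue_measure_itv/=; case: ifP => _; rewrite -?EFinB ltry.
rewrite integral_cst; last exact: measurable_itv.
by apply: lte_mul_pinfty => //; exact: l0.
Qed.

Lemma L2F_L2 (f : R -> Omega -> X -> R) : L2F P B T D (sqnorm_GS G) f -> L2 f.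
Proof. by move=> [af foo]; apply: L2_processE. Qed.

End equation.

Section terms.
Context (R : realType) (d : nat) (G : set 'rV[R]_d).
Hypotheses (G_open : open G) (G_bounded : bounded_set G).
Context (dO : measure_display) (Omega : measurableType dO).
Context (P : probability Omega R) (B : R -> Omega -> R).
Hypotheses (P_complete : measure_is_complete P) (B_bm : brownian_motion P B).
Variable T : R.
Hypothesis T0 : 0 < T.
Local Notation V := 'rV[R]_d.
Local Notation X := (V * V)%type.
Local Notation leb := (@lebesgue_measure R).
Local Notation D := (GS G).
Local Notation m := (@mu_GS_sigma_finite R d).
Local Notation sigma := (@sphere_measure R d).
Local Notation S := (@sphere R d).
Variables (g : X -> R) (Mg : R).
Hypotheses (mg : measurable_fun setT g) (gM : forall z, D z -> `|g z| <= Mg).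

Let mD : measurable D. Proof. exact: measurable_GS. Qed.
Let mS : measurable S. Proof. exact: measurable_sphere. Qed.
Let mDoo : (m D < +oo)%E. Proof. exact: (mu_GS_lty G_open G_bounded). Qed.

Let m2 : {sigma_finite_measure set (X * V)%type -> \bar R} :=
  product_sigma_finite m sigma.
Let D2 : set (X * V) := D `*` S.
Let mD2 : measurable D2. Proof. exact: measurableX. Qed.
Let m2D2oo : (m2 D2 < +oo)%E.
Proof.
rewrite [ltLHS](product_measure1E m sigma mD mS).
apply: lte_mul_pinfty => //; last exact: sphere_measure_lty.
by rewrite ge0_fin_numE//; exact: measure_ge0.
Qed.

(** In the scattering term the state is evaluated at [(x, V)] for a triple
    [(x, U, V)], and integration over the idle direction [U] produces the factor
    [sigma S]. *)
Lemma sq_norm_outgoing (y : R -> Omega -> X -> R) s w :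
  measurable_fun D (y s w) ->
  sq_norm m2 D2 (fun s w p => y s w (p.1.1, p.2)) s w =
  (sigma S * sq_norm m D y s w)%E.
Proof.
move=> my; rewrite /sq_norm.
have mG : measurable G by exact: open_measurable_rV.
have my2 : measurable_fun D (fun z => (y s w z ^+ 2)%:E).
  by apply/measurable_EFinP; exact: measurable_funX.
have my2' : measurable_fun D2 (fun p => (y s w (p.1.1, p.2) ^+ 2)%:E).
  have mp : measurable_fun D2 (fun p : X * V => (p.1.1, p.2)).
    apply: measurable_funTS; apply/measurable_fun_pairP; split; last exact: measurable_snd.
    exact: measurableT_comp measurable_fst measurable_fst.
  by apply: (measurable_comp _ _ my2 mp) => // _ [[[x u] v] /= [[/= Gx _] Sv] <-].
have ge0 (z : X) : (0 <= (y s w z ^+ 2)%:E)%E by rewrite lee_fin sqr_ge0.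
rewrite [LHS](tonelli_prod_on m sigma mD mS my2'); last by move=> p _; exact: ge0.
pose h (x : V) := (\int[sigma]_(v in S) (y s w (x, v) ^+ 2)%:E)%E.
have mh : measurable_fun G h by exact: (@measurable_integral_section1 _ _ _ _ _ sigma _ _ _ mG mS my2).
have mh' : measurable_fun D (fun z => h z.1).
  apply: (measurable_comp _ _ mh) => //; last by apply: measurable_funTS; exact: measurable_fst.
  by move=> _ [[x u] /= [Gx _] <-].
have h0 x : (0 <= h x)%E by apply: integral_ge0 => v _; exact: ge0.
have := tonelli_prod_on (@lebesgue_rV R d) sigma mG mS mh'.
move=> -> //; rewrite [in RHS](tonelli_prod_on (@lebesgue_rV R d) sigma mG mS my2)//.
transitivity (\int[@lebesgue_rV R d]_(x in G) (h x * sigma S))%E.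
  by apply: eq_integral => x _; exact: (integral_cst sigma mS (h x)).
by rewrite ge0_integralZr// muleC.
Qed.

(** The inner integral over the directions [V] is merged with the integral over
    [(x, U)]: the scattering term is a drift term on the space of triples
    [(x, U, V)]. *)
Lemma integral_incr_sg_scattering_le (y : R -> Omega -> X -> R)
    (a2 : R -> Omega -> X * V -> R) :
  L2FC P B T D (sqnorm_GS G) y -> LinftyFC P B T (closure G `*` S `*` S) a2 ->
  exists2 K, {ae P, forall w, \int[leb]_(s in `[0, T]) \int[mu_GS (d:=d)]_(z in D)
       ((\int[sigma]_(v in S) (a2 s w (z, v) * y s w (z.1, v))) * g z) = K w} &
    correlation_decay P B T K.
Proof.
move=> yFC [aa2 _ [M a2M]].
have [ay yfin _] := yFC.
have mG : measurable G by exact: open_measurable_rV.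
have mK : measurable (closure G `*` S `*` S).
  do 2 apply: measurableX => //.
  by apply: closed_measurable_rV; exact: closed_closure.
have D2K : D2 `<=` closure G `*` S `*` S.
  by move=> [[x u] v] [[/= Gx Su] Sv]; split => //; split => //; exact: subset_closure.
have mr : measurable_fun setT (fun p : X * V => (p.1.1, p.2)).
  apply/measurable_fun_pairP; split; last exact: measurable_snd.
  exact: measurableT_comp measurable_fst measurable_fst.
pose y' s w (p : X * V) := y s w (p.1.1, p.2).
have ay' : adapted_process P B T D2 y'.
  apply: (adapted_process_comp (r := fun p : X * V => (p.1.1, p.2)) mD mD2 mr _ ay).
  by move=> [[x u] v] [[/= Gx Su] Sv].
have IT s : (`[0, T]%classic : set R) s -> 0 <= s <= T by rewrite /= in_itv.
have L2y' : L2_process P B T m2 D2 y'.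
  split; first exact: ay'.
  have [_ yoo] := L2FC_L2 G_open T0 yFC.
  have mE := measurable_expected_sq_norm m mD ay.
  rewrite (_ : (\int[leb]_(s in _) _)%E =
     (\int[leb]_(s in `[0%R, T]) (sigma S * \int[P]_w sq_norm m D y s w))%E).
    rewrite ge0_integralZl//.
      by apply: lte_mul_pinfty => //; rewrite ge0_fin_numE ?sphere_measure_lty.
    by move=> s _; apply: integral_ge0 => w _; exact: sq_norm_ge0.
  apply: eq_integral => s; rewrite inE => /IT sT.
  transitivity (\int[P]_w (sigma S * sq_norm m D y s w))%E.
    apply: eq_integral => w _; apply: sq_norm_outgoing.
    exact: (measurable_process_section mD _ ay sT).
  rewrite ge0_integralZl//; first exact: (measurable_sq_norm_section m mD ay sT).
  by move=> w _; exact: sq_norm_ge0.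
have aa2' : adapted_process P B T D2 a2.
  exact: (adapted_processS mK mD2 D2K aa2).
pose F s w p := a2 s w p * y' s w p.
have aF : adapted_process P B T D2 F by exact: adapted_processM aa2' ay'.
have L2F : L2_process P B T m2 D2 F.
  apply: (L2_process_le mD2 (k := `|M|) aF L2y') => //.
  apply: aeW => s sT; move: a2M; apply: filterS => w a2M.
  apply: aeW => z Dz; rewrite normrM ler_wpM2r//.
  by rewrite (le_trans (a2M s sT z (D2K _ Dz)))// ler_norm.
have mg' : measurable_fun setT (fun p : X * V => g p.1).
  exact: measurableT_comp mg measurable_fst.
have gM' (p : X * V) : D2 p -> `|g p.1| <= Mg by move=> [Dp _]; exact: gM.
have L2Phi := L2_mul_space mD2 mg' gM' L2F.
have [K EK decK] := integral_incr_sg_drift_le P_complete B_bm mD2 m2D2oo L2Phi.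
exists K; last exact: decK.
move: EK; apply: filterS3 yfin a2M => w yw aw <-.
apply: eq_Rintegral => s; rewrite inE => /IT sT.
have mys := measurable_process_section mD w ay sT.
have sqy : (\int[m2]_(p in D2) (y' s w p ^+ 2)%:E < +oo)%E.
  have -> : (\int[m2]_(p in D2) (y' s w p ^+ 2)%:E = sigma S * sq_norm m D y s w)%E.
    exact: sq_norm_outgoing.
  apply: lte_mul_pinfty => //; first by rewrite ge0_fin_numE ?sphere_measure_lty.
  by have [] := yw s sT.
have Fi : m2.-integrable D2 (fun p => (F s w p)%:E).
  apply: (@integrable_bounded_mul _ _ _ m2 D2 M) => //.
  - exact: (measurable_process_section mD2 _ aa2' sT).
  - by move=> p /D2K; exact: aw.
  - by apply: integrable_sq sqy => //; exact: (measurable_process_section mD2 _ ay' sT).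
have Gi : m2.-integrable D2 (fun p => (F s w p * g p.1)%:E).
  rewrite (_ : (fun p => _) = (fun p => (g p.1 * F s w p)%:E)); last first.
    by apply/funext => p; rewrite mulrC.
  apply: (@integrable_bounded_mul _ _ _ m2 D2 Mg) => //.
  exact: measurable_funTS.
apply/esym; apply: (Rintegral_fubini_onM mD mS _ Fi Gi).
exact: measurable_funTS.
Qed.

End terms.

Section ito_term.
Context (R : realType) (d : nat) (G : set 'rV[R]_d).
Hypotheses (G_open : open G) (G_bounded : bounded_set G).
Context (dO : measure_display) (Omega : measurableType dO).
Context (P : probability Omega R) (B : R -> Omega -> R).
Hypotheses (P_complete : measure_is_complete P) (B_bm : brownian_motion P B).
Variable T : R.
Hypothesis T0 : 0 < T.
Local Notation V := 'rV[R]_d.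
Local Notation X := (V * V)%type.
Local Notation leb := (@lebesgue_measure R).
Local Notation D := (GS G).
Local Notation m := (@mu_GS_sigma_finite R d).
Variables (g : X -> R) (Mg : R).
Hypotheses (mg : measurable_fun setT g) (gM : forall z, D z -> `|g z| <= Mg).

Let mD : measurable D. Proof. exact: measurable_GS. Qed.
Let mDoo : (m D < +oo)%E. Proof. exact: (mu_GS_lty G_open G_bounded). Qed.

(** The energy of the integrand after the time [t] is at most [kappa * (T - t)], so
    [e = Num.sqrt (T - t)] balances the two terms of [integral_incr_sg_ito_le]. *)
Lemma integral_incr_sg_diffusion_le (y a3 : R -> Omega -> X -> R) (Z : Omega -> R) :
  L2FC P B T D (sqnorm_GS G) y -> LinftyF P B T D (@mu_GS R d) a3 ->
  is_ito_integral P B T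
    (fun s w => \int[mu_GS (d:=d)]_(z in D) (a3 s w z * y s w z * g z)) Z ->
  correlation_decay P B T Z.
Proof.
move=> yFC [aa3 [M a3M]] ito.
have [ay _ _] := yFC.
have [K K0 yK] := L2FC_sup_expected T0 yFC.
have [mh _ _] := ito.
pose F s w z := a3 s w z * y s w z * g z.
pose h s w := \int[m]_(z in D) F s w z.
have aF : adapted_process P B T D F.
  by apply: adapted_process_mul_space => //; exact: adapted_processM aa3 ay.
(* The constant of sq_Rintegral_le. *)
pose c := 4 * (fine (m D) + 1).
have c0 : 0 <= c by rewrite mulr_ge0// addr_ge0// fine_ge0.
pose k := `|M| * `|Mg|.
pose kappa := c * (k ^+ 2 * K).
have kappa0 : 0 <= kappa by exact: mulr_ge0 c0 (mulr_ge0 (sqr_ge0 _) K0).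
have hE s : 0 <= s <= T ->
    (\int[P]_w (h s w ^+ 2)%:E <= c%:E * \int[P]_w sq_norm m D F s w)%E.
  move=> sT; rewrite -ge0_integralZl//.
  - apply: le_integral_ge0 => w; first by rewrite lee_fin sqr_ge0.
    exact: (sq_Rintegral_le mD mDoo (measurable_process_section mD w aF sT)).
  - exact: (measurable_sq_norm_section m mD aF sT).
  - by move=> w _; exact: sq_norm_ge0.
have FE : {ae leb, forall s, 0 <= s <= T ->
    (\int[P]_w (h s w ^+ 2)%:E <= kappa%:E)%E}.
  move: a3M; apply: (@filterS _ _ (ae_filter_ringOfSetsType leb)) => s + sT => /(_ sT) a3M.
  apply: (le_trans (hE s sT)); rewrite (EFinM c (k ^+ 2 * K) : kappa%:E = _).
  apply: lee_wpmul2l; first by rewrite lee_fin.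
  have k0 : 0 <= k by rewrite mulr_ge0.
  apply: (@le_trans _ _ ((k ^+ 2)%:E * \int[P]_w sq_norm m D y s w)%E).
    apply: (expected_sq_norm_le mD aF ay sT k0).
    move: a3M; apply: filterS => w; apply: filterS => z + Dz => /(_ Dz) a3M.
    rewrite /F /k !normrM mulrAC ler_wpM2r// ler_pM//.
      by rewrite (le_trans a3M)// ler_norm.
    by rewrite (le_trans (gM Dz))// ler_norm.
  by rewrite (EFinM (k ^+ 2) K); apply: lee_wpmul2l; [rewrite lee_fin sqr_ge0|exact: yK].
have energy t : 0 <= t < T ->
    (\int[P]_w \int[leb]_(s in `]t, T]) (h s w ^+ 2)%:E <= (kappa * (T - t))%:E)%E.
  move=> /andP[t0 tT].
  pose J := `]t, T]%classic : set (measurableTypeR R).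
  have mJ : measurable J by exact: measurable_itv.
  have JT s : J s -> 0 <= s <= T.
    by rewrite /J /= in_itv/= => /andP[ts ->]; rewrite andbT (le_trans t0)// ltW.
  have mh2 : measurable_fun (J `*` [set: Omega]) (fun p => (h p.1 p.2 ^+ 2)%:E).
    apply/measurable_EFinP; apply: measurable_funX.
    apply: measurable_funS mh; first by apply: measurableX => //; exact: measurable_itv.
    by move=> [s w] [/JT sT _]; split => //=; rewrite in_itv.
  have := @tonelli_on _ _ _ _ _ leb P J setT _ mJ measurableT mh2.
  move=> <-; last by move=> p _; rewrite lee_fin sqr_ge0.
  have mEh : measurable_fun J (fun s => \int[P]_w (h s w ^+ 2)%:E)%E.
    apply: (@measurable_integral_section1 _ _ _ _ _ P J setT _ mJ measurableT mh2).
    by move=> p _; rewrite lee_fin sqr_ge0.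
  apply: (@le_trans _ _ (\int[leb]_(s in J) cst kappa%:E s)%E).
    apply: (ae_ge0_le_integral mJ).
    - by move=> s _; apply: integral_ge0 => w _; rewrite lee_fin sqr_ge0.
    - exact: mEh.
    - by move=> s _; rewrite lee_fin.
    - exact: measurable_cst.
    - by move: FE; apply: (@filterS _ _ (ae_filter_ringOfSetsType leb)) => s + /JT.
  have lJ : leb `]t, T]%classic = (T - t)%:E.
    by rewrite lebesgue_measure_itv/= lte_fin tT -EFinB.
  by rewrite integral_cst// [X in (_ * X)%E](lJ) -EFinM.
have key t t' : 0 <= t < T -> t < t' ->
    P.-integrable setT (EFin \o Z) /\
    (`|\int[P]_w (incr_sg B t t' w * Z w)%:E| <=
       ((19 + 16 * kappa) * Num.sqrt (T - t))%:E)%E.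
  move=> tT tt'; have /andP[t0 tT'] := tT.
  have e0 : 0 < Num.sqrt (T - t) by rewrite sqrtr_gt0 subr_gt0.
  have tT2 : 0 <= t <= T by rewrite t0 ltW.
  have [iZ leZ] := integral_incr_sg_ito_le P_complete B_bm tT2 tt' e0 ito (energy t tT).
  split; first exact: iZ.
  apply: (le_trans leZ); rewrite lee_fin.
  have Tt0 : 0 <= T - t by rewrite subr_ge0 ltW.
  move: (sqr_sqrtr Tt0) e0; move: (Num.sqrt _) => e <- e0.
  by rewrite le_eqVlt; apply/orP; left; apply/eqP; field; rewrite gt_eqF.
split; last by exists (19 + 16 * kappa) => t t' tT tt'; have [] := key t t' tT tt'.
have h0T : (0 : R) <= 0 < T by apply/andP; split.
by have [] := key 0 T h0T T0.
Qed.

End ito_term.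

(** * Lack of exact controllability *)

Theorem theorem1p4 (R : realType) (d : nat) (d_gt0 : (0 < d)%N)
  (G : set 'rV[R]_d) (G_domain : strictly_convex_C1_domain G)
  (dO : measure_display) (Omega : measurableType dO) (P : probability Omega R)
  (P_complete : measure_is_complete P)
  (B : R -> Omega -> R) (B_brownian : brownian_motion P B)
  (T : R) (T_gt0 : 0 < T)
  (a1 a3 : R -> Omega -> 'rV[R]_d * 'rV[R]_d -> R)
  (a1_Linfty : LinftyF P B T (GS G) (@mu_GS R d) a1)
  (a3_Linfty : LinftyF P B T (GS G) (@mu_GS R d) a3)
  (a2 : R -> Omega -> 'rV[R]_d * 'rV[R]_d * 'rV[R]_d -> R)
  (a2_LinftyC :
     LinftyFC P B T (closure G `*` @sphere R d `*` @sphere R d) a2)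
  (f : R -> Omega -> 'rV[R]_d * 'rV[R]_d -> R)
  (f_L2 : L2F P B T (GS G) (sqnorm_GS G) f) :
  ~ exactly_controllable G P B T a1 a2 a3 f.

Proof.
move=> ctrl.
have [G_ne G_open _ G_bounded _ _] := G_domain.
have [c [r [r0 ballG]]] := open_euclidean_ball G_open G_ne.
pose phi := bump_test c r.
pose D := GS G.
pose m := @mu_GS_sigma_finite R d.
have mD : measurable D by exact: measurable_GS.
have mDoo : (m D < +oo)%E by exact: (mu_GS_lty G_open G_bounded).
have mphi : measurable_fun setT phi.
  by apply: (measurableT_comp (measurable_bump c r)); exact: measurable_fst.
have phi_le z : `|phi z| <= r ^+ 2 by exact: bump_le.
have phi_le_on z : D z -> `|phi z| <= r ^+ 2 by [].
have mphiD : measurable_fun D phi by exact: measurable_funTS.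
pose c0 := \int[m]_(z in D) (phi z * phi z).
have phi2i : m.-integrable D (fun z => (phi z * phi z)%:E).
  apply: (integrable_bounded_mul mD mphiD phi_le_on).
  exact: bounded_integrable mD mDoo mphiD phi_le_on.
have c0_gt0 : 0 < c0.
  rewrite -lte_fin fineK; last exact: (integrable_fin_num mD phi2i).
  exact: (bump_test_sq_integral_gt0 r0 G_open ballG d_gt0).
pose xi := sign_series B T.
have axi : measurable_fun [set: filtration P B T] xi by exact: sign_series_adapted.
(* The state that is out of reach from the initial state 0. *)
pose y1 w z := xi w * phi z.
have my1 w : measurable_fun D (y1 w) by apply: measurable_funM.
have L2y0 : L2_GS G (cst 0).
  split; first exact: measurable_cst.
  rewrite /sqnorm_GS (_ : (\int[_]_(_ in _) _)%E = 0%E)//.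
  by apply: integral0_eq => z _; rewrite expr0n.
have L2y1 : L2Omega P B T (GS G) (sqnorm_GS G) y1.
  split.
    apply: measurable_funM.
      apply: (measurable_comp measurableT _ axi) => //.
      by apply: measurable_funTS; exact: measurable_fst.
    by apply: measurable_funTS; apply: (measurableT_comp mphi); exact: measurable_snd.
  pose M := (3 / 2 * r ^+ 2) ^+ 2.
  have M0 : 0 <= M by exact: sqr_ge0.
  apply: (@le_lt_trans _ _ (\int[P]_w cst (M%:E * m D) w)%E).
    apply: le_integral_ge0 => w.
      by apply: integral_ge0 => z _; rewrite lee_fin sqr_ge0.
    rewrite -(integral_cst m mD); apply: ge0_le_integral => //.
    - by move=> z _; rewrite lee_fin sqr_ge0.
    - by apply/measurable_EFinP; apply: measurable_funX.
    - move=> z _; rewrite lee_fin -[leLHS]real_normK ?num_real//.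
      rewrite lerXn2r ?nnegrE//; first by rewrite mulr_ge0// sqr_ge0.
      by rewrite normrM ler_pM//; exact: sign_series_le.
  rewrite integral_cst// [X in (_ * X)%E](@probability_setT _ _ _ P) mule1.
  by apply: lte_mul_pinfty => //; rewrite lee_fin.
have [u [l [y [L2u L2l [yFC sol] yT]]]] := ctrl _ L2y0 _ L2y1.
have TT : 0 <= T <= T by rewrite lexx (ltW T_gt0).
have phi_test : test_function G phi by exact: test_function_bump_test.
have [Z [ito eqT]] := sol T TT phi phi_test.
have [ay _ _] := yFC.
have L2y := L2FC_L2 G_open T_gt0 yFC.
have L2f := L2F_L2 G_open f_L2.
have L2l' := L2F_L2 G_open L2l.
have mtr := measurable_transport_bump_test c r.
have tr_le z : D z -> `|transport phi z| <= d%:R * (4 * r * (1 + r)).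
  by move=> [_ Sz]; exact: transport_bump_test_le.
have L2tr := L2_mul_space mD mtr tr_le L2y.
have [K1 E1 dec1] := integral_incr_sg_drift_le P_complete B_brownian mD mDoo L2tr.
have a1m : LinftyF P B T D m a1 := a1_Linfty.
have L2src := L2_mul_space mD mphi phi_le_on
  (L2_processD mD (L2_processD mD (L2_mulLinfty mD a1m L2y) L2f) L2l').
have [K2 E2 dec2] := integral_incr_sg_drift_le P_complete B_brownian mD mDoo L2src.
have [K3 E3 dec3] := integral_incr_sg_scattering_le G_open G_bounded P_complete
  B_brownian T_gt0 mphi phi_le_on yFC a2_LinftyC.
have dec4 := integral_incr_sg_diffusion_le G_open G_bounded P_complete B_brownian
  T_gt0 mphi phi_le_on yFC a3_Linfty ito.
have dec := correlation_decayD B_brownian (correlation_decayD B_brownian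
  (correlation_decayD B_brownian dec1 dec2) dec3) dec4.
apply: (sign_series_not_decay P_complete B_brownian T_gt0 c0_gt0 _ dec).
have yTE : {ae P, forall w, \int[m]_(z in D) (y T w z * phi z) = c0 * xi w}.
  move: yT; apply: filterS => w yTw.
  transitivity (\int[m]_(z in D) (xi w * (phi z * phi z))).
    congr fine; apply: ae_eq_integral => //.
    - apply/measurable_EFinP; apply: measurable_funM => //.
      exact: (measurable_process_section mD w ay TT).
    - by apply/measurable_EFinP; do 2 apply: measurable_funM => //.
    - move: yTw; apply: filterS => z h Dz; congr EFin.
      by rewrite (h Dz) /y1 mulrA.
  by rewrite RintegralZl// mulrC.
have y0E : \int[mu_GS (d:=d)]_(z in GS G) (cst 0 z * phi z) = 0.
  by apply: Rintegral_eq0 => z _; rewrite mul0r.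
have uE w : \int[lebesgue_measure]_(s in `[0, T]) fine
    (\int[@mu_GammaS R d]_(z in GammaS_minus G)
       (u s w z * phi z * normal_speed G z)%:E)%E = 0.
  apply: Rintegral_eq0 => s _; apply: fine_integral_eq0 => z [bz _ _].
  by rewrite [phi z](bump_test_boundary G_open ballG bz) mulr0 mul0r.
have balance : {ae P, forall w, c0 * xi w - K1 w = K2 w + K3 w + Z w}.
  apply: (filterS3 _ _ eqT (filterI yTE E1) (filterI E2 E3)) => w + [yTw e1] [e2 e3].
  rewrite y0E uE subr0 addr0 [X in X - _](yTw) [X in _ - X](e1).
  by rewrite [X in X + _ + _](e2) [X in _ + X + _](e3).
by apply: filterS balance => w; rewrite -/xi => h; lra.
Qed.
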